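(* Let $a>b>0$ be arbitrary but fixed and let $x_1,x_2,p_1,p_2>0$ be such that $\mathcal{B}^{p_1,p_2}_{x_1,x_2}\left(\frac{a}{b}\right)>\frac{b}{a}$, where $$\mathcal{B}^{p_1,p_2}_{x_1,x_2}(q):=\frac{2M(p_1,x_1)+2M(p_2,x_2)-N(p_1,x_1)-N(p_2,x_2)}{G(p_1,x_1)\cdot q+G(p_2,x_2)},\qquad q>1.$$ Then a travelling wave solution of $$u_{tt}+u_{xxxx}+au^+-bu^-=1\ \ (x\in\mathbb{R},\,t>0),\qquad u(x,t)\to 1/a,\ u_x(x,t)\to 0\ \text{ for } |x|\to+\infty,$$ exists for any wave speed $c$ satisfying $$|c|\in\left(\sqrt[4]{\frac{4b}{\mathcal{B}^{p_1,p_2}_{x_1,x_2}(a/b)}},\ \sqrt[4]{4a}\right).$$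
   Context: Here $u^{\pm}=\max\{\pm u,0\}$, so $u=u^+-u^-$. A travelling wave solution with wave speed $c$ is a (classical) solution of the problem $$u_{tt}+u_{xxxx}+au^+-bu^-=1\ \ (x\in\mathbb{R},\,t>0),\qquad u(x,t)\to 1/a,\ u_x(x,t)\to 0\ \text{ for } |x|\to+\infty,$$ of the form $u(x,t)=y(x-ct)$ which is nontrivial, i.e. $y\not\equiv 1/a$; equivalently, $z=y-1/a$ is a nontrivial solution of $z^{(4)}+c^2z''+a(z+1/a)^+-b(z+1/a)^--1=0$ on $\mathbb{R}$ with $z,z'\to0$ as $|s|\to+\infty$. For $p,x>0$, the functions $G,M,N$ are $$G(p,x):=\frac{(px^2+1)^2\left(\sqrt{p}\,x(px^2+3)+(px^2-3)(px^2+1)\arctan(\sqrt{p}\,x)\right)}{4\sqrt{p^5}\,x^2},$$ $$M(p,x):=\frac{(px^2+1)\left(\sqrt{p}\,x(px^2+3)(3px^2-1)+3(px^2+1)^3\arctan(\sqrt{p}\,x)\right)}{24\sqrt{p^3}\,x^2},$$ $$N(p,x):=\frac{\sqrt{p}\,x\left(15p^4x^8+70p^3x^6+128p^2x^4+10px^2+65\right)+15(px^2+1)^5\arctan(\sqrt{p}\,x)}{40\sqrt{p}\,x^2(px^2+1)}.$$ *)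

(* Defs.v *)
From Stdlib Require Import Reals Lra.
From Coquelicot Require Import Coquelicot.
Open Scope R_scope.

Definition pos_part (r : R) : R := Rmax r 0.
Definition neg_part (r : R) : R := Rmax (- r) 0.

(* Fourth root; only used at positive arguments. *)
Definition root4 (r : R) : R := sqrt (sqrt r).

Definition Gfun (p x : R) : R :=
  (p * x ^ 2 + 1) ^ 2 *
    (sqrt p * x * (p * x ^ 2 + 3)
     + (p * x ^ 2 - 3) * (p * x ^ 2 + 1) * atan (sqrt p * x))
  / (4 * sqrt (p ^ 5) * x ^ 2).

Definition Mfun (p x : R) : R :=
  (p * x ^ 2 + 1) *
    (sqrt p * x * (p * x ^ 2 + 3) * (3 * p * x ^ 2 - 1)
     + 3 * (p * x ^ 2 + 1) ^ 3 * atan (sqrt p * x))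
  / (24 * sqrt (p ^ 3) * x ^ 2).

Definition Nfun (p x : R) : R :=
  (sqrt p * x *
     (15 * p ^ 4 * x ^ 8 + 70 * p ^ 3 * x ^ 6 + 128 * p ^ 2 * x ^ 4
      + 10 * p * x ^ 2 + 65)
   + 15 * (p * x ^ 2 + 1) ^ 5 * atan (sqrt p * x))
  / (40 * sqrt p * x ^ 2 * (p * x ^ 2 + 1)).

Definition Bfun (p1 p2 x1 x2 q : R) : R :=
  (2 * Mfun p1 x1 + 2 * Mfun p2 x2 - Nfun p1 x1 - Nfun p2 x2)
  / (Gfun p1 x1 * q + Gfun p2 x2).

Definition d_x (k : nat) (u : R -> R -> R) (x t : R) : R :=
  Derive_n (fun s => u s t) k x.
Definition d_t (k : nat) (u : R -> R -> R) (x t : R) : R :=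
  Derive_n (fun s => u x s) k t.

(* u has, on the open half-plane t > 0, x-derivatives up to order 4 and
   t-derivatives up to order 2, all jointly continuous. Every order is listed
   because [ex_derive_n f n] alone says nothing about the lower orders. *)
Definition classical_regularity (u : R -> R -> R) : Prop :=
  forall x t : R, 0 < t ->
    (forall k : nat, (k <= 4)%nat ->
       ex_derive_n (fun s => u s t) k x /\ continuity_2d_pt (d_x k u) x t) /\
    (forall k : nat, (k <= 2)%nat ->
       ex_derive_n (fun s => u x s) k t /\ continuity_2d_pt (d_t k u) x t).

Definition beam_equation (a b : R) (u : R -> R -> R) : Prop :=
  forall x t : R, 0 < t ->
    d_t 2 u x t + d_x 4 u x t + a * pos_part (u x t) - b * neg_part (u x t) = 1.

Definition beam_boundary_conditions (a : R) (u : R -> R -> R) : Prop :=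
  forall t : R, 0 < t ->
    is_lim (fun x => u x t) p_infty (1 / a) /\
    is_lim (fun x => u x t) m_infty (1 / a) /\
    is_lim (fun x => d_x 1 u x t) p_infty 0 /\
    is_lim (fun x => d_x 1 u x t) m_infty 0.

(* Values of u at t <= 0 are irrelevant. *)
Definition travelling_wave_solution (a b c : R) (u : R -> R -> R) : Prop :=
  classical_regularity u /\
  beam_equation a b u /\
  beam_boundary_conditions a u /\
  exists y : R -> R,
    (forall x t : R, 0 < t -> u x t = y (x - c * t)) /\
    (exists s : R, y s <> 1 / a).

(* Main.v *)
Require Import Defs.
From mathcomp Require filter.
From Stdlib Require Import Reals Lra Lia ZArith Classical IndefiniteDescription.
From Coquelicot Require Import Coquelicot.
Open Scope R_scope.

(** Write y for the profile, g = a - b, u = 1/a - y and V = g (u - 1/a)^+, which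
    is g y^-. The travelling wave equation becomes
      u'''' + c^2 u'' + a u = V.
    As c^4 < 4 a, the operator on the left has an exponentially decaying Green
    function K, so what is needed is a nonzero solution of u = K * V with V
    integrable: integrability of V then gives the decay of u and u'.

    Consider the quadratic form
      q(v) = int v^2 - g int int K(x - y) v(x) v(y) dx dy
    on probability densities v >= 0. At a minimiser the first order conditions read
      v - g K * v >= q(v), with equality where v > 0,
    and if q(v) < 0, the multiple of v by -1/(a q(v)) solves
    w = (g K * w - 1/a)^+, that is, V = g w solves the problem. Two points remain.

    Existence in spite of the translation invariance. The form is discretised with
    mass points on a grid. On a finite window of the grid a minimiser exists, and a
    window on which the minimum is close to the infimum over all windows satisfies
    the first order conditions approximately at every grid point
    ([complementarity_solution], [grid_solution]). The total mass of the rescaled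
    minimiser is controlled by the upper bound on q, so the resulting
    functions u are bounded and equi-Lipschitz. Each is translated so that it
    exceeds 1/a at the origin, and a limit along a free ultrafilter solves the
    integral equation, with a nonzero V of finite mass ([grid_compactness]). The
    explicit form of K turns the integral equation into the differential equation
    and yields the decay at infinity ([integral_equation_ode]).

    Negativity of q. Let f(s) = (1 + p x^2) (x^2 - s^2) / (2 x (1 + p s^2)). Then
    G, M and N are the integrals over [-x, x] of f^2, f'^2 and f''^2
    ([mass_scaled], [slope_scaled], [curvature_scaled]). Let phi consist of n periods, each made of
    one negative and one positive such bump, glued with slopes -1 and 1, in the
    variable |c| s / sqrt 2. The hypothesis c^4 B(a/b) > 4 b says that
      int phi''^2 - c^2 phi'^2 + a (phi^+)^2 + b (phi^-)^2,
    with the signs of the bumps exchanged, is negative over one period. Take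
    v = phi^+ and u = K * v. The quadratic form of the beam operator is
    nonnegative at g u - phi, up to boundary terms which stay bounded in n. Expanding
    it gives int (g u v - v^2) > 0 for n large, that is, q(v) < 0
    ([energy_step], [train_form_positive]). *)

(** * Ultralimits and sums over integer windows *)

Definition free_ultrafilter (U : (nat -> Prop) -> Prop) : Prop :=
  ProperFilter U /\
  (forall P, U P \/ U (fun n => ~ P n)) /\
  (forall P, eventually P -> U P).

(** Limits along a free ultrafilter replace every extraction of subsequences: all
    bounded sequences converge at once. *)
Lemma free_ultrafilter_exists : exists U, free_ultrafilter U.
Proof.
  assert (HF : @filter.ProperFilter nat (@eventually)).
  { constructor.
    - intros [N HN]. exact (HN N (Nat.le_refl N)).
    - constructor.
      + exists 0%nat. intros n _. exact I.
      + intros P Q HP HQ. exact (filter_and _ _ HP HQ).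
      + intros P Q HPQ HP. exact (filter_imp _ _ HPQ HP). }
  destruct (filter.ultraFilterLemma HF) as [U [HU Hsub]].
  exists U. split; [|split].
  - destruct HU as [[Hne [HT HI HS]] _]. constructor.
    + intros P HP. apply NNPP. intros Hn. apply Hne.
      apply (HS P); [|exact HP]. intros n Pn. apply Hn. now exists n.
    + constructor.
      * exact HT.
      * intros P Q HP HQ. exact (HI P Q HP HQ).
      * intros P Q HPQ HP. exact (HS P Q HPQ HP).
  - intros P. exact (filter.in_ultra_setVsetC P HU).
  - exact Hsub.
Qed.

(** The limit is the supremum of the x that lie below [f n] for almost all n. *)
Lemma ultralimit_exists (U : (nat -> Prop) -> Prop) (f : nat -> R) (M : R) :
  free_ultrafilter U -> (forall n, Rabs (f n) <= M) ->
  exists l, filterlim f U (locally l).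
Proof.
  intros [HP [HV _]] Hf.
  destruct (completeness (fun x => U (fun n => x <= f n))) as [l [Hub Hlub]].
  - exists M. intros x Hx.
    destruct (filter_ex _ Hx) as [n Hn]. generalize (Hf n).
    intros H. apply Rabs_le_between in H. lra.
  - exists (- M). apply filter_forall. intros n. generalize (Hf n).
    intros H. apply Rabs_le_between in H. lra.
  - exists l. apply filterlim_locally. intros eps.
    assert (H1 : U (fun n => f n < l + eps)).
    { destruct (HV (fun n => l + eps <= f n)) as [H|H].
      - specialize (Hub _ H). destruct eps as [e He]; simpl in Hub. lra.
      - revert H. apply filter_imp. intros n Hn. lra. }
    assert (H2 : U (fun n => l - eps < f n)).
    { apply NNPP. intros Hn.
      assert (Hb : l <= l - eps); [|destruct eps as [e He]; simpl in Hb; lra].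
      apply Hlub. intros x Hx.
      destruct (Rle_or_lt x (l - eps)) as [H|H]; [exact H|].
      exfalso. apply Hn. revert Hx. apply filter_imp. intros n. lra. }
    generalize (filter_and _ _ H1 H2). apply filter_imp. intros n [Ha Hb].
    unfold ball; simpl; unfold AbsRing_ball, abs, minus, plus, opp; simpl.
    apply Rabs_def1; lra.
Qed.

Lemma filterlim_Rplus {T} (F : (T -> Prop) -> Prop) {FF : Filter F} f g a b :
  filterlim f F (locally a) -> filterlim g F (locally b) ->
  filterlim (fun n => f n + g n) F (locally (a + b)).
Proof.
  intros Hf Hg. exact (filterlim_comp_2 _ _ Rplus Hf Hg (filterlim_plus a b)).
Qed.

Lemma filterlim_Rmult {T} (F : (T -> Prop) -> Prop) {FF : Filter F} f g a b :
  filterlim f F (locally a) -> filterlim g F (locally b) ->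
  filterlim (fun n => f n * g n) F (locally (a * b)).
Proof.
  intros Hf Hg. exact (filterlim_comp_2 _ _ Rmult Hf Hg (filterlim_mult a b)).
Qed.

(** The sum over -N <= k < N. Growing the window at both ends keeps the windows
    nested and exhausts the integers; the half-open range matches the cells of the
    interval [-N h, N h] in Riemann sums. *)
Fixpoint window_sum (N : nat) (f : Z -> R) : R :=
  match N with
  | O => 0
  | S M => f (- Z.of_nat (S M))%Z + window_sum M f + f (Z.of_nat M)
  end.

Definition in_window (N : nat) (k : Z) : Prop :=
  (- Z.of_nat N <= k < Z.of_nat N)%Z.

Lemma in_window_dec N k : {in_window N k} + {~ in_window N k}.
Proof.
  unfold in_window.
  destruct (Z_le_dec (- Z.of_nat N) k), (Z_lt_dec k (Z.of_nat N));
    [left; lia | right; lia ..].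
Qed.

Lemma window_sum_ext N f g : (forall k, in_window N k -> f k = g k) -> window_sum N f = window_sum N g.
Proof.
  unfold in_window. induction N as [|N IH]; intros H; [reflexivity|].
  cbn [window_sum]. rewrite IH, (H (- Z.of_nat (S N))%Z), (H (Z.of_nat N)); try lia.
  - reflexivity.
  - intros k Hk. apply H. lia.
Qed.

Lemma window_sum_plus N f g : window_sum N (fun k => f k + g k) = window_sum N f + window_sum N g.
Proof. induction N as [|N IH]; cbn [window_sum]; [|rewrite IH]; ring. Qed.

Lemma window_sum_scal N c f : window_sum N (fun k => c * f k) = c * window_sum N f.
Proof. induction N as [|N IH]; cbn [window_sum]; [|rewrite IH]; ring. Qed.

Lemma window_sum_zero N : window_sum N (fun _ => 0) = 0.
Proof. induction N as [|N IH]; cbn [window_sum]; [|rewrite IH]; ring. Qed.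

Lemma window_sum_const N c : window_sum N (fun _ => c) = 2 * INR N * c.
Proof.
  induction N as [|N IH]; [simpl; ring|]. cbn [window_sum].
  rewrite IH, S_INR. ring.
Qed.

Lemma window_sum_le N f g : (forall k, in_window N k -> f k <= g k) -> window_sum N f <= window_sum N g.
Proof.
  unfold in_window. induction N as [|N IH]; intros H; [apply Rle_refl|].
  cbn [window_sum].
  generalize (H (- Z.of_nat (S N))%Z ltac:(lia)) (H (Z.of_nat N) ltac:(lia)).
  assert (window_sum N f <= window_sum N g) by (apply IH; intros k Hk; apply H; lia). lra.
Qed.

Lemma window_sum_abs N f : Rabs (window_sum N f) <= window_sum N (fun k => Rabs (f k)).
Proof.
  induction N as [|N IH]; cbn [window_sum]; [rewrite Rabs_R0; apply Rle_refl|].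
  eapply Rle_trans; [apply Rabs_triang|]. apply Rplus_le_compat_r.
  eapply Rle_trans; [apply Rabs_triang|]. lra.
Qed.

Lemma window_sum_swap N M (f : Z -> Z -> R) :
  window_sum N (fun i => window_sum M (fun j => f i j)) = window_sum M (fun j => window_sum N (fun i => f i j)).
Proof.
  induction N as [|N IH]; cbn [window_sum]; [now rewrite window_sum_zero|].
  rewrite IH, !window_sum_plus. reflexivity.
Qed.

Lemma window_sum_extend N M f : (N <= M)%nat ->
  (forall k, ~ in_window N k -> f k = 0) -> window_sum M f = window_sum N f.
Proof.
  intros H Hf. induction H as [|M H IH]; [reflexivity|].
  cbn [window_sum]. rewrite IH, !Hf by (unfold in_window; lia). ring.
Qed.

Lemma window_sum_delta N i f : in_window N i ->
  window_sum N (fun k => if Z.eq_dec k i then f k else 0) = f i.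
Proof.
  unfold in_window. induction N as [|N IH]; intros H; [lia|]. cbn [window_sum].
  destruct (Z.eq_dec (- Z.of_nat (S N)) i) as [E1|E1];
  destruct (Z.eq_dec (Z.of_nat N) i) as [E2|E2]; try lia.
  - rewrite (window_sum_ext N _ (fun _ => 0)), window_sum_zero, E1; [ring|].
    intros k Hk. unfold in_window in Hk. destruct (Z.eq_dec k i); [lia|reflexivity].
  - rewrite (window_sum_ext N _ (fun _ => 0)), window_sum_zero, E2; [ring|].
    intros k Hk. unfold in_window in Hk. destruct (Z.eq_dec k i); [lia|reflexivity].
  - rewrite IH by lia. ring.
Qed.

Lemma window_sum_term_le N f i : (forall k, 0 <= f k) -> in_window N i -> f i <= window_sum N f.
Proof.
  intros Hf Hi. rewrite <- (window_sum_delta N i f Hi). apply window_sum_le. intros k _.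
  destruct (Z.eq_dec k i); [apply Rle_refl|apply Hf].
Qed.

(** Writing each term as a sum against a Kronecker delta and exchanging the sums
    avoids any reindexing of the windows. *)
Lemma window_sum_shift N M i f : (forall k, ~ in_window N k -> f k = 0) ->
  (N + Z.abs_nat i <= M)%nat -> window_sum M (fun k => f (k + i)%Z) = window_sum N f.
Proof.
  intros Hf HM.
  rewrite (window_sum_ext M _ (fun k => window_sum N (fun j => if Z.eq_dec j (k + i) then f j else 0))).
  - rewrite window_sum_swap. apply window_sum_ext. intros j Hj.
    etransitivity; [|apply (window_sum_delta M (j - i) (fun _ => f j))].
    + apply window_sum_ext. intros k _.
      destruct (Z.eq_dec j (k + i)), (Z.eq_dec k (j - i)); (reflexivity || lia).
    + unfold in_window in *. lia.
  - intros k _. destruct (in_window_dec N (k + i)) as [H|H].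
    + now rewrite window_sum_delta.
    + rewrite (Hf _ H). rewrite (window_sum_ext N _ (fun _ => 0)), window_sum_zero; [reflexivity|].
      intros j Hj. destruct (Z.eq_dec j (k + i)) as [E|E]; [|reflexivity].
      subst j. contradiction.
Qed.

Lemma window_sum_filterlim {T} (F : (T -> Prop) -> Prop) {FF : Filter F} N (f : T -> Z -> R) g :
  (forall k, filterlim (fun n => f n k) F (locally (g k))) ->
  filterlim (fun n => window_sum N (f n)) F (locally (window_sum N g)).
Proof.
  intros H. induction N as [|N IH]; cbn [window_sum]; [apply filterlim_const|].
  apply filterlim_Rplus; [exact FF| |apply H].
  apply filterlim_Rplus; [exact FF|apply H|exact IH].
Qed.

Lemma filterlim_Rle {T} (F : (T -> Prop) -> Prop) {FF : ProperFilter F}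
  (f g : T -> R) (a b : R) : (forall n, f n <= g n) ->
  filterlim f F (locally a) -> filterlim g F (locally b) -> a <= b.
Proof.
  intros Hle Hf Hg.
  exact (@filterlim_le T F (Proper_StrongProper _ _) f g (Finite a) (Finite b)
           (filter_forall _ Hle) Hf Hg).
Qed.

Lemma filterlim_Req {T} (F : (T -> Prop) -> Prop) {FF : ProperFilter F}
  (f g : T -> R) (a b : R) : (forall n, f n = g n) ->
  filterlim f F (locally a) -> filterlim g F (locally b) -> a = b.
Proof.
  intros He Hf Hg. apply Rle_antisym.
  - apply (filterlim_Rle F f g); auto. intros n. rewrite He. apply Rle_refl.
  - apply (filterlim_Rle F g f); auto. intros n. rewrite He. apply Rle_refl.
Qed.

Lemma filterlim_inv_succ (U : (nat -> Prop) -> Prop) : free_ultrafilter U ->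
  filterlim (fun n => / INR (S n)) U (locally 0).
Proof.
  intros (HP & _ & HE). apply filterlim_locally. intros eps. apply HE.
  destruct (archimed_cor1 eps (cond_pos eps)) as [N [HN HN0]].
  exists N. intros n Hn. change (Rabs (/ INR (S n) - 0) < eps).
  assert (0 < / INR (S n)) by (apply Rinv_0_lt_compat, lt_0_INR; lia).
  rewrite Rminus_0_r, Rabs_pos_eq by lra.
  apply Rle_lt_trans with (2 := HN). apply Rinv_le_contravar.
  - apply lt_0_INR. lia.
  - apply le_INR. lia.
Qed.

(** * Minimisers of a quadratic form on a growing simplex *)

Definition apply_matrix (A : Z -> Z -> R) (N : nat) (m : Z -> R) (i : Z) : R :=
  window_sum N (fun j => A i j * m j).

Definition quad_form (A : Z -> Z -> R) (N : nat) (m : Z -> R) : R :=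
  window_sum N (fun i => m i * apply_matrix A N m i).

Definition simplex (N : nat) (m : Z -> R) : Prop :=
  (forall k, 0 <= m k) /\ (forall k, ~ in_window N k -> m k = 0) /\ window_sum N m = 1.

Definition unit_mass (i k : Z) : R := if Z.eq_dec k i then 1 else 0.

Lemma window_sum_unit_mass N i f : in_window N i -> window_sum N (fun k => unit_mass i k * f k) = f i.
Proof.
  intros Hi. rewrite <- (window_sum_delta N i f Hi) at 1. apply window_sum_ext. intros k _.
  unfold unit_mass. destruct (Z.eq_dec k i); ring.
Qed.

Lemma simplex_widen A N M m : (N <= M)%nat -> simplex N m ->
  simplex M m /\ (forall i, apply_matrix A M m i = apply_matrix A N m i) /\ quad_form A M m = quad_form A N m.
Proof.
  intros HNM (Hp & Hs & H1).
  assert (Ha : forall i, apply_matrix A M m i = apply_matrix A N m i).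
  { intros i. apply window_sum_extend; [exact HNM|]. intros k Hk. rewrite (Hs k Hk). ring. }
  split; [split; [exact Hp|split]|split; [exact Ha|]].
  - intros k Hk. apply Hs. unfold in_window in *. lia.
  - rewrite <- H1. now apply window_sum_extend.
  - unfold quad_form. rewrite (window_sum_extend N M); [|exact HNM|].
    + apply window_sum_ext. intros k _. now rewrite Ha.
    + intros k Hk. rewrite (Hs k Hk). ring.
Qed.

Lemma simplex_average N m f C : simplex N m ->
  (forall k, Rabs (f k) <= C) -> Rabs (window_sum N (fun k => m k * f k)) <= C.
Proof.
  intros (Hp & _ & H1) Hf. eapply Rle_trans; [apply window_sum_abs|].
  replace C with (C * window_sum N m) by (rewrite H1; ring). rewrite <- window_sum_scal.
  apply window_sum_le. intros k _. rewrite Rabs_mult, (Rabs_pos_eq _ (Hp k)), Rmult_comm.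
  apply Rmult_le_compat_r; [apply Hp|apply Hf].
Qed.

Lemma apply_matrix_bound A N m i C : simplex N m -> (forall i j, Rabs (A i j) <= C) ->
  Rabs (apply_matrix A N m i) <= C.
Proof.
  intros Hm HA. unfold apply_matrix.
  rewrite (window_sum_ext N _ (fun j => m j * A i j)) by (intros; ring).
  now apply simplex_average.
Qed.

Lemma quad_form_bound A N m C : simplex N m -> (forall i j, Rabs (A i j) <= C) ->
  Rabs (quad_form A N m) <= C.
Proof.
  intros Hm HA. apply simplex_average; [exact Hm|].
  intros k. now apply apply_matrix_bound.
Qed.

Lemma quad_form_towards_unit_mass A N m i e :
  (forall i j, A i j = A j i) -> in_window N i ->
  quad_form A N (fun k => (1 - e) * m k + e * unit_mass i k) =
  (1 - e) ^ 2 * quad_form A N m + 2 * e * (1 - e) * apply_matrix A N m i + e ^ 2 * A i i.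
Proof.
  intros Hsym Hi.
  assert (Ha : forall k, apply_matrix A N (fun k => (1 - e) * m k + e * unit_mass i k) k =
                         (1 - e) * apply_matrix A N m k + e * A k i).
  { intros k. unfold apply_matrix at 1.
    rewrite (window_sum_ext N _ (fun j => (1 - e) * (A k j * m j) + e * (unit_mass i j * A k j)))
      by (intros; ring).
    rewrite window_sum_plus, !window_sum_scal, window_sum_unit_mass by exact Hi. reflexivity. }
  unfold quad_form at 1.
  rewrite (window_sum_ext N _ (fun k =>
     ((1 - e) ^ 2 * (m k * apply_matrix A N m k) + e * (1 - e) * (A i k * m k)) +
     (e * (1 - e) * (unit_mass i k * apply_matrix A N m k) + e ^ 2 * (unit_mass i k * A k i)))).
  - rewrite !window_sum_plus, !window_sum_scal, !window_sum_unit_mass by exact Hi.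
    fold (quad_form A N m). fold (apply_matrix A N m i). ring.
  - intros k _. rewrite Ha, (Hsym i k). ring.
Qed.

Lemma simplex_towards_unit_mass N m i e : simplex N m -> in_window N i ->
  0 <= e <= 1 -> simplex N (fun k => (1 - e) * m k + e * unit_mass i k).
Proof.
  intros (Hp & Hs & H1) Hi He. split; [|split].
  - intros k. generalize (Hp k). unfold unit_mass.
    destruct (Z.eq_dec k i); intros H; nra.
  - intros k Hk. rewrite (Hs k Hk). unfold unit_mass.
    destruct (Z.eq_dec k i) as [E|E]; [subst; contradiction|ring].
  - rewrite window_sum_plus, window_sum_scal, H1.
    rewrite (window_sum_ext N _ (fun k => unit_mass i k * e)) by (intros; ring).
    rewrite window_sum_unit_mass by exact Hi. ring.
Qed.

(** Let q be the value of the form at [m]. For the mixture of [m] and a unit mass at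
    [i], with weights 1 - e and e, it is q + 2 e ((A m)_i - q) + O(e^2), which
    cannot be below q - d. *)
Lemma quad_form_almost_minimal_apply_matrix A N m i C d e :
  (forall i j, A i j = A j i) -> (forall i j, Rabs (A i j) <= C) ->
  simplex N m -> in_window N i -> 0 < e <= 1 ->
  (forall m', simplex N m' -> quad_form A N m - d <= quad_form A N m') ->
  quad_form A N m - d / e - 2 * C * e <= apply_matrix A N m i.
Proof.
  intros Hsym HA Hm Hi He Hmin.
  generalize (Hmin _ (simplex_towards_unit_mass N m i e Hm Hi ltac:(lra))).
  rewrite (quad_form_towards_unit_mass A N m i e Hsym Hi). intros H.
  generalize (apply_matrix_bound A N m i C Hm HA) (quad_form_bound A N m C Hm HA) (HA i i).
  intros H1 H2 H3.
  apply Rabs_le_between in H1. apply Rabs_le_between in H2.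
  apply Rabs_le_between in H3.
  assert (Hd : - d <= 2 * e * (apply_matrix A N m i - quad_form A N m) + e ^ 2 * (4 * C)).
  { assert (e ^ 2 * (quad_form A N m - 2 * apply_matrix A N m i + A i i) <= e ^ 2 * (4 * C)).
    { apply Rmult_le_compat_l; [apply pow2_ge_0|lra]. }
    nra. }
  assert (H0 : 0 <= d).
  { generalize (Hmin _ Hm). lra. }
  assert (Hde : e * (d / e) = d) by (field; lra).
  assert (0 <= d / e) by (apply Rdiv_le_0_compat; lra).
  apply Rmult_le_reg_l with e; [lra|]. nra.
Qed.

(** The simplex of a window is compact: an ultralimit, taken coordinatewise, of a
    minimising sequence is a minimiser. *)
Lemma quad_form_minimum_on_window (U : (nat -> Prop) -> Prop) A N C :
  free_ultrafilter U -> (forall i j, Rabs (A i j) <= C) ->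
  (exists m, simplex N m) ->
  exists m, simplex N m /\ forall m', simplex N m' -> quad_form A N m <= quad_form A N m'.
Proof.
  intros HU HA [m0 Hm0].
  destruct (completeness (fun x => exists m, simplex N m /\ x = - quad_form A N m))
    as [l [Hub Hlub]].
  { exists C. intros x [m [Hm ->]]. generalize (quad_form_bound A N m C Hm HA).
    intros H. apply Rabs_le_between in H. lra. }
  { exists (- quad_form A N m0). now exists m0. }
  assert (Hseq : forall n, exists m, simplex N m /\ l - / INR (S n) < - quad_form A N m).
  { intros n. apply NNPP. intros Hn.
    assert (Hi : 0 < / INR (S n)) by (apply Rinv_0_lt_compat, lt_0_INR; lia).
    assert (l <= l - / INR (S n)); [|lra].
    apply Hlub. intros x [m [Hm ->]]. apply Rnot_lt_le. intros Hlt.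
    apply Hn. now exists m. }
  apply functional_choice in Hseq. destruct Hseq as [ms Hms].
  assert (Hlim : forall k, exists x, filterlim (fun n => ms n k) U (locally x)).
  { intros k. apply (ultralimit_exists U _ 1 HU). intros n.
    destruct (Hms n) as [(Hp & Hs & H1) _].
    rewrite Rabs_pos_eq by apply Hp.
    destruct (in_window_dec N k) as [Hk|Hk].
    - rewrite <- H1. now apply window_sum_term_le.
    - rewrite Hs by exact Hk. lra. }
  apply functional_choice in Hlim. destruct Hlim as [m Hm].
  assert (HP : ProperFilter U) by apply HU.
  assert (Hq : filterlim (fun n => quad_form A N (ms n)) U (locally (quad_form A N m))).
  { apply window_sum_filterlim; [apply HP|]. intros k. apply filterlim_Rmult; [apply HP|apply Hm|].
    apply window_sum_filterlim; [apply HP|]. intros j.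
    apply filterlim_Rmult; [apply HP|apply filterlim_const|apply Hm]. }
  assert (Hsx : simplex N m).
  { split; [|split].
    - intros k. apply (filterlim_Rle U (fun _ => 0) (fun n => ms n k)).
      + intros n. apply (Hms n).
      + apply filterlim_const.
      + apply Hm.
    - intros k Hk. apply (filterlim_Req U (fun n => ms n k) (fun _ => 0)).
      + intros n. now apply (Hms n).
      + apply Hm.
      + apply filterlim_const.
    - apply (filterlim_Req U (fun n => window_sum N (ms n)) (fun _ => 1)).
      + intros n. apply (Hms n).
      + apply window_sum_filterlim; [apply HP|exact Hm].
      + apply filterlim_const. }
  exists m. split; [exact Hsx|]. intros m' Hm'.
  apply Rle_trans with (- l).
  - rewrite <- (Rplus_0_r (- l)).
    apply (filterlim_Rle U (fun n => quad_form A N (ms n)) (fun n => - l + / INR (S n))).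
    + intros n. destruct (Hms n). lra.
    + exact Hq.
    + apply filterlim_Rplus; [apply HP|apply filterlim_const|].
      now apply filterlim_inv_succ.
  - assert (- quad_form A N m' <= l); [|lra]. apply Hub. now exists m'.
Qed.

(** First order conditions. Let q be the minimum of the form over a window, attained
    at [m]. Then A m >= q in the window, and since the average of A m against [m] is q,
    equality holds wherever [m] has mass. Outside the window the inequality holds up
    to [eta], because the window is chosen so large that q is almost the infimum over
    all windows. *)
Lemma complementarity_solution (U : (nat -> Prop) -> Prop) A C N0 m0 eta :
  free_ultrafilter U ->
  (forall i j, A i j = A j i) -> (forall i j, Rabs (A i j) <= C) ->
  simplex N0 m0 -> 0 < eta ->
  exists N m, simplex N m /\ quad_form A N m <= quad_form A N0 m0 /\
    (forall i, 0 < m i -> apply_matrix A N m i = quad_form A N m) /\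
    (forall i, quad_form A N m - eta <= apply_matrix A N m i).
Proof.
  intros HU Hsym HA Hm0 Heta.
  assert (HC : 0 <= C) by (apply Rle_trans with (2 := HA 0%Z 0%Z), Rabs_pos).
  set (e := Rmin 1 (eta / (4 * C + 1))).
  assert (He : 0 < e <= 1).
  { split; [|apply Rmin_l]. apply Rmin_glb_lt; [lra|]. apply Rdiv_lt_0_compat; lra. }
  assert (HeC : 2 * C * e <= eta / 2).
  { assert (e <= eta / (4 * C + 1)) by apply Rmin_r.
    assert (eta / (4 * C + 1) * (4 * C + 1) = eta) by (field; lra).
    nra. }
  (* with this slack, both error terms d / e and 2 C e are at most eta / 2 *)
  set (d := eta / 2 * e).
  assert (Hd : 0 < d) by (apply Rmult_lt_0_compat; lra).
  destruct (completeness (fun x => exists N m, simplex N m /\ x = - quad_form A N m))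
    as [l [Hub Hlub]].
  { exists C. intros x [N [m [Hm ->]]]. generalize (quad_form_bound A N m C Hm HA).
    intros H. apply Rabs_le_between in H. lra. }
  { exists (- quad_form A N0 m0). now exists N0, m0. }
  assert (HN1 : exists N1 m1, simplex N1 m1 /\ l - d < - quad_form A N1 m1).
  { apply NNPP. intros Hn. assert (l <= l - d); [|lra].
    apply Hlub. intros x [N [m [Hm ->]]]. apply Rnot_lt_le. intros Hlt.
    apply Hn. now exists N, m. }
  destruct HN1 as [N1 [m1 [Hm1 Hl1]]].
  set (N := Nat.max N0 N1).
  destruct (simplex_widen A N0 N m0 ltac:(lia) Hm0) as (Hm0' & _ & Eq0).
  destruct (simplex_widen A N1 N m1 ltac:(lia) Hm1) as (Hm1' & _ & Eq1).
  destruct (quad_form_minimum_on_window U A N C HU HA ltac:(now exists m0)) as [m [Hm Hmin]].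
  exists N, m. split; [exact Hm|]. split; [rewrite <- Eq0; now apply Hmin|].
  assert (Hin : forall i, in_window N i -> quad_form A N m <= apply_matrix A N m i).
  { intros i Hi. apply le_epsilon. intros x Hx.
    set (t := Rmin 1 (x / (2 * C + 1))).
    assert (Ht : 0 < t <= 1).
    { split; [|apply Rmin_l]. apply Rmin_glb_lt; [lra|]. apply Rdiv_lt_0_compat; lra. }
    assert (HtC : 2 * C * t <= x).
    { assert (t <= x / (2 * C + 1)) by apply Rmin_r.
      assert (x / (2 * C + 1) * (2 * C + 1) = x) by (field; lra). nra. }
    generalize (quad_form_almost_minimal_apply_matrix A N m i C 0 t Hsym HA Hm Hi Ht
      ltac:(intros m' Hm'; generalize (Hmin m' Hm'); lra)).
    unfold Rdiv. lra. }
  split.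
  - intros i Hi.
    assert (Hwi : in_window N i).
    { destruct (in_window_dec N i) as [H|H]; [exact H|].
      destruct Hm as (_ & Hs & _). rewrite (Hs i H) in Hi. lra. }
    assert (Hz : window_sum N (fun k => m k * (apply_matrix A N m k - quad_form A N m)) = 0).
    { rewrite (window_sum_ext N _ (fun k => m k * apply_matrix A N m k + (- quad_form A N m) * m k))
        by (intros; ring).
      rewrite window_sum_plus, window_sum_scal. fold (quad_form A N m).
      destruct Hm as (_ & _ & H1). rewrite H1. ring. }
    assert (Hle : m i * (apply_matrix A N m i - quad_form A N m) <= 0).
    { rewrite <- Hz.
      apply (window_sum_term_le N (fun k => m k * (apply_matrix A N m k - quad_form A N m))); [|exact Hwi].
      intros k. destruct Hm as (Hp & Hs & _).
      destruct (in_window_dec N k) as [H|H].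
      - apply Rmult_le_pos; [apply Hp|]. generalize (Hin k H). lra.
      - rewrite (Hs k H). lra. }
    generalize (Hin i Hwi). nra.
  - intros i.
    (* the same [m], seen in a window that contains i *)
    set (M := (N + Z.abs_nat i + 1)%nat).
    destruct (simplex_widen A N M m ltac:(lia) Hm) as (HmM & HaM & HqM).
    rewrite <- HaM, <- HqM.
    assert (HiM : in_window M i) by (unfold in_window; lia).
    assert (Hde : d / e = eta / 2) by (unfold d; field; lra).
    generalize (quad_form_almost_minimal_apply_matrix A M m i C d e Hsym HA HmM HiM He). rewrite Hde.
    intros H. assert (HH : forall m', simplex M m' -> quad_form A M m - d <= quad_form A M m').
    { intros m' Hm'. assert (- quad_form A M m' <= l) by (apply Hub; now exists M, m').
      generalize (Hmin m1 Hm1'). rewrite HqM, Eq1. lra. }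
    specialize (H HH). lra.
Qed.

(** * The discretised equation on a grid *)

Definition lipschitz (L : R) (f : R -> R) : Prop :=
  forall x y, Rabs (f x - f y) <= L * Rabs (x - y).

Lemma lipschitz_nonneg L f : lipschitz L f -> 0 <= L.
Proof.
  intros Hf. generalize (Hf 1 0). rewrite Rminus_0_r, Rabs_R1.
  generalize (Rabs_pos (f 1 - f 0)). lra.
Qed.

Lemma lipschitz_continuous L f x : lipschitz L f -> continuous f x.
Proof.
  intros Hf.
  assert (HL := lipschitz_nonneg _ _ Hf).
  apply filterlim_locally. intros eps.
  assert (Hd : 0 < eps / (L + 1)) by (apply Rdiv_lt_0_compat; [apply cond_pos|lra]).
  exists (mkposreal _ Hd). intros y Hy.
  change (Rabs (y - x) < eps / (L + 1)) in Hy. change (Rabs (f y - f x) < eps).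
  assert (E : eps / (L + 1) * (L + 1) = eps) by (field; lra).
  generalize (Hf y x) (Rabs_pos (y - x)) (cond_pos eps). nra.
Qed.

Lemma lipschitz_RInt L f a b : lipschitz L f -> ex_RInt f a b.
Proof.
  intros Hf. apply (ex_RInt_continuous (V := R_CompleteNormedModule)).
  intros z _. now apply lipschitz_continuous with L.
Qed.

Lemma lipschitz_plus L M f g : lipschitz L f -> lipschitz M g -> lipschitz (L + M) (fun x => f x + g x).
Proof.
  intros Hf Hg x y. generalize (Hf x y) (Hg x y). intros H1 H2.
  replace (f x + g x - (f y + g y)) with ((f x - f y) + (g x - g y)) by ring.
  eapply Rle_trans; [apply Rabs_triang|]. lra.
Qed.

Lemma lipschitz_mult L M A B f g : lipschitz L f -> lipschitz M g ->
  (forall x, Rabs (f x) <= A) -> (forall x, Rabs (g x) <= B) ->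
  lipschitz (L * B + A * M) (fun x => f x * g x).
Proof.
  intros Hf Hg HA HB x y.
  replace (f x * g x - f y * g y) with ((f x - f y) * g x + f y * (g x - g y)) by ring.
  eapply Rle_trans; [apply Rabs_triang|]. rewrite !Rabs_mult.
  generalize (Hf x y) (Hg x y) (HA y) (HB x) (Rabs_pos (f x - f y))
    (Rabs_pos (g x - g y)) (Rabs_pos (f y)) (Rabs_pos (g x)) (Rabs_pos (x - y)).
  intros.
  assert (Rabs (f x - f y) * Rabs (g x) <= L * Rabs (x - y) * B)
    by (apply Rmult_le_compat; assumption).
  assert (Rabs (f y) * Rabs (g x - g y) <= A * (M * Rabs (x - y)))
    by (apply Rmult_le_compat; assumption).
  lra.
Qed.

Lemma lipschitz_scal L c f : lipschitz L f -> lipschitz (Rabs c * L) (fun x => c * f x).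
Proof.
  intros Hf x y. rewrite <- Rmult_minus_distr_l, Rabs_mult, Rmult_assoc.
  apply Rmult_le_compat_l; [apply Rabs_pos|apply Hf].
Qed.

Lemma lipschitz_reflect L f x : lipschitz L f -> lipschitz L (fun y => f (x - y)).
Proof.
  intros Hf y z. rewrite (Rabs_minus_sym y z).
  replace (z - y) with ((x - y) - (x - z)) by ring. apply Hf.
Qed.

Lemma Rmax_0_lipschitz x y : Rabs (Rmax 0 x - Rmax 0 y) <= Rabs (x - y).
Proof. unfold Rmax, Rabs. repeat (destruct Rle_dec || destruct Rcase_abs); lra. Qed.

(** On each cell the function differs from its left value by at most [L * h]. *)
Lemma Riemann_sum_error L f h N : lipschitz L f -> 0 <= h ->
  Rabs (RInt f (- (INR N * h)) (INR N * h) - h * window_sum N (fun k => f (IZR k * h)))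
    <= 2 * INR N * (L * h ^ 2).
Proof.
  intros Hf Hh.
  assert (Hcell : forall s, Rabs (RInt f s (s + h) - h * f s) <= L * h ^ 2).
  { intros s.
    assert (HL := lipschitz_nonneg _ _ Hf).
    replace (h * f s) with (RInt (fun _ => f s) s (s + h)).
    2:{ rewrite RInt_const. unfold scal; simpl; unfold mult; simpl. ring. }
    rewrite <- (RInt_minus (V := R_CompleteNormedModule) f (fun _ => f s)).
    2:{ apply lipschitz_RInt with L; exact Hf. }
    2:{ apply ex_RInt_const. }
    replace (L * h ^ 2) with ((s + h - s) * (L * h)) by ring.
    apply abs_RInt_le_const; [lra| |].
    - apply ex_RInt_minus; [apply lipschitz_RInt with L; exact Hf|apply ex_RInt_const].
    - intros t Ht. unfold minus, plus, opp; simpl.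
      eapply Rle_trans; [apply Hf|]. apply Rmult_le_compat_l; [exact HL|].
      rewrite Rabs_pos_eq; lra. }
  induction N as [|N IH].
  - simpl. rewrite Rmult_0_l, Ropp_0, RInt_point. unfold zero; simpl.
    rewrite Rmult_0_r, Rminus_0_r, Rabs_R0. lra.
  - cbn [window_sum]. rewrite opp_IZR, <- !INR_IZR_INZ.
    assert (EI := lipschitz_RInt L f). rewrite S_INR.
    rewrite <- (RInt_Chasles f _ (- (INR N * h))) by (now apply EI).
    rewrite <- (RInt_Chasles f (- (INR N * h)) (INR N * h)) by (now apply EI).
    generalize (Hcell (- ((INR N + 1) * h))) (Hcell (INR N * h)).
    replace (- ((INR N + 1) * h) + h) with (- (INR N * h)) by ring.
    replace (INR N * h + h) with ((INR N + 1) * h) by ring.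
    replace (- (INR N + 1) * h) with (- ((INR N + 1) * h)) by ring.
    unfold plus; simpl. intros H1 H2.
    set (S := window_sum N (fun k : Z => f (IZR k * h))) in *.
    replace (_ - h * _) with
      ((RInt f (- ((INR N + 1) * h)) (- (INR N * h)) - h * f (- ((INR N + 1) * h)))
      + ((RInt f (- (INR N * h)) (INR N * h) - h * S)
      + (RInt f (INR N * h) ((INR N + 1) * h) - h * f (INR N * h)))) by ring.
    eapply Rle_trans; [apply Rabs_triang|].
    generalize (Rabs_triang (RInt f (- (INR N * h)) (INR N * h) - h * S)
       (RInt f (INR N * h) ((INR N + 1) * h) - h * f (INR N * h))). lra.
Qed.

Lemma exp_monotone x y : x <= y -> exp x <= exp y.
Proof.
  intros [H | ->]; [now apply Rlt_le, exp_increasing|apply Rle_refl].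
Qed.

Definition decaying_kernel (C al L : R) (K : R -> R) : Prop :=
  0 < al /\ lipschitz L K /\ (forall s, K (- s) = K s) /\
  (forall s, Rabs (K s) <= C * exp (- (al * Rabs s))).

Lemma decaying_kernel_bounded C al L K : decaying_kernel C al L K ->
  0 <= C /\ forall s, Rabs (K s) <= C.
Proof.
  intros (Hal & _ & _ & HK).
  assert (HC : 0 <= C).
  { generalize (HK 0) (Rabs_pos (K 0)). rewrite Rabs_R0, Rmult_0_r, Ropp_0, exp_0. lra. }
  split; [exact HC|]. intros s. eapply Rle_trans; [apply HK|].
  rewrite <- (Rmult_1_r C) at 2. apply Rmult_le_compat_l; [exact HC|].
  rewrite <- exp_0. apply exp_monotone. generalize (Rabs_pos s). nra.
Qed.

(** The form q for point masses: a mass m at a grid point stands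
    for the density m / h on a cell, whose contribution to int v^2 is m^2 / h. *)
Definition grid_form (K : R -> R) (g h : R) (i j : Z) : R :=
  (if Z.eq_dec j i then / h else 0) - g * K (IZR (i - j) * h).

(** Let mu <= -d be the minimum. Scaling the minimiser by [t = kap / - mu] turns the first
    order conditions into V = g (u - kap)^+ up to [eta]; the total mass g t is at most
    g kap / d. Centring the grid at a point that carries mass gives [kap <= u 0]. *)
Lemma grid_solution (U : (nat -> Prop) -> Prop) K C al L g kap h N0 m0 d eta :
  free_ultrafilter U -> decaying_kernel C al L K ->
  0 < g -> 0 < kap -> 0 < h -> 0 < d -> 0 < eta ->
  simplex N0 m0 -> quad_form (grid_form K g h) N0 m0 <= - d ->
  exists N V,
    (forall k, 0 <= V k) /\ (forall k, ~ in_window N k -> V k = 0) /\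
    h * window_sum N V <= g * kap / d /\
    kap <= h * window_sum N (fun k => K (0 - IZR k * h) * V k) /\
    forall i, Rabs (V i - g * Rmax 0
       (h * window_sum N (fun k => K (IZR i * h - IZR k * h) * V k) - kap)) <= eta.
Proof.
  intros HU HK Hg Hkap Hh Hd Heta Hm0 Hq0.
  destruct (decaying_kernel_bounded _ _ _ _ HK) as [HC HKC].
  destruct HK as (Hal & HL & Hev & HKe).
  set (A := grid_form K g h) in *.
  assert (Hsym : forall i j, A i j = A j i).
  { intros i j. unfold A, grid_form.
    replace (IZR (j - i) * h) with (- (IZR (i - j) * h)) by (rewrite !minus_IZR; ring).
    rewrite Hev. destruct (Z.eq_dec j i), (Z.eq_dec i j); (reflexivity || lia). }
  assert (HA : forall i j, Rabs (A i j) <= / h + g * C).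
  { intros i j. unfold A, grid_form. assert (0 < / h) by now apply Rinv_0_lt_compat.
    generalize (HKC (IZR (i - j) * h)). intros H1. apply Rabs_le_between in H1.
    apply Rabs_le. destruct (Z.eq_dec j i); split; nra. }
  assert (Hgk : 0 < g * kap) by now apply Rmult_lt_0_compat.
  assert (Heta' : 0 < eta * d / (g * kap))
    by (apply Rdiv_lt_0_compat; [now apply Rmult_lt_0_compat|exact Hgk]).
  destruct (complementarity_solution U A _ N0 m0 _ HU Hsym HA Hm0 Heta')
    as (N & m & Hm & Hle & Heq & Hge).
  destruct (Hm) as (Hp & Hs & H1).
  set (mu := quad_form A N m) in *.
  assert (Hmu : mu <= - d) by lra.
  set (t := kap / - mu).
  assert (Ht : t * - mu = kap) by (unfold t; field; lra).
  assert (Htpos : 0 < t) by (apply Rdiv_lt_0_compat; lra).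
  assert (Htd : t <= kap / d).
  { apply Rmult_le_compat_l; [lra|]. apply Rinv_le_contravar; lra. }
  set (u := fun x => g * t * window_sum N (fun k => K (x - IZR k * h) * m k)).
  assert (Hact : forall i, apply_matrix A N m i = m i / h - u (IZR i * h) / t).
  { intros i. unfold apply_matrix.
    rewrite (window_sum_ext N _ (fun j => (if Z.eq_dec j i then m j / h else 0) +
       (- g) * (K (IZR i * h - IZR j * h) * m j))).
    - rewrite window_sum_plus, window_sum_scal.
      replace (m i / h - u (IZR i * h) / t) with
        (m i / h + - g * window_sum N (fun j => K (IZR i * h - IZR j * h) * m j))
        by (unfold u; field; lra).
      f_equal.
      destruct (in_window_dec N i) as [Hi|Hi].
      + now rewrite (window_sum_delta N i (fun j => m j / h)).
      + rewrite (Hs i Hi), (window_sum_ext N _ (fun _ => 0)), window_sum_zero; [unfold Rdiv; ring|].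
        intros k Hk. destruct (Z.eq_dec k i) as [E|E]; [|reflexivity].
        rewrite E in Hk. contradiction.
    - intros j _. unfold A, grid_form.
      replace (IZR (i - j) * h) with (IZR i * h - IZR j * h) by (rewrite minus_IZR; ring).
      destruct (Z.eq_dec j i); unfold Rdiv; ring. }
  assert (Hi0 : exists i0, 0 < m i0).
  { apply NNPP. intros Hn. rewrite (window_sum_ext N _ (fun _ => 0)), window_sum_zero in H1; [lra|].
    intros k _. destruct (Hp k) as [H|H]; [|now rewrite <- H].
    exfalso. apply Hn. now exists k. }
  destruct Hi0 as [i0 Hi0].
  set (V := fun k => g * t / h * m (k + i0)%Z).
  set (M := (N + Z.abs_nat i0)%nat).
  assert (Hu : forall x, h * window_sum M (fun k => K (x - IZR k * h) * V k) = u (x + IZR i0 * h)).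
  { intros x. unfold u, V.
    rewrite <- (window_sum_shift N M i0); [|intros k Hk; rewrite (Hs k Hk); ring|reflexivity].
    rewrite <- !window_sum_scal. apply window_sum_ext. intros k _. rewrite plus_IZR.
    replace (x + IZR i0 * h - (IZR k + IZR i0) * h) with (x - IZR k * h) by ring.
    field. lra. }
  assert (Hpos : forall i, 0 < m i -> g * t / h * m i = g * (u (IZR i * h) - kap)).
  { intros i Hi. specialize (Heq i Hi). rewrite Hact in Heq.
    assert (E : m i / h = mu + u (IZR i * h) / t) by lra.
    replace (g * t / h * m i) with (g * t * (m i / h)) by (field; lra).
    rewrite E, <- Ht. field. lra. }
  exists M, V. split; [|split; [|split; [|split]]].
  - intros k. apply Rmult_le_pos; [|apply Hp].
    apply Rlt_le, Rdiv_lt_0_compat; [now apply Rmult_lt_0_compat|exact Hh].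
  - intros k Hk. unfold V. rewrite Hs; [ring|]. unfold in_window, M in *. lia.
  - unfold V. rewrite window_sum_scal.
    rewrite (window_sum_shift N M i0 m Hs), H1 by reflexivity.
    replace (h * (g * t / h * 1)) with (g * t) by (field; lra).
    replace (g * kap / d) with (g * (kap / d)) by (field; lra).
    apply Rmult_le_compat_l; lra.
  - rewrite Hu. generalize (Hpos i0 Hi0). rewrite Rplus_0_l.
    assert (0 < g * t / h * m i0).
    { apply Rmult_lt_0_compat; [|exact Hi0].
      apply Rdiv_lt_0_compat; [now apply Rmult_lt_0_compat|exact Hh]. }
    intros H2. nra.
  - intros i. rewrite Hu. unfold V.
    replace (IZR i * h + IZR i0 * h) with (IZR (i + i0) * h) by (rewrite plus_IZR; ring).
    set (j := (i + i0)%Z). destruct (Hp j) as [H|H].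
    + generalize (Hpos j H). intros E. rewrite E, Rmax_right.
      * rewrite Rminus_diag, Rabs_R0; lra.
      * assert (0 < g * t / h * m j).
        { apply Rmult_lt_0_compat; [|exact H].
          apply Rdiv_lt_0_compat; [now apply Rmult_lt_0_compat|exact Hh]. }
        nra.
    + rewrite <- H, Rmult_0_r, Rminus_0_l, Rabs_Ropp.
      assert (Hub : u (IZR j * h) - kap <= t * (eta * d / (g * kap))).
      { generalize (Hge j). rewrite Hact, <- H. intros H2.
        assert (E : u (IZR j * h) = t * (u (IZR j * h) / t)) by (field; lra).
        assert (E0 : 0 / h = 0) by (field; lra). rewrite E0 in H2.
        rewrite E. set (s := u (IZR j * h) / t) in *.
        set (e' := eta * d / (g * kap)) in *. nra. }
      assert (Hub2 : t * (eta * d / (g * kap)) <= eta / g).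
      { replace (eta / g) with (kap / d * (eta * d / (g * kap))) by (field; lra).
        apply Rmult_le_compat_r; lra. }
      rewrite Rabs_pos_eq.
      * replace eta with (g * (eta / g)) by (field; lra).
        apply Rmult_le_compat_l; [lra|]. apply Rmax_lub; [|lra].
        apply Rlt_le, Rdiv_lt_0_compat; lra.
      * apply Rmult_le_pos; [lra|apply Rmax_l].
Qed.

(** * Refining the grid *)

Lemma lipschitz_limit {T} (F : (T -> Prop) -> Prop) {FF : ProperFilter F} L (f : T -> R -> R) g :
  (forall n, lipschitz L (f n)) ->
  (forall x, filterlim (fun n => f n x) F (locally (g x))) -> lipschitz L g.
Proof.
  intros Hf Hg.
  assert (H : forall x y, g x <= g y + L * Rabs (x - y)).
  { intros x y. apply (filterlim_Rle F (fun n => f n x) (fun n => f n y + L * Rabs (x - y))).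
    - intros n. generalize (Hf n x y). intros H. apply Rabs_le_between in H. lra.
    - apply Hg.
    - apply filterlim_Rplus; [apply FF|apply Hg|apply filterlim_const]. }
  intros x y. apply Rabs_le. generalize (H x y) (H y x).
  rewrite (Rabs_minus_sym y x). lra.
Qed.

Lemma filterlim_R_intro {T} (F : (T -> Prop) -> Prop) {FF : Filter F} (f : T -> R) l :
  (forall eps, 0 < eps -> F (fun n => Rabs (f n - l) < eps)) ->
  filterlim f F (locally l).
Proof.
  intros H. apply filterlim_locally. intros eps. exact (H eps (cond_pos eps)).
Qed.

Lemma filterlim_R_elim {T} (F : (T -> Prop) -> Prop) {FF : Filter F} (f : T -> R) l eps :
  filterlim f F (locally l) -> 0 < eps -> F (fun n => Rabs (f n - l) < eps).
Proof.
  intros H He. apply filterlim_locally with (eps := mkposreal eps He) in H. exact H.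
Qed.

(** Riemann sums of varying equi-Lipschitz functions, with mesh tending to zero,
    converge to the integral of the pointwise limit: each is compared with the sum
    over one fixed fine mesh, where only finitely many points are involved. *)
Lemma Riemann_sums_filterlim {T} (F : (T -> Prop) -> Prop) {FF : ProperFilter F}
  (f : T -> R -> R) g L R h N :
  0 < R -> (forall n, lipschitz L (f n)) ->
  (forall y, filterlim (fun n => f n y) F (locally (g y))) ->
  (forall n, 0 < h n /\ INR (N n) * h n = R) -> filterlim h F (locally 0) ->
  filterlim (fun n => h n * window_sum (N n) (fun k => f n (IZR k * h n))) F
    (locally (RInt g (- R) R)).
Proof.
  intros HR Hf Hg HN Hh. apply filterlim_R_intro; [apply FF|]. intros eps Heps.
  assert (Hlg : lipschitz L g) by (apply (lipschitz_limit F) with f; assumption).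
  assert (HL := lipschitz_nonneg _ _ Hlg).
  assert (Hw : 0 < eps / (8 * R * L + 1)) by (apply Rdiv_lt_0_compat; nra).
  assert (Hw2 : eps / (8 * R * L + 1) * (8 * R * L + 1) = eps) by (field; nra).
  set (w := eps / (8 * R * L + 1)) in *.
  (* a fixed mesh on which the finite sums converge *)
  destruct (archimed_cor1 (w / R) ltac:(now apply Rdiv_lt_0_compat)) as [M [HM HM0]].
  assert (HMp : 0 < INR M) by now apply lt_0_INR.
  set (h0 := R / INR M).
  assert (Hh0 : 0 < h0) by now apply Rdiv_lt_0_compat.
  assert (HMh : INR M * h0 = R) by (unfold h0; field; lra).
  assert (Hh0w : h0 < w).
  { unfold h0. replace w with (R * (w / R)) by (field; lra).
    apply Rmult_lt_compat_l; assumption. }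
  assert (Hs : filterlim (fun n => h0 * window_sum M (fun k => f n (IZR k * h0))) F
                 (locally (h0 * window_sum M (fun k => g (IZR k * h0))))).
  { apply filterlim_Rmult; [apply FF|apply filterlim_const|].
    apply (window_sum_filterlim F M (fun n k => f n (IZR k * h0)) (fun k => g (IZR k * h0))).
    intros k. apply Hg. }
  apply (filterlim_R_elim F _ _ (eps / 4)) in Hs; [|lra].
  apply (filterlim_R_elim F _ _ w) in Hh; [|exact Hw].
  generalize (filter_and _ _ Hs Hh). apply filter_imp. intros n [H1 H2].
  destruct (HN n) as [Hn1 Hn2].
  rewrite Rminus_0_r, Rabs_pos_eq in H2 by lra.
  generalize (Riemann_sum_error L g h0 M Hlg ltac:(lra))
    (Riemann_sum_error L (f n) h0 M (Hf n) ltac:(lra))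
    (Riemann_sum_error L (f n) (h n) (N n) (Hf n) ltac:(lra)).
  rewrite HMh, Hn2.
  replace (2 * INR M * (L * h0 ^ 2)) with (2 * L * R * h0) by (rewrite <- HMh; ring).
  replace (2 * INR (N n) * (L * h n ^ 2)) with (2 * L * R * h n) by (rewrite <- Hn2; ring).
  assert (HLR : 0 <= L * R) by nra.
  assert (2 * L * R * h0 <= eps / 4) by nra.
  assert (2 * L * R * h n <= eps / 4) by nra.
  intros H3 H4 H5. apply Rabs_le_between in H3. apply Rabs_le_between in H4.
  apply Rabs_le_between in H5. apply Rabs_lt_between in H1.
  apply Rabs_def1; try lra.
Qed.

Lemma window_sum_le_wider N M f : (forall k, 0 <= f k) -> (N <= M)%nat -> window_sum N f <= window_sum M f.
Proof.
  intros Hf H. induction H as [|M H IH]; [apply Rle_refl|]. cbn [window_sum].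
  generalize (Hf (- Z.of_nat (S M))%Z) (Hf (Z.of_nat M)). lra.
Qed.

(** The mass bound [T = g kap / d] makes the grid solutions bounded and
    equi-Lipschitz, independently of the mesh. In the limit the integral equation is
    only asserted on [-k L, k L] up to the contribution of the mass outside this
    interval, which the decay of the kernel controls; this avoids improper
    integrals. *)
Lemma grid_compactness (U : (nat -> Prop) -> Prop) K C al LK g kap L d n0 :
  free_ultrafilter U -> decaying_kernel C al LK K ->
  0 < g -> 0 < kap -> 0 < L -> 0 < d ->
  (forall n, (n0 <= n)%nat -> exists N m, simplex N m /\
     quad_form (grid_form K g (L / INR (S n))) N m <= - d) ->
  exists u, (exists Lu, lipschitz Lu u) /\ kap <= u 0 /\
    forall k, (0 < k)%nat ->
      RInt (fun y => g * Rmax 0 (u y - kap)) (- (INR k * L)) (INR k * L) <= g * kap / d /\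
      forall x, Rabs x <= INR k * L ->
        Rabs (u x - RInt (fun y => K (x - y) * (g * Rmax 0 (u y - kap)))
                      (- (INR k * L)) (INR k * L))
          <= g * kap / d * (C * exp (- (al * (INR k * L - Rabs x)))).
Proof.
  intros HU HK Hg Hkap HL Hd Hneg.
  destruct (decaying_kernel_bounded _ _ _ _ HK) as [HC HKC].
  assert (HP : ProperFilter U) by apply HU.
  set (h := fun n => L / INR (S (n0 + n))).
  assert (Hh : forall n, 0 < h n)
    by (intros n; apply Rdiv_lt_0_compat; [exact HL|apply lt_0_INR; lia]).
  assert (Hsol : forall n, exists NV : nat * (Z -> R), let (N, V) := NV in
    (forall k, 0 <= V k) /\ (forall k, ~ in_window N k -> V k = 0) /\
    h n * window_sum N V <= g * kap / d /\
    kap <= h n * window_sum N (fun k => K (0 - IZR k * h n) * V k) /\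
    forall i, Rabs (V i - g * Rmax 0
       (h n * window_sum N (fun k => K (IZR i * h n - IZR k * h n) * V k) - kap)) <= / INR (S n)).
  { intros n. destruct (Hneg (n0 + n)%nat ltac:(lia)) as (N0 & m0 & Hm0 & Hq0).
    destruct (grid_solution U K C al LK g kap (h n) N0 m0 d (/ INR (S n)))
      as (N & V & HNV); try assumption; [apply Hh| |now exists (N, V)].
    apply Rinv_0_lt_compat, lt_0_INR; lia. }
  apply functional_choice in Hsol. destruct Hsol as [NV HNV].
  set (T := g * kap / d) in *.
  assert (HT : 0 < T) by (apply Rdiv_lt_0_compat; [now apply Rmult_lt_0_compat|exact Hd]).
  set (un := fun n x => h n * window_sum (fst (NV n)) (fun k => K (x - IZR k * h n) * snd (NV n) k)).
  set (eta := fun n => / INR (S n)).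
  assert (Heta : forall n, 0 < eta n) by (intros n; apply Rinv_0_lt_compat, lt_0_INR; lia).
  assert (HV : forall n, (forall k, 0 <= snd (NV n) k) /\
    (forall k, ~ in_window (fst (NV n)) k -> snd (NV n) k = 0) /\
    h n * window_sum (fst (NV n)) (snd (NV n)) <= T /\ kap <= un n 0 /\
    forall i, Rabs (snd (NV n) i - g * Rmax 0 (un n (IZR i * h n) - kap)) <= eta n).
  { intros n. generalize (HNV n). unfold un. now destruct (NV n). }
  clear HNV Hneg.
  assert (Hwt : forall n M a c, 0 <= c -> (forall k, Rabs (a k) <= c) ->
     (fst (NV n) <= M)%nat -> Rabs (h n * window_sum M (fun k => a k * snd (NV n) k)) <= c * T).
  { intros n M a c Hc Ha HM. destruct (HV n) as (Hp & Hs & Hm & _).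
    rewrite Rabs_mult, (Rabs_pos_eq (h n)) by (generalize (Hh n); lra).
    apply Rle_trans with (h n * (c * window_sum (fst (NV n)) (snd (NV n)))).
    - apply Rmult_le_compat_l; [generalize (Hh n); lra|].
      eapply Rle_trans; [apply window_sum_abs|].
      rewrite <- (window_sum_extend _ M _ HM Hs), <- window_sum_scal. apply window_sum_le. intros k _.
      rewrite Rabs_mult, (Rabs_pos_eq _ (Hp k)).
      apply Rmult_le_compat_r; [apply Hp|apply Ha].
    - rewrite <- Rmult_assoc, (Rmult_comm (h n)), Rmult_assoc.
      now apply Rmult_le_compat_l. }
  assert (Hub : forall n x, Rabs (un n x) <= C * T).
  { intros n x. apply (Hwt n _ (fun k => K (x - IZR k * h n))); [exact HC| |apply Nat.le_refl].
    intros k. apply HKC. }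
  assert (HLK : 0 <= LK) by (apply lipschitz_nonneg with K; apply HK).
  assert (Hul : forall n, lipschitz (LK * T) (un n)).
  { intros n x y. unfold un. rewrite <- Rmult_minus_distr_l.
    replace (window_sum _ _ - window_sum _ _) with (window_sum (fst (NV n)) (fun k =>
      (K (x - IZR k * h n) - K (y - IZR k * h n)) * snd (NV n) k)).
    - replace (LK * T * Rabs (x - y)) with (LK * Rabs (x - y) * T) by ring.
      apply (Hwt n _ (fun k => K (x - IZR k * h n) - K (y - IZR k * h n)));
        [|intros k|apply Nat.le_refl].
      + apply Rmult_le_pos; [exact HLK|apply Rabs_pos].
      + destruct HK as (_ & HLip & _).
        replace (x - y) with ((x - IZR k * h n) - (y - IZR k * h n)) by ring. apply HLip.
    - rewrite (window_sum_ext _ _ (fun k => K (x - IZR k * h n) * snd (NV n) k +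
         (-1) * (K (y - IZR k * h n) * snd (NV n) k))) by (intros; ring).
      rewrite window_sum_plus, window_sum_scal. ring. }
  assert (Hlim : forall x, exists l, filterlim (fun n => un n x) U (locally l)).
  { intros x. apply (ultralimit_exists U _ (C * T) HU). intros n. apply Hub. }
  apply functional_choice in Hlim. destruct Hlim as [u Hu].
  assert (Hulip : lipschitz (LK * T) u) by (apply (lipschitz_limit U) with un; assumption).
  set (P := fun n y => g * Rmax 0 (un n y - kap)).
  assert (HPl : forall n, lipschitz (g * (LK * T)) (P n)).
  { intros n x y. unfold P. rewrite <- Rmult_minus_distr_l, Rabs_mult, Rabs_pos_eq by lra.
    rewrite Rmult_assoc. apply Rmult_le_compat_l; [lra|].
    eapply Rle_trans; [apply Rmax_0_lipschitz|].
    replace (un n x - kap - (un n y - kap)) with (un n x - un n y) by ring. apply Hul. }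
  assert (HPb : forall n x, Rabs (P n x) <= g * (C * T)).
  { intros n x. unfold P. generalize (Hub n x). intros H. apply Rabs_le_between in H.
    rewrite Rabs_mult, Rabs_pos_eq by lra. apply Rmult_le_compat_l; [lra|].
    rewrite Rabs_pos_eq by apply Rmax_l. apply Rmax_lub; lra. }
  assert (HPlim : forall y, filterlim (fun n => P n y) U (locally (g * Rmax 0 (u y - kap)))).
  { intros y. apply filterlim_Rmult; [apply HP|apply filterlim_const|].
    apply filterlim_R_intro; [apply HP|]. intros eps Heps.
    generalize (filterlim_R_elim U _ _ eps (Hu y) Heps). apply filter_imp. intros n Hn.
    eapply Rle_lt_trans; [apply Rmax_0_lipschitz|].
    now replace (un n y - kap - (u y - kap)) with (un n y - u y) by ring. }
  assert (Hhlim : filterlim h U (locally 0)).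
  { apply filterlim_R_intro; [apply HP|]. intros eps Heps.
    generalize (filterlim_R_elim U _ _ (eps / L) (filterlim_inv_succ U HU)
      ltac:(now apply Rdiv_lt_0_compat)). apply filter_imp. intros n Hn.
    assert (Hn0 : 0 < / INR (S n)) by (apply Rinv_0_lt_compat, lt_0_INR; lia).
    rewrite Rminus_0_r, Rabs_pos_eq in Hn by lra.
    rewrite Rminus_0_r, Rabs_pos_eq by (generalize (Hh n); lra).
    apply Rle_lt_trans with (L * / INR (S n)).
    - apply Rmult_le_compat_l; [lra|]. apply Rinv_le_contravar; [apply lt_0_INR; lia|].
      apply le_INR. lia.
    - replace eps with (L * (eps / L)) by (field; lra). now apply Rmult_lt_compat_l. }
  assert (Hetalim : filterlim eta U (locally 0)) by now apply filterlim_inv_succ.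
  exists u. split; [now exists (LK * T)|]. split.
  { apply (filterlim_Rle U (fun _ => kap) (fun n => un n 0));
      [intros n; apply HV|apply filterlim_const|apply Hu]. }
  intros k Hk. set (R := INR k * L).
  assert (HR : 0 < R) by (apply Rmult_lt_0_compat; [now apply lt_0_INR|exact HL]).
  set (W := fun n => (k * S (n0 + n))%nat).
  assert (HW : forall n, 0 < h n /\ INR (W n) * h n = R).
  { intros n. split; [apply Hh|]. unfold W, h, R. rewrite mult_INR. field.
    apply not_0_INR. lia. }
  split.
  - rewrite <- (Rplus_0_r T).
    apply (filterlim_Rle U (fun n => h n * window_sum (W n) (fun j => P n (IZR j * h n)))
                           (fun n => T + 2 * R * eta n)).
    + intros n. destruct (HV n) as (Hp & Hs & Hm & _ & Ha). destruct (HW n) as [_ HWn].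
      set (M := Nat.max (fst (NV n)) (W n)).
      assert (H1 : window_sum (W n) (fun j => P n (IZR j * h n)) <=
                   window_sum (W n) (fun j => snd (NV n) j + eta n)).
      { apply window_sum_le. intros j _. generalize (Ha j). fold (P n (IZR j * h n)).
        intros H. apply Rabs_le_between in H. lra. }
      rewrite window_sum_plus, window_sum_const in H1.
      assert (H2 : window_sum (W n) (snd (NV n)) <= window_sum (fst (NV n)) (snd (NV n))).
      { rewrite <- (window_sum_extend (fst (NV n)) M _ ltac:(lia) Hs). apply window_sum_le_wider; [exact Hp|lia]. }
      apply Rle_trans with (h n * (window_sum (fst (NV n)) (snd (NV n)) + 2 * INR (W n) * eta n)).
      * apply Rmult_le_compat_l; [generalize (Hh n); lra|lra].
      * rewrite <- HWn. nra.
    + apply (Riemann_sums_filterlim U P _ (g * (LK * T))); assumption.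
    + apply filterlim_Rplus; [apply HP|apply filterlim_const|].
      rewrite <- (Rmult_0_r (2 * R)).
      apply filterlim_Rmult; [apply HP|apply filterlim_const|exact Hetalim].
  - intros x Hx. set (b := C * exp (- (al * (R - Rabs x)))).
    assert (Hb : 0 <= b) by (apply Rmult_le_pos; [exact HC|apply Rlt_le, exp_pos]).
    set (Q := fun n y => K (x - y) * P n y).
    assert (HQ : filterlim (fun n => h n * window_sum (W n) (fun j => Q n (IZR j * h n))) U
      (locally (RInt (fun y => K (x - y) * (g * Rmax 0 (u y - kap))) (- R) R))).
    { apply (Riemann_sums_filterlim U Q _
               (LK * (g * (C * T)) + C * (g * (LK * T)))); try assumption.
      - intros n. apply lipschitz_mult; [apply lipschitz_reflect; apply HK|apply HPl|intros; apply HKC|apply HPb].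
      - intros y. apply filterlim_Rmult; [apply HP|apply filterlim_const|apply HPlim]. }
    assert (Hn : forall n, Rabs (un n x - h n * window_sum (W n) (fun j => Q n (IZR j * h n))) <=
                           T * b + 2 * R * C * eta n).
    { intros n. destruct (HV n) as (Hp & Hs & Hm & _ & Ha). destruct (HW n) as [_ HWn].
      set (M := Nat.max (fst (NV n)) (W n)).
      set (a := fun j => K (x - IZR j * h n)).
      assert (E1 : un n x = h n * window_sum (W n) (fun j => a j * snd (NV n) j) +
        h n * window_sum M (fun j => (if in_window_dec (W n) j then 0 else a j) * snd (NV n) j)).
      { unfold un. rewrite <- Rmult_plus_distr_l. f_equal.
        rewrite <- (window_sum_extend (fst (NV n)) M);
          [|lia|intros j Hj; rewrite (Hs j Hj); ring].
        rewrite (window_sum_ext (W n) _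
          (fun j => (if in_window_dec (W n) j then a j else 0) * snd (NV n) j))
          by (intros j Hj; destruct (in_window_dec (W n) j); [reflexivity|contradiction]).
        rewrite <- (window_sum_extend (W n) M), <- window_sum_plus;
          [|lia|intros j Hj; destruct (in_window_dec (W n) j); [contradiction|ring]].
        apply window_sum_ext. intros j _. unfold a. destruct (in_window_dec (W n) j); ring. }
      assert (E2 : Rabs (h n * window_sum M (fun j => (if in_window_dec (W n) j then 0 else a j) *
                     snd (NV n) j)) <= b * T).
      { apply (Hwt n M (fun j => if in_window_dec (W n) j then 0 else a j) b Hb);
          [|lia]. intros j. destruct (in_window_dec (W n) j) as [Hj|Hj];
          [rewrite Rabs_R0; exact Hb|].
        unfold a, b. destruct HK as (Hal & _ & _ & HKe).
        eapply Rle_trans; [apply HKe|]. apply Rmult_le_compat_l; [exact HC|].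
        apply exp_monotone, Ropp_le_contravar, Rmult_le_compat_l; [lra|].
        assert (HRj : R <= Rabs (IZR j * h n)).
        { rewrite <- HWn. unfold in_window in Hj.
          assert (Hj' : (j <= - Z.of_nat (W n) \/ Z.of_nat (W n) <= j)%Z) by lia.
          rewrite Rabs_mult, (Rabs_pos_eq (h n)) by (generalize (Hh n); lra).
          apply Rmult_le_compat_r; [generalize (Hh n); lra|].
          rewrite INR_IZR_INZ. rewrite <- abs_IZR. apply IZR_le. lia. }
        generalize (Rabs_triang_inv (IZR j * h n) x). rewrite Rabs_minus_sym. lra. }
      assert (E3 : Rabs (h n * window_sum (W n) (fun j => a j * snd (NV n) j) -
          h n * window_sum (W n) (fun j => Q n (IZR j * h n))) <= 2 * R * C * eta n).
      { rewrite <- Rmult_minus_distr_l, Rabs_mult, (Rabs_pos_eq (h n))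
          by (generalize (Hh n); lra).
        replace (2 * R * C * eta n) with (h n * (2 * INR (W n) * (C * eta n)))
          by (rewrite <- HWn; ring).
        apply Rmult_le_compat_l; [generalize (Hh n); lra|].
        replace (window_sum _ _ - window_sum _ _) with (window_sum (W n) (fun j => a j * (snd (NV n) j - P n (IZR j * h n)))).
        - eapply Rle_trans; [apply window_sum_abs|]. rewrite <- window_sum_const. apply window_sum_le. intros j _.
          rewrite Rabs_mult. apply Rmult_le_compat; [apply Rabs_pos..|apply HKC|apply Ha].
        - rewrite (window_sum_ext _ _ (fun j => a j * snd (NV n) j + (-1) * Q n (IZR j * h n)))
            by (intros; unfold Q, a; ring).
          rewrite window_sum_plus, window_sum_scal. ring. }
      apply Rabs_le_between in E2. apply Rabs_le_between in E3.
      rewrite E1. apply Rabs_le. rewrite (Rmult_comm T b). lra. }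
    assert (Hlb : filterlim (fun n => T * b + 2 * R * C * eta n) U (locally (T * b))).
    { rewrite <- (Rplus_0_r (T * b)) at 1. apply filterlim_Rplus; [apply HP|apply filterlim_const|].
      rewrite <- (Rmult_0_r (2 * R * C)).
      apply filterlim_Rmult; [apply HP|apply filterlim_const|exact Hetalim]. }
    apply Rabs_le. split.
    + assert (RInt (fun y => K (x - y) * (g * Rmax 0 (u y - kap))) (- R) R <= u x + T * b); [|lra].
      refine (filterlim_Rle U _ _ _ _ _ HQ
                (filterlim_Rplus U _ _ _ _ (Hu x) Hlb)).
      intros n. generalize (Hn n). intros H. apply Rabs_le_between in H. lra.
    + assert (u x <= RInt (fun y => K (x - y) * (g * Rmax 0 (u y - kap))) (- R) R + T * b); [|lra].
      refine (filterlim_Rle U _ _ _ _ _ (Hu x)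
                (filterlim_Rplus U _ _ _ _ HQ Hlb)).
      intros n. generalize (Hn n). intros H. apply Rabs_le_between in H. lra.
Qed.

(** * The Green function of the beam operator *)

Lemma is_derive_eq (f : R -> R) (x d d' : R) :
  is_derive f x d -> d = d' -> is_derive f x d'.
Proof. now intros H <-. Qed.

Definition damped (al be A B s : R) : R :=
  exp (- al * s) * (A * cos (be * s) + B * sin (be * s)).

(** The integral of [damped al be A B (x - y) * V y] over y < x, written through the
    addition theorem: [C] and [S] stand for the moments of V against
    exp (al y) cos (be y) and exp (al y) sin (be y), taken up to x. In this form it
    can be differentiated without differentiating under the integral sign. With
    [- al] and [- B] it is the integral over y > x. *)
Definition damped_response (al be A B : R) (C S : R -> R) (x : R) : R :=
  exp (- al * x) * ((A * cos (be * x) + B * sin (be * x)) * C x +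
                    (A * sin (be * x) - B * cos (be * x)) * S x).

Lemma is_derive_damped al be A B s :
  is_derive (damped al be A B) s
    (damped al be (- al * A + be * B) (- al * B - be * A) s).
Proof. unfold damped. auto_derive; [exact I|]. ring. Qed.

Lemma trig_bound A B t : Rabs (A * cos t + B * sin t) <= Rabs A + Rabs B.
Proof.
  eapply Rle_trans; [apply Rabs_triang|]. rewrite !Rabs_mult.
  assert (Rabs (cos t) <= 1) by (apply Rabs_le; generalize (COS_bound t); lra).
  assert (Rabs (sin t) <= 1) by (apply Rabs_le; generalize (SIN_bound t); lra).
  generalize (Rabs_pos A) (Rabs_pos B). nra.
Qed.

Lemma damped_bound al be A B s :
  Rabs (damped al be A B s) <= (Rabs A + Rabs B) * exp (- al * s).
Proof.
  unfold damped. rewrite Rabs_mult, (Rabs_pos_eq (exp _)) by apply Rlt_le, exp_pos.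
  rewrite Rmult_comm. apply Rmult_le_compat_r; [apply Rlt_le, exp_pos|apply trig_bound].
Qed.

Lemma damped_response_bound al be A B C S x :
  Rabs (damped_response al be A B C S x) <=
  (Rabs A + Rabs B) * (Rabs (exp (- al * x) * C x) + Rabs (exp (- al * x) * S x)).
Proof.
  unfold damped_response. rewrite Rmult_plus_distr_l.
  eapply Rle_trans; [apply Rabs_triang|].
  rewrite Rmult_plus_distr_l. apply Rplus_le_compat.
  - rewrite (Rmult_comm _ (C x)), <- Rmult_assoc, Rmult_comm, Rabs_mult.
    apply Rmult_le_compat_r; [apply Rabs_pos|apply trig_bound].
  - rewrite (Rmult_comm _ (S x)), <- Rmult_assoc, Rmult_comm, Rabs_mult.
    apply Rmult_le_compat_r; [apply Rabs_pos|].
    replace (A * sin (be * x) - B * cos (be * x)) with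
      (- B * cos (be * x) + A * sin (be * x)) by ring.
    eapply Rle_trans; [apply trig_bound|]. rewrite Rabs_Ropp. lra.
Qed.

Lemma is_derive_damped_response al be A B C S x v :
  is_derive C x (exp (al * x) * (cos (be * x) * v)) ->
  is_derive S x (exp (al * x) * (sin (be * x) * v)) ->
  is_derive (damped_response al be A B C S) x
    (damped_response al be (- al * A + be * B) (- al * B - be * A) C S x + A * v).
Proof.
  intros HC HS. unfold damped_response.
  auto_derive; [repeat split; eexists; eassumption|].
  replace (Derive (fun x0 => C x0) x) with (exp (al * x) * (cos (be * x) * v))
    by (symmetry; now apply is_derive_unique).
  replace (Derive (fun x0 => S x0) x) with (exp (al * x) * (sin (be * x) * v))
    by (symmetry; now apply is_derive_unique).
  assert (E : exp (- al * x) * exp (al * x) = 1).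
  { rewrite <- exp_plus. replace (- al * x + al * x) with 0 by ring. apply exp_0. }
  assert (E2 : Rsqr (sin (be * x)) + Rsqr (cos (be * x)) = 1) by apply sin2_cos2.
  unfold Rsqr in E2.
  set (e := exp (- al * x)) in *. set (e' := exp (al * x)) in *.
  set (c := cos (be * x)) in *. set (s := sin (be * x)) in *.
  transitivity (e * (((- al * A + be * B) * c + (- al * B - be * A) * s) * C x
     + ((- al * A + be * B) * s - (- al * B - be * A) * c) * S x)
     + A * v * (e * e') * (s * s + c * c)); [ring|].
  rewrite E, E2. ring.
Qed.

(** On s > 0, the derivative of order l of the Green function of
    u'''' + 2 (be^2 - al^2) u'' + (al^2 + be^2)^2 u is
    [damped al be (green_cos al be l) (green_sin al be l)]. The function is even, and
    [green_cos al be l] is the value at 0+: it has to be 0 for l = 1 and 1/2 for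
    l = 3, which gives the third derivative a jump of 1. *)
Definition green_cos (al be : R) (l : nat) : R :=
  match l with
  | 0%nat => / (4 * al * (al ^ 2 + be ^ 2))
  | 1%nat => 0
  | 2%nat => - / (4 * al)
  | _ => / 2
  end.

Definition green_sin (al be : R) (l : nat) : R :=
  match l with
  | 0%nat => / (4 * be * (al ^ 2 + be ^ 2))
  | 1%nat => - / (4 * al * be)
  | 2%nat => / (4 * be)
  | _ => be / (4 * al) - al / (4 * be)
  end.

Definition green (al be s : R) : R :=
  damped al be (green_cos al be 0) (green_sin al be 0) (Rabs s).

Lemma green_decaying al be : 0 < al -> 0 < be ->
  decaying_kernel (Rabs (green_cos al be 0) + Rabs (green_sin al be 0)) al
    (/ (4 * al * be)) (green al be).
Proof.
  intros Hal Hbe. split; [exact Hal|]. split; [|split].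
  - intros x y. unfold green. set (f := damped al be _ _).
    assert (Hd : forall s, is_derive f s (damped al be 0 (- / (4 * al * be)) s)).
    { intros s. unfold f.
      replace (damped al be 0 (- / (4 * al * be)) s) with
        (damped al be (- al * green_cos al be 0 + be * green_sin al be 0)
           (- al * green_sin al be 0 - be * green_cos al be 0) s);
        [apply is_derive_damped|].
      f_equal; simpl; field; repeat split; nra. }
    destruct (MVT_gen f (Rabs y) (Rabs x) (damped al be 0 (- / (4 * al * be))))
      as [s [Hs E]].
    + intros s _. apply Hd.
    + intros s _. apply continuity_pt_filterlim.
      apply (ex_derive_continuous (V := R_NormedModule) f). eexists. apply Hd.
    + rewrite E, Rabs_mult. apply Rmult_le_compat; [apply Rabs_pos..| |].
      * eapply Rle_trans; [apply damped_bound|].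
        rewrite Rabs_R0, Rabs_Ropp, Rplus_0_l, Rabs_pos_eq
          by (apply Rlt_le, Rinv_0_lt_compat; nra).
        rewrite <- (Rmult_1_r (/ (4 * al * be))) at 2.
        apply Rmult_le_compat_l; [apply Rlt_le, Rinv_0_lt_compat; nra|].
        rewrite <- exp_0. apply exp_monotone.
        assert (0 <= s); [|nra].
        apply Rle_trans with (2 := proj1 Hs). apply Rmin_glb; apply Rabs_pos.
      * apply Rabs_triang_inv2.
  - intros s. unfold green. now rewrite Rabs_Ropp.
  - intros s. unfold green. eapply Rle_trans; [apply damped_bound|].
    right. f_equal. f_equal. ring.
Qed.

Definition potential (al be : R) (C1 S1 C2 S2 : R -> R) (l : nat) (x : R) : R :=
  damped_response al be (green_cos al be l) (green_sin al be l) C1 S1 x +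
  (-1) ^ l * damped_response (- al) be (green_cos al be l) (- green_sin al be l) C2 S2 x.

(** Differentiating the two one-sided responses produces, as a factor of V, the jump
    of a derivative of the Green function at 0. It vanishes below the third
    derivative, where it is 1 and gives the source term of the equation. *)
Lemma potential_ode al be C1 S1 C2 S2 V x : 0 < al -> 0 < be ->
  is_derive C1 x (exp (al * x) * (cos (be * x) * V x)) ->
  is_derive S1 x (exp (al * x) * (sin (be * x) * V x)) ->
  is_derive C2 x (- (exp (- al * x) * (cos (be * x) * V x))) ->
  is_derive S2 x (- (exp (- al * x) * (sin (be * x) * V x))) ->
  let p := potential al be C1 S1 C2 S2 in
  is_derive (p 0%nat) x (p 1%nat x) /\ is_derive (p 1%nat) x (p 2%nat x) /\
  is_derive (p 2%nat) x (p 3%nat x) /\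
  is_derive (p 3%nat) x
    (V x - 2 * (be ^ 2 - al ^ 2) * p 2%nat x - (al ^ 2 + be ^ 2) ^ 2 * p 0%nat x).
Proof.
  intros Hal Hbe HC1 HS1 HC2 HS2 p.
  assert (HC2' : is_derive C2 x (exp (- al * x) * (cos (be * x) * - V x))).
  { replace (exp _ * _) with (- (exp (- al * x) * (cos (be * x) * V x))) by ring. exact HC2. }
  assert (HS2' : is_derive S2 x (exp (- al * x) * (sin (be * x) * - V x))).
  { replace (exp _ * _) with (- (exp (- al * x) * (sin (be * x) * V x))) by ring. exact HS2. }
  assert (Hd : forall l, is_derive (p l) x
    ((damped_response al be (- al * green_cos al be l + be * green_sin al be l)
        (- al * green_sin al be l - be * green_cos al be l) C1 S1 x
      + green_cos al be l * V x)
     + (-1) ^ l * (damped_response (- al) be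
         (- - al * green_cos al be l + be * - green_sin al be l)
         (- - al * - green_sin al be l - be * green_cos al be l) C2 S2 x
       + green_cos al be l * - V x))).
  { intros l. unfold p, potential.
    apply (is_derive_plus (V := R_NormedModule)).
    - now apply is_derive_damped_response.
    - apply is_derive_scal. now apply is_derive_damped_response. }
  split; [|split; [|split]].
  - apply (is_derive_eq _ _ _ _ (Hd 0%nat)).
    unfold p, potential, damped_response. cbn [green_cos green_sin pow].
    field. repeat split; nra.
  - apply (is_derive_eq _ _ _ _ (Hd 1%nat)).
    unfold p, potential, damped_response. cbn [green_cos green_sin pow].
    field. repeat split; nra.
  - apply (is_derive_eq _ _ _ _ (Hd 2%nat)).
    unfold p, potential, damped_response. cbn [green_cos green_sin pow].
    field. repeat split; nra.
  - apply (is_derive_eq _ _ _ _ (Hd 3%nat)).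
    unfold p, potential, damped_response. cbn [green_cos green_sin pow].
    field. repeat split; nra.
Qed.

(** * Convolution with the Green function *)

Definition moment (al : R) (w : R -> R) (p q : R) : R :=
  RInt (fun y => exp (al * y) * w y) p q.

Lemma continuous_exp_mult al (w : R -> R) y : continuous w y ->
  continuous (fun y => exp (al * y) * w y) y.
Proof.
  intros Hw. apply (continuous_mult (K := R_AbsRing)); [|exact Hw].
  apply (@ex_derive_continuous R_AbsRing R_NormedModule). auto_derive. exact I.
Qed.

Lemma continuous_RInt (f : R -> R) a b : (forall y, continuous f y) -> ex_RInt f a b.
Proof.
  intros Hf. apply (ex_RInt_continuous (V := R_CompleteNormedModule)). auto.
Qed.

Lemma ex_moment al (w : R -> R) p q : (forall y, continuous w y) ->
  ex_RInt (fun y => exp (al * y) * w y) p q.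
Proof.
  intros Hw. apply continuous_RInt. intros y. now apply continuous_exp_mult.
Qed.

Lemma moment_Chasles al (w : R -> R) p q r : (forall y, continuous w y) ->
  moment al w p q + moment al w q r = moment al w p r.
Proof.
  intros Hw. apply (RInt_Chasles (V := R_CompleteNormedModule)); now apply ex_moment.
Qed.

Lemma is_derive_moment_r al (w : R -> R) p x : (forall y, continuous w y) ->
  is_derive (moment al w p) x (exp (al * x) * w x).
Proof.
  intros Hw. apply (is_derive_RInt (V := R_NormedModule) (fun y => exp (al * y) * w y) _ p).
  - apply filter_forall. intros y. apply (RInt_correct (V := R_CompleteNormedModule)).
    now apply ex_moment.
  - now apply continuous_exp_mult.
Qed.

Lemma is_derive_moment_l al (w : R -> R) x q : (forall y, continuous w y) ->
  is_derive (fun x => moment al w x q) x (- (exp (al * x) * w x)).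
Proof.
  intros Hw. apply (is_derive_RInt' (V := R_NormedModule) (fun y => exp (al * y) * w y) _ x q).
  - apply filter_forall. intros y. apply (RInt_correct (V := R_CompleteNormedModule)).
    now apply ex_moment.
  - now apply continuous_exp_mult.
Qed.

Lemma moment_bound al (w V : R -> R) p q : 0 < al -> p <= q ->
  (forall y, continuous w y) -> (forall y, continuous V y) ->
  (forall y, Rabs (w y) <= V y) ->
  Rabs (moment al w p q) <= exp (al * q) * RInt V p q.
Proof.
  intros Hal Hpq Hw HV HwV.
  assert (HE : ex_RInt (fun y => scal (exp (al * q)) (V y)) p q).
  { apply (ex_RInt_scal (V := R_NormedModule)). now apply continuous_RInt. }
  replace (exp (al * q) * RInt V p q) with (RInt (fun y => scal (exp (al * q)) (V y)) p q).
  2:{ apply (RInt_scal (V := R_CompleteNormedModule)). now apply continuous_RInt. }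
  eapply Rle_trans; [apply abs_RInt_le; [exact Hpq|now apply ex_moment]|].
  apply RInt_le; [exact Hpq| |exact HE|].
  - apply continuous_RInt. intros y. apply (continuous_comp _ Rabs).
    + now apply continuous_exp_mult.
    + apply (continuous_Rabs (exp (al * y) * w y)).
  - intros y Hy. rewrite Rabs_mult, (Rabs_pos_eq (exp _)) by apply Rlt_le, exp_pos.
    apply Rmult_le_compat; [apply Rlt_le, exp_pos|apply Rabs_pos| |apply HwV].
    apply exp_monotone. nra.
Qed.

Lemma continuous_trig_mult (trig : R -> R) be (V : R -> R) y :
  (trig = cos \/ trig = sin) -> continuous V y ->
  continuous (fun y => trig (be * y) * V y) y.
Proof.
  intros Ht HV. apply (continuous_mult (K := R_AbsRing)); [|exact HV].
  apply (@ex_derive_continuous R_AbsRing R_NormedModule).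
  destruct Ht as [-> | ->]; auto_derive; exact I.
Qed.

Lemma green_convolution al be (V : R -> R) p q x : 0 < al -> p <= x <= q ->
  (forall y, continuous V y) ->
  RInt (fun y => green al be (x - y) * V y) p q =
  potential al be
    (moment al (fun y => cos (be * y) * V y) p)
    (moment al (fun y => sin (be * y) * V y) p)
    (fun x => moment (- al) (fun y => cos (be * y) * V y) x q)
    (fun x => moment (- al) (fun y => sin (be * y) * V y) x q) 0 x.
Proof.
  intros Hal Hx HV.
  set (A := green_cos al be 0). set (B := green_sin al be 0).
  assert (Hc : forall y, continuous (fun y => cos (be * y) * V y) y)
    by (intros; apply (continuous_trig_mult cos); auto).
  assert (Hs : forall y, continuous (fun y => sin (be * y) * V y) y)
    by (intros; apply (continuous_trig_mult sin); auto).
  assert (Hpart : forall a P Q s t, (forall y, s <= y <= t ->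
     green al be (x - y) * V y = exp (- a * x) * P * (exp (a * y) * (cos (be * y) * V y)) +
                 exp (- a * x) * Q * (exp (a * y) * (sin (be * y) * V y))) -> s <= t ->
     is_RInt (fun y => green al be (x - y) * V y) s t
       (exp (- a * x) * (P * moment a (fun y => cos (be * y) * V y) s t +
                    Q * moment a (fun y => sin (be * y) * V y) s t))).
  { intros a P Q s t Heq Hst.
    replace (exp (- a * x) * _) with
     (exp (- a * x) * P * moment a (fun y => cos (be * y) * V y) s t +
      exp (- a * x) * Q * moment a (fun y => sin (be * y) * V y) s t) by ring.
    apply (is_RInt_ext (V := R_NormedModule) (fun y =>
       plus (scal (exp (- a * x) * P) (exp (a * y) * (cos (be * y) * V y)))
            (scal (exp (- a * x) * Q) (exp (a * y) * (sin (be * y) * V y))))).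
    - intros y Hy. rewrite Rmin_left, Rmax_right in Hy by exact Hst.
      symmetry. apply Heq. lra.
    - apply (is_RInt_plus (V := R_NormedModule));
      apply (is_RInt_scal (V := R_NormedModule));
      apply (RInt_correct (V := R_CompleteNormedModule)); now apply ex_moment. }
  assert (Hexp : forall a y, exp (a * (x - y)) = exp (a * x) * exp (- a * y)).
  { intros a y. rewrite <- exp_plus. f_equal. ring. }
  apply is_RInt_unique.
  unfold potential, damped_response. fold A B. rewrite pow_O, Rmult_1_l.
  apply (is_RInt_Chasles (V := R_NormedModule) _ p x q).
  - apply Hpart; [|lra]. intros y Hy. unfold green, damped. fold A B.
    rewrite Rabs_pos_eq by lra. rewrite Hexp.
    rewrite Rmult_minus_distr_l, cos_minus, sin_minus.
    rewrite Ropp_involutive. ring.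
  - apply Hpart; [|lra]. intros y Hy. unfold green, damped. fold A B.
    rewrite Rabs_minus_sym, Rabs_pos_eq by lra.
    replace (exp (- al * (y - x))) with (exp (- - al * x) * exp (- al * y))
      by (rewrite <- exp_plus; f_equal; ring).
    rewrite Rmult_minus_distr_l, cos_minus, sin_minus. ring.
Qed.

Definition vanishing (f : R -> R) : Prop :=
  forall eps, 0 < eps -> exists X, forall x, X <= Rabs x -> Rabs (f x) <= eps.

Definition integrable_bound (V : R -> R) (t : R) : Prop :=
  (forall y, continuous V y) /\ (forall y, 0 <= V y) /\
  (forall p q, p <= q -> RInt V p q <= t).

Lemma integrable_tail V t eps : integrable_bound V t -> 0 < eps ->
  exists X, 0 <= X /\ forall p q, p <= q -> (X <= p \/ q <= - X) -> RInt V p q <= eps.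
Proof.
  intros (HVc & HVp & HVt) Heps.
  assert (HE : forall a b, ex_RInt V a b) by (intros; now apply continuous_RInt).
  assert (Hpos : forall p q, p <= q -> 0 <= RInt V p q).
  { intros p q Hpq. apply RInt_ge_0; auto. }
  destruct (completeness (fun s => exists X, 0 <= X /\ s = RInt V (- X) X))
    as [l [Hub Hlub]].
  { exists t. intros s [X [HX ->]]. apply HVt. lra. }
  { exists (RInt V (- 0) 0), 0. split; [lra|reflexivity]. }
  assert (HX : exists X, 0 <= X /\ l - eps < RInt V (- X) X).
  { apply NNPP. intros Hn. assert (l <= l - eps); [|lra]. apply Hlub.
    intros s [X [HX ->]]. apply Rnot_lt_le. intros H. apply Hn. now exists X. }
  destruct HX as [X [HX HXl]]. exists X. split; [exact HX|]. intros p q Hpq Hside.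
  set (Y := Rmax (Rabs p) (Rabs q)).
  assert (HYp : - Y <= p <= Y).
  { assert (Rabs p <= Y) by apply Rmax_l. now apply Rabs_le_between. }
  assert (HYq : - Y <= q <= Y).
  { assert (Rabs q <= Y) by apply Rmax_r. now apply Rabs_le_between. }
  assert (HYl : RInt V (- Y) Y <= l) by (apply Hub; exists Y; split; [lra|reflexivity]).
  assert (Ch : forall a b c, RInt V a b + RInt V b c = RInt V a c)
    by (intros; apply (RInt_Chasles (V := R_CompleteNormedModule)); apply HE).
  destruct Hside as [H|H].
  - generalize (Ch (- Y) (- X) Y) (Ch (- X) X Y) (Ch X p Y) (Ch p q Y)
      (Hpos (- Y) (- X)) (Hpos X p) (Hpos q Y). lra.
  - generalize (Ch (- Y) X Y) (Ch (- Y) (- X) X) (Ch (- Y) q (- X)) (Ch (- Y) p q)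
      (Hpos X Y) (Hpos q (- X)) (Hpos (- Y) p). lra.
Qed.

(** The integral of exp (al y) f y over y < x, as a limit along the points
    [- (n * L)], exists by the Cauchy criterion at x = 0. After multiplication by
    exp (- al x) it tends to 0 for x -> +oo as well: the part before a point X is
    damped by exp (- al (x - X)), the part after X is at most a tail of the integral
    of V. *)
Lemma left_moment al (f V : R -> R) t L : 0 < al -> 0 < L -> integrable_bound V t ->
  (forall y, continuous f y) -> (forall y, Rabs (f y) <= V y) ->
  exists C : R -> R,
    (forall x, is_derive C x (exp (al * x) * f x)) /\
    (forall x, is_lim_seq (fun n => moment al f (- (INR n * L)) x) (C x)) /\
    vanishing (fun x => exp (- al * x) * C x).
Proof.
  intros Hal HL HV Hf HfV. destruct (HV) as (HVc & HVp & HVt).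
  assert (Ht : 0 <= t).
  { generalize (HVt 0 0 (Rle_refl 0)). now rewrite RInt_point. }
  assert (HE : forall a b, ex_RInt V a b) by (intros; now apply continuous_RInt).
  assert (Hb : forall p q, p <= q -> Rabs (moment al f p q) <= exp (al * q) * t).
  { intros p q Hpq. eapply Rle_trans; [now apply moment_bound with (V := V)|].
    apply Rmult_le_compat_l; [apply Rlt_le, exp_pos|now apply HVt]. }
  assert (Hsmall : forall eps, 0 < eps -> exists Y, 0 <= Y /\ forall x, Y <= x -> exp (- al * x) * t <= eps).
  { intros eps Heps. exists (t / (al * eps)).
    split. { apply Rdiv_le_0_compat; nra. }
    intros x Hx.
    assert (E : t / (al * eps) * (al * eps) = t) by (field; lra).
    assert (H1 : 1 + al * x <= exp (al * x)) by apply exp_ineq1_le.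
    assert (H2 : exp (- al * x) * exp (al * x) = 1).
    { rewrite <- exp_plus. replace (- al * x + al * x) with 0 by ring. apply exp_0. }
    assert (H0 : t / (al * eps) * (al * eps) <= x * (al * eps))
      by (apply Rmult_le_compat_r; nra).
    assert (H3 : t <= eps * exp (al * x)) by nra.
    generalize (exp_pos (- al * x)). intros H4.
    apply Rle_trans with (exp (- al * x) * (eps * exp (al * x))).
    - apply Rmult_le_compat_l; lra.
    - rewrite (Rmult_comm eps), <- Rmult_assoc, H2. lra. }
  assert (HC0 : exists c, is_lim_seq (fun n => moment al f (- (INR n * L)) 0) (Finite c)).
  { apply ex_lim_seq_cauchy_corr. intros eps.
    destruct (Hsmall (eps / 2) ltac:(generalize (cond_pos eps); lra)) as [Y [HY0 HY]].
    destruct (INR_unbounded (Y / L)) as [N HN].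
    assert (HNY : forall n, (N <= n)%nat -> Y <= INR n * L).
    { intros n Hn. apply le_INR in Hn.
      replace Y with (Y / L * L) by (field; lra). apply Rmult_le_compat_r; lra. }
    assert (Hm : forall n m, (N <= n)%nat -> (n <= m)%nat ->
      Rabs (moment al f (- (INR m * L)) 0 - moment al f (- (INR n * L)) 0) < eps).
    { intros n m Hn Hnm. rewrite <- (moment_Chasles al f _ (- (INR n * L)) 0 Hf).
      replace (_ + _ - _) with (moment al f (- (INR m * L)) (- (INR n * L))) by ring.
      apply Rle_lt_trans with (eps / 2); [|generalize (cond_pos eps); lra].
      eapply Rle_trans; [apply Hb|].
      - apply le_INR in Hnm. nra.
      - replace (al * - (INR n * L)) with (- al * (INR n * L)) by ring.
        now apply HY, HNY. }
    exists N. intros n m Hn Hm'.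
    destruct (Nat.le_ge_cases n m) as [H|H].
    - rewrite Rabs_minus_sym. now apply Hm.
    - now apply Hm. }
  destruct HC0 as [c Hc].
  exists (fun x => c + moment al f 0 x).
  assert (HCl : forall x, is_lim_seq (fun n => moment al f (- (INR n * L)) x)
                  (Finite (c + moment al f 0 x))).
  { intros x.
    apply is_lim_seq_ext with (fun n => moment al f (- (INR n * L)) 0 + moment al f 0 x).
    - intros n. now apply moment_Chasles.
    - apply (is_lim_seq_plus' _ _ c (moment al f 0 x)); [exact Hc|apply is_lim_seq_const]. }
  split; [|split; [exact HCl|]].
  - intros x. apply (is_derive_eq _ _ (plus zero (exp (al * x) * f x)));
      [|apply plus_zero_l].
    apply (is_derive_plus (V := R_NormedModule) (fun _ => c));
      [apply (is_derive_const (V := R_NormedModule))|now apply is_derive_moment_r].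
  - intros eps Heps.
    destruct (integrable_tail V t (eps / 2) HV ltac:(lra)) as [X [HX0 HX]].
    destruct (Hsmall (eps / 2) ltac:(lra)) as [Y [HY0 HY]].
    assert (Hcl : forall x b, (exists N, forall n, (N <= n)%nat -> Rabs (moment al f (- (INR n * L)) x) <= b) ->
      Rabs (c + moment al f 0 x) <= b).
    { intros x b [N HN].
      apply (filterlim_Rle eventually (fun n => Rabs (moment al f (- (INR (n + N) * L)) x)) (fun _ => b));
        [intros n; apply HN; lia| |apply filterlim_const].
      apply (is_lim_seq_abs _ (Finite (c + moment al f 0 x))).
      apply (is_lim_seq_incr_n (fun n => moment al f (- (INR n * L)) x) N (Finite (c + moment al f 0 x))).
      apply HCl. }
    assert (Hfar : forall r, exists N, forall n, (N <= n)%nat -> - (INR n * L) <= r).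
    { intros r. destruct (INR_unbounded (- r / L)) as [N HN]. exists N. intros n Hn.
      apply le_INR in Hn. assert (- r / L * L = - r) by (field; lra). nra. }
    assert (Hinv : forall x b, exp (- al * x) * (exp (al * x) * b) = b).
    { intros x b. rewrite <- Rmult_assoc, <- exp_plus.
      replace (- al * x + al * x) with 0 by ring. rewrite exp_0. ring. }
    exists (X + Y). intros x Hx.
    rewrite Rabs_mult, (Rabs_pos_eq (exp _)) by apply Rlt_le, exp_pos.
    destruct (Rle_or_lt 0 x) as [Hx0|Hx0].
    + rewrite Rabs_pos_eq in Hx by exact Hx0.
      apply Rle_trans with (exp (- al * x) * (exp (al * X) * t + exp (al * x) * (eps / 2))).
      * apply Rmult_le_compat_l; [apply Rlt_le, exp_pos|]. apply Hcl.
        destruct (Hfar X) as [N HN]. exists N. intros n Hn.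
        rewrite <- (moment_Chasles al f _ X x Hf).
        eapply Rle_trans; [apply Rabs_triang|]. apply Rplus_le_compat.
        -- now apply Hb, HN.
        -- eapply Rle_trans; [apply moment_bound with (V := V); auto; lra|].
           apply Rmult_le_compat_l; [apply Rlt_le, exp_pos|]. apply HX; lra.
      * rewrite Rmult_plus_distr_l, Hinv, <- Rmult_assoc, <- exp_plus.
        replace (- al * x + al * X) with (- al * (x - X)) by ring.
        generalize (HY (x - X) ltac:(lra)). lra.
    + rewrite Rabs_left in Hx by exact Hx0.
      apply Rle_trans with (exp (- al * x) * (exp (al * x) * (eps / 2))); [|rewrite Hinv; lra].
      apply Rmult_le_compat_l; [apply Rlt_le, exp_pos|]. apply Hcl.
      destruct (Hfar x) as [N HN]. exists N. intros n Hn. specialize (HN n Hn).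
      eapply Rle_trans; [apply moment_bound with (V := V); auto; lra|].
      apply Rmult_le_compat_l; [apply Rlt_le, exp_pos|]. apply HX; lra.
Qed.

Lemma continuous_reflection (f : R -> R) y : continuous f (- y) -> continuous (fun y => f (- y)) y.
Proof.
  intros Hf. apply (continuous_comp Ropp f); [|exact Hf].
  apply (@ex_derive_continuous R_AbsRing R_NormedModule). auto_derive. exact I.
Qed.

Lemma RInt_reflection (f : R -> R) a b : (forall y, continuous f y) ->
  RInt (fun y => f (- y)) a b = RInt f (- b) (- a).
Proof.
  intros Hf.
  apply is_RInt_unique.
  apply (is_RInt_ext (V := R_NormedModule) (fun y => opp (opp (f (- y))))).
  { intros y _. apply (opp_opp (G := R_AbelianGroup)). }
  rewrite <- (opp_opp (G := R_AbelianGroup) (RInt f (- b) (- a))).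
  apply (is_RInt_opp (V := R_NormedModule)), (is_RInt_comp_opp (V := R_NormedModule)).
  apply (is_RInt_swap (V := R_NormedModule)).
  apply (RInt_correct (V := R_CompleteNormedModule)). now apply continuous_RInt.
Qed.

Lemma right_moment al (f V : R -> R) t L : 0 < al -> 0 < L -> integrable_bound V t ->
  (forall y, continuous f y) -> (forall y, Rabs (f y) <= V y) ->
  exists C : R -> R,
    (forall x, is_derive C x (- (exp (- al * x) * f x))) /\
    (forall x, is_lim_seq (fun n => moment (- al) f x (INR n * L)) (C x)) /\
    vanishing (fun x => exp (al * x) * C x).
Proof.
  intros Hal HL (HVc & HVp & HVt) Hf HfV.
  assert (Hf' : forall y, continuous (fun y => f (- y)) y)
    by (intros; now apply continuous_reflection).
  assert (HV' : forall y, continuous (fun y => V (- y)) y)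
    by (intros; now apply continuous_reflection).
  destruct (left_moment al (fun y => f (- y)) (fun y => V (- y)) t L Hal HL)
    as (C & HC1 & HC2 & HC3); [|exact Hf'|auto|].
  { split; [exact HV'|]. split; [auto|]. intros p q Hpq.
    rewrite RInt_reflection by exact HVc. apply HVt. lra. }
  exists (fun x => C (- x)). split; [|split].
  - intros x.
    assert (H : is_derive (fun x => C (- x)) x (scal (-1) (exp (al * - x) * f (- - x)))).
    { apply (is_derive_comp (V := R_NormedModule) C Ropp); [apply HC1|].
      auto_derive; [exact I|ring]. }
    apply (is_derive_eq _ _ _ _ H). rewrite Ropp_involutive.
    replace (al * - x) with (- al * x) by ring. unfold scal; simpl; unfold mult; simpl. ring.
  - intros x. apply is_lim_seq_ext with (2 := HC2 (- x)). intros n.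
    assert (E := RInt_reflection (fun y => exp (- al * y) * f y) (- (INR n * L)) (- x)
                   ltac:(intros; now apply continuous_exp_mult)).
    rewrite !Ropp_involutive in E. unfold moment. rewrite <- E.
    apply (RInt_ext (V := R_CompleteNormedModule)). intros y _.
    replace (- al * - y) with (al * y) by ring. reflexivity.
  - intros eps Heps. destruct (HC3 eps Heps) as [X HX]. exists X. intros x Hx.
    replace (al * x) with (- al * - x) by ring. apply HX. now rewrite Rabs_Ropp.
Qed.

(** * From the integral equation to a travelling wave *)

Lemma vanishing_plus_scal f g c : vanishing f -> vanishing g ->
  vanishing (fun x => c * (f x + g x)).
Proof.
  intros Hf Hg eps Heps.
  set (e := eps / (2 * (Rabs c + 1))).
  assert (Hc := Rabs_pos c).
  assert (He : 0 < e) by (apply Rdiv_lt_0_compat; lra).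
  assert (Ee : e * (2 * (Rabs c + 1)) = eps) by (unfold e; field; lra).
  destruct (Hf e He) as [X HX]. destruct (Hg e He) as [Y HY].
  exists (Rmax X Y). intros x Hx.
  assert (H1 := HX x (Rle_trans _ _ _ (Rmax_l X Y) Hx)).
  assert (H2 := HY x (Rle_trans _ _ _ (Rmax_r X Y) Hx)).
  rewrite Rabs_mult. generalize (Rabs_triang (f x) (g x)). nra.
Qed.

Lemma vanishing_le f g : vanishing g -> (forall x, Rabs (f x) <= g x) -> vanishing f.
Proof.
  intros Hg H eps Heps. destruct (Hg eps Heps) as [X HX]. exists X. intros x Hx.
  eapply Rle_trans; [apply H|]. eapply Rle_trans; [apply Rle_abs|auto].
Qed.

Lemma vanishing_abs f : vanishing f -> vanishing (fun x => Rabs (f x)).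
Proof.
  intros Hf eps Heps. destruct (Hf eps Heps) as [X HX]. exists X. intros x Hx.
  rewrite Rabs_Rabsolu. auto.
Qed.

Lemma vanishing_potential al be C1 S1 C2 S2 l :
  vanishing (fun x => exp (- al * x) * C1 x) -> vanishing (fun x => exp (- al * x) * S1 x) ->
  vanishing (fun x => exp (al * x) * C2 x) -> vanishing (fun x => exp (al * x) * S2 x) ->
  vanishing (potential al be C1 S1 C2 S2 l).
Proof.
  intros H1 H2 H3 H4.
  set (A := Rabs (green_cos al be l) + Rabs (green_sin al be l)).
  apply (vanishing_le _ (fun x => 1 * (A * (Rabs (exp (- al * x) * C1 x) + Rabs (exp (- al * x) * S1 x)) +
    A * (Rabs (exp (al * x) * C2 x) + Rabs (exp (al * x) * S2 x))))).
  - apply vanishing_plus_scal; apply vanishing_plus_scal; now apply vanishing_abs.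
  - intros x. unfold potential. rewrite Rmult_1_l.
    eapply Rle_trans; [apply Rabs_triang|]. apply Rplus_le_compat.
    + apply damped_response_bound.
    + rewrite Rabs_mult, pow_1_abs, Rmult_1_l.
      eapply Rle_trans; [apply damped_response_bound|].
      rewrite Rabs_Ropp, Ropp_involutive. apply Rle_refl.
Qed.

Lemma exhausted_integrable V t L : 0 < L -> (forall y, continuous V y) ->
  (forall y, 0 <= V y) ->
  (forall k, (0 < k)%nat -> RInt V (- (INR k * L)) (INR k * L) <= t) ->
  integrable_bound V t.
Proof.
  intros HL HVc HVp HVt. split; [exact HVc|]. split; [exact HVp|]. intros p q Hpq.
  destruct (INR_unbounded (Rmax (Rabs p) (Rabs q) / L)) as [k Hk].
  set (R := INR (S k) * L).
  assert (HkR : Rmax (Rabs p) (Rabs q) <= R).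
  { unfold R. rewrite S_INR.
    replace (Rmax (Rabs p) (Rabs q)) with (Rmax (Rabs p) (Rabs q) / L * L) by (field; lra).
    apply Rmult_le_compat_r; lra. }
  assert (Hp : - R <= p <= R).
  { apply Rabs_le_between. apply Rle_trans with (2 := HkR), Rmax_l. }
  assert (Hq : - R <= q <= R).
  { apply Rabs_le_between. apply Rle_trans with (2 := HkR), Rmax_r. }
  assert (HE : forall a b, ex_RInt V a b) by (intros; now apply continuous_RInt).
  assert (Hpos : forall p q, p <= q -> 0 <= RInt V p q)
    by (intros; apply RInt_ge_0; auto).
  assert (Ch : forall a b c, RInt V a b + RInt V b c = RInt V a c)
    by (intros; apply (RInt_Chasles (V := R_CompleteNormedModule)); apply HE).
  generalize (HVt (S k) ltac:(lia)). fold R.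
  generalize (Ch (- R) p R) (Ch p q R) (Hpos (- R) p) (Hpos q R). lra.
Qed.

(** Letting the window [- k L, k L] grow in the representation of the convolution by
    moments identifies u with a potential, whose derivatives are known. *)
Lemma integral_equation_ode al be (V u : R -> R) t L : 0 < al -> 0 < be -> 0 < L ->
  (forall y, continuous V y) -> (forall y, 0 <= V y) ->
  (forall k, (0 < k)%nat ->
     RInt V (- (INR k * L)) (INR k * L) <= t /\
     forall x, Rabs x <= INR k * L ->
       Rabs (u x - RInt (fun y => green al be (x - y) * V y) (- (INR k * L)) (INR k * L))
       <= t * ((Rabs (green_cos al be 0) + Rabs (green_sin al be 0)) *
               exp (- (al * (INR k * L - Rabs x))))) ->
  exists u1 u2 u3 : R -> R,
    (forall x, is_derive u x (u1 x)) /\ (forall x, is_derive u1 x (u2 x)) /\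
    (forall x, is_derive u2 x (u3 x)) /\
    (forall x, is_derive u3 x
       (V x - 2 * (be ^ 2 - al ^ 2) * u2 x - (al ^ 2 + be ^ 2) ^ 2 * u x)) /\
    vanishing u /\ vanishing u1.
Proof.
  intros Hal Hbe HL HVc HVp Hk.
  assert (HI : integrable_bound V t)
    by (apply exhausted_integrable with L; auto; intros k Hk0; now apply Hk).
  assert (Hc : forall y, continuous (fun y => cos (be * y) * V y) y)
    by (intros; apply (continuous_trig_mult cos); auto).
  assert (Hs : forall y, continuous (fun y => sin (be * y) * V y) y)
    by (intros; apply (continuous_trig_mult sin); auto).
  assert (Hcb : forall y, Rabs (cos (be * y) * V y) <= V y).
  { intros y. rewrite Rabs_mult, (Rabs_pos_eq (V y)) by apply HVp.
    rewrite <- (Rmult_1_l (V y)) at 2. apply Rmult_le_compat_r; [apply HVp|].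
    apply Rabs_le. generalize (COS_bound (be * y)). lra. }
  assert (Hsb : forall y, Rabs (sin (be * y) * V y) <= V y).
  { intros y. rewrite Rabs_mult, (Rabs_pos_eq (V y)) by apply HVp.
    rewrite <- (Rmult_1_l (V y)) at 2. apply Rmult_le_compat_r; [apply HVp|].
    apply Rabs_le. generalize (SIN_bound (be * y)). lra. }
  destruct (left_moment al _ V t L Hal HL HI Hc Hcb) as (C1 & HC1 & LC1 & VC1).
  destruct (left_moment al _ V t L Hal HL HI Hs Hsb) as (S1 & HS1 & LS1 & VS1).
  destruct (right_moment al _ V t L Hal HL HI Hc Hcb) as (C2 & HC2 & LC2 & VC2).
  destruct (right_moment al _ V t L Hal HL HI Hs Hsb) as (S2 & HS2 & LS2 & VS2).
  set (p := potential al be C1 S1 C2 S2).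
  assert (Hu : forall x, u x = p 0%nat x).
  { intros x.
    destruct (INR_unbounded (Rabs x / L)) as [N HN].
    assert (HNx : forall n, (N <= n)%nat -> Rabs x <= INR n * L).
    { intros n Hn. apply le_INR in Hn.
      replace (Rabs x) with (Rabs x / L * L) by (field; lra).
      apply Rmult_le_compat_r; lra. }
    set (J := fun n => RInt (fun y => green al be (x - y) * V y)
                         (- (INR (n + S N) * L)) (INR (n + S N) * L)).
    apply (filterlim_Req eventually J J); [reflexivity| |].
    - set (M := Rabs (green_cos al be 0) + Rabs (green_sin al be 0)).
      assert (Ht : 0 <= t).
      { destruct HI as (_ & _ & H). generalize (H 0 0 (Rle_refl 0)). now rewrite RInt_point. }
      assert (HM : 0 <= M) by (apply Rplus_le_le_0_compat; apply Rabs_pos).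
      apply filterlim_R_intro; [apply eventually_filter|]. intros eps Heps.
      (* exp w >= 1 + w makes the remainder smaller than eps once w >= al z *)
      set (z := t * M / (eps * al)).
      assert (Hz0 : 0 <= z) by (apply Rdiv_le_0_compat; nra).
      assert (Hz : z * (eps * al) = t * M) by (unfold z; field; lra).
      destruct (INR_unbounded ((Rabs x + z) / L)) as [N' HN']. exists N'. intros n Hn.
      rewrite Rabs_minus_sym.
      set (r := INR (n + S N) * L).
      assert (Hr : Rabs x + z <= r).
      { replace (Rabs x + z) with ((Rabs x + z) / L * L) by (field; lra).
        apply Rmult_le_compat_r; [lra|]. apply Rlt_le, Rlt_le_trans with (1 := HN').
        apply le_INR. lia. }
      destruct (Hk (n + S N)%nat ltac:(lia)) as [_ H].
      eapply Rle_lt_trans; [apply H, HNx; lia|]. fold M r.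
      set (w := al * (r - Rabs x)).
      assert (Hw : al * z <= w) by (apply Rmult_le_compat_l; lra).
      assert (H1 : 1 + w <= exp w) by apply exp_ineq1_le.
      assert (H2 : exp (- w) * exp w = 1)
        by (rewrite <- exp_plus, Rplus_opp_l; apply exp_0).
      generalize (exp_pos (- w)). intros H3.
      assert (H4 : t * M < eps * exp w) by nra.
      rewrite <- Rmult_assoc.
      apply Rlt_le_trans with (eps * exp w * exp (- w)).
      + now apply Rmult_lt_compat_r.
      + rewrite Rmult_assoc, (Rmult_comm (exp w)), H2. lra.
    - apply filterlim_ext with (fun n =>
        potential al be
          (fun x => moment al (fun y => cos (be * y) * V y) (- (INR (n + S N) * L)) x)
          (fun x => moment al (fun y => sin (be * y) * V y) (- (INR (n + S N) * L)) x)
          (fun x => moment (- al) (fun y => cos (be * y) * V y) x (INR (n + S N) * L))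
          (fun x => moment (- al) (fun y => sin (be * y) * V y) x (INR (n + S N) * L)) 0 x).
      { intros n. unfold J. symmetry. apply green_convolution; [exact Hal| |exact HVc].
        apply Rabs_le_between. apply HNx. lia. }
      assert (Hshift : forall v (l : R), is_lim_seq v l ->
        filterlim (fun n => v (n + S N)%nat) eventually (locally l)).
      { intros v l Hv. apply (is_lim_seq_incr_n v (S N) l). exact Hv. }
      unfold p, potential, damped_response.
      apply filterlim_Rplus; [apply eventually_filter| |].
      + apply filterlim_Rmult; [apply eventually_filter|apply filterlim_const|].
        apply filterlim_Rplus; [apply eventually_filter| |];
          (apply filterlim_Rmult; [apply eventually_filter|apply filterlim_const|]).
        * apply (Hshift (fun n => moment al _ (- (INR n * L)) x)), LC1.
        * apply (Hshift (fun n => moment al _ (- (INR n * L)) x)), LS1.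
      + apply filterlim_Rmult; [apply eventually_filter|apply filterlim_const|].
        apply filterlim_Rmult; [apply eventually_filter|apply filterlim_const|].
        apply filterlim_Rplus; [apply eventually_filter| |];
          (apply filterlim_Rmult; [apply eventually_filter|apply filterlim_const|]).
        * apply (Hshift (fun n => moment (- al) _ x (INR n * L))), LC2.
        * apply (Hshift (fun n => moment (- al) _ x (INR n * L))), LS2. }
  assert (Hode := fun x => potential_ode al be C1 S1 C2 S2 V x Hal Hbe (HC1 x) (HS1 x) (HC2 x) (HS2 x)).
  exists (p 1%nat), (p 2%nat), (p 3%nat).
  split; [|split; [|split; [|split; [|split]]]].
  - intros x. apply (is_derive_ext (V := R_NormedModule) (p 0%nat)); [intros; symmetry; apply Hu|].
    apply (Hode x).
  - intros x. apply (Hode x).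
  - intros x. apply (Hode x).
  - intros x. rewrite Hu. apply (Hode x).
  - apply (vanishing_le _ (fun x => Rabs (p 0%nat x))).
    + now apply vanishing_abs, vanishing_potential.
    + intros x. rewrite Hu. apply Rle_refl.
  - now apply vanishing_potential.
Qed.

(** The profile is evaluated at an affine function of x, and of t. *)
Lemma Derive_n_affine (ys : nat -> R -> R) (n : nat) (m q : R) :
  (forall k x, (k < n)%nat -> is_derive (ys k) x (ys (S k) x)) ->
  forall k, (k <= n)%nat -> forall x,
    ex_derive_n (fun s => ys 0%nat (m * s + q)) k x /\
    Derive_n (fun s => ys 0%nat (m * s + q)) k x = m ^ k * ys k (m * x + q).
Proof.
  intros Hys. induction k as [|k IH]; intros Hk x.
  - split; [exact I|]. simpl. ring.
  - assert (Hd : is_derive (fun x => m ^ k * ys k (m * x + q)) x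
                   (m ^ S k * ys (S k) (m * x + q))).
    { apply (is_derive_eq _ _ (m ^ k * (m * ys (S k) (m * x + q)))); [|simpl; ring].
      apply is_derive_scal.
      apply (is_derive_comp (V := R_NormedModule) (ys k) (fun x => m * x + q)).
      - apply Hys. lia.
      - auto_derive; [exact I|ring]. }
    assert (He : forall x, m ^ k * ys k (m * x + q) =
                           Derive_n (fun s => ys 0%nat (m * s + q)) k x).
    { intros z. symmetry. apply IH. lia. }
    split.
    + apply (ex_derive_ext (V := R_NormedModule) _ _ x He). eexists; exact Hd.
    + simpl Derive_n. apply is_derive_unique.
      apply (is_derive_ext (V := R_NormedModule) _ _ x _ He). exact Hd.
Qed.

Lemma travelling_wave_of_profile a b c (ys : nat -> R -> R) :
  (forall k x, (k < 4)%nat -> is_derive (ys k) x (ys (S k) x)) ->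
  (forall x, continuous (ys 4%nat) x) ->
  (forall s, c ^ 2 * ys 2%nat s + ys 4%nat s + a * pos_part (ys 0%nat s)
             - b * neg_part (ys 0%nat s) = 1) ->
  vanishing (fun s => ys 0%nat s - 1 / a) -> vanishing (ys 1%nat) ->
  (exists s, ys 0%nat s <> 1 / a) ->
  travelling_wave_solution a b c (fun x t => ys 0%nat (x - c * t)).
Proof.
  intros Hd H4 Heq Hv0 Hv1 Hne.
  assert (Hx : forall k x t, (k <= 4)%nat ->
    ex_derive_n (fun s => ys 0%nat (s - c * t)) k x /\
    Derive_n (fun s => ys 0%nat (s - c * t)) k x = ys k (x - c * t)).
  { intros k x t Hk.
    assert (Heq0 : forall s, ys 0%nat (1 * s + - (c * t)) = ys 0%nat (s - c * t))
      by (intros; f_equal; ring).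
    destruct (Derive_n_affine ys 4 1 (- (c * t)) Hd k Hk x) as [H1 H2]. split.
    - now apply (ex_derive_n_ext _ _ _ _ Heq0).
    - rewrite <- (Derive_n_ext _ _ k x Heq0), H2, pow1, Rmult_1_l. f_equal. ring. }
  assert (Ht : forall k x t, (k <= 4)%nat ->
    ex_derive_n (fun s => ys 0%nat (x - c * s)) k t /\
    Derive_n (fun s => ys 0%nat (x - c * s)) k t = (- c) ^ k * ys k (x - c * t)).
  { intros k x t Hk.
    assert (Heq0 : forall s, ys 0%nat (- c * s + x) = ys 0%nat (x - c * s))
      by (intros; f_equal; ring).
    destruct (Derive_n_affine ys 4 (- c) x Hd k Hk t) as [H1 H2]. split.
    - now apply (ex_derive_n_ext _ _ _ _ Heq0).
    - rewrite <- (Derive_n_ext _ _ k t Heq0), H2. f_equal. f_equal. ring. }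
  assert (Hcont : forall k x, (k <= 4)%nat -> continuity_pt (ys k) x).
  { intros k x Hk. apply continuity_pt_filterlim.
    destruct (Nat.eq_dec k 4) as [->|Hk4]; [apply H4|].
    apply (ex_derive_continuous (V := R_NormedModule) (ys k)).
    exists (ys (S k) x). apply Hd. lia. }
  assert (H2d : forall k x t, (k <= 4)%nat ->
    continuity_2d_pt (fun x t => ys k (x - c * t)) x t).
  { intros k x t Hk. apply (continuity_1d_2d_pt_comp (ys k) (fun x t => x - c * t)).
    - now apply Hcont.
    - apply continuity_2d_pt_minus; [apply continuity_2d_pt_id1|].
      apply continuity_2d_pt_mult; [apply continuity_2d_pt_const|apply continuity_2d_pt_id2]. }
  assert (Hlim : forall g l t, vanishing (fun s => g s - l) ->
    is_lim (fun x => g (x - c * t)) p_infty (Finite l) /\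
    is_lim (fun x => g (x - c * t)) m_infty (Finite l)).
  { intros g l t Hg. split; apply is_lim_spec; intros eps;
      destruct (Hg (eps / 2) ltac:(generalize (cond_pos eps); lra)) as [X HX].
    - exists (X + Rabs (c * t)). intros x Hx0.
      apply Rle_lt_trans with (eps / 2); [|generalize (cond_pos eps); lra].
      apply HX. eapply Rle_trans; [|apply Rle_abs].
      generalize (Rle_abs (c * t)). lra.
    - exists (- X - Rabs (c * t)). intros x Hx0.
      apply Rle_lt_trans with (eps / 2); [|generalize (cond_pos eps); lra].
      apply HX. rewrite <- Rabs_Ropp. eapply Rle_trans; [|apply Rle_abs].
      generalize (Rle_abs (- (c * t))). rewrite Rabs_Ropp. lra. }
  split; [|split; [|split]].
  - intros x t _. split; intros k Hk.
    + split; [now apply Hx|].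
      apply (continuity_2d_pt_ext (fun x t => ys k (x - c * t))); [|now apply H2d].
      intros x' t'. symmetry. now apply Hx.
    + split; [apply Ht; lia|].
      apply (continuity_2d_pt_ext (fun x t => (- c) ^ k * ys k (x - c * t))).
      * intros x' t'. symmetry. apply Ht. lia.
      * apply continuity_2d_pt_mult; [apply continuity_2d_pt_const|apply H2d; lia].
  - intros x t _. unfold d_x, d_t.
    rewrite (proj2 (Hx 4%nat x t ltac:(lia))), (proj2 (Ht 2%nat x t ltac:(lia))).
    rewrite <- (Heq (x - c * t)). ring.
  - intros t _. destruct (Hlim (ys 0%nat) (1 / a) t Hv0) as [L1 L2].
    destruct (Hlim (ys 1%nat) 0 t) as [L3 L4].
    { intros eps Heps. destruct (Hv1 eps Heps) as [X HX]. exists X. intros s Hs.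
      rewrite Rminus_0_r. auto. }
    split; [exact L1|split; [exact L2|]].
    split; (eapply is_lim_ext; [intros x; symmetry; apply (Hx 1%nat x t); lia|assumption]).
  - exists (ys 0%nat). split; [reflexivity|exact Hne].
Qed.

(** * Negativity passes from the line to the grid *)

(** The form of the sampled and normalised density differs from the integral by
    O(h), and the normalising mass is at most [sm], so one bound [- d] serves all fine
    grids. *)
Lemma discretised_form_negative K C al LK g v m Lv L :
  decaying_kernel C al LK K -> 0 < g -> 0 < L -> lipschitz Lv v ->
  (forall x, 0 <= v x <= m) -> (forall x, L <= Rabs x -> v x = 0) ->
  0 < RInt (fun x => g * RInt (fun y => K (x - y) * v y) (- L) L * v x - v x * v x) (- L) L ->
  exists d n0, 0 < d /\ forall n, (n0 <= n)%nat -> exists N p, simplex N p /\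
     quad_form (grid_form K g (L / INR (S n))) N p <= - d.
Proof.
  intros HK Hg HL Hv Hm Hs HI.
  destruct (decaying_kernel_bounded _ _ _ _ HK) as [HC HKC].
  assert (HLv := lipschitz_nonneg _ _ Hv).
  assert (HLK : 0 <= LK) by (apply lipschitz_nonneg with K; apply HK).
  assert (Hm0 : 0 <= m) by (generalize (Hm 0); lra).
  assert (Hvm : forall x, Rabs (v x) <= m)
    by (intros x; rewrite Rabs_pos_eq; apply Hm).
  set (u := fun x => RInt (fun y => K (x - y) * v y) (- L) L).
  set (Lw := LK * m + C * Lv).
  assert (HLw : 0 <= Lw) by (unfold Lw; nra).
  assert (Hw : forall x, lipschitz Lw (fun y => K (x - y) * v y)).
  { intros x. apply lipschitz_mult; [apply lipschitz_reflect; apply HK|exact Hv|intros; apply HKC|exact Hvm]. }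
  assert (Hub : forall x, Rabs (u x) <= 2 * L * (C * m)).
  { intros x. replace (2 * L * (C * m)) with ((L - - L) * (C * m)) by ring.
    apply abs_RInt_le_const; [lra|now apply lipschitz_RInt with Lw|].
    intros y _. rewrite Rabs_mult. apply Rmult_le_compat; auto using Rabs_pos. }
  assert (Hul : lipschitz (2 * L * (LK * m)) u).
  { intros x y. unfold u.
    rewrite <- (RInt_minus (V := R_CompleteNormedModule)) by now apply lipschitz_RInt with Lw.
    replace (2 * L * (LK * m) * Rabs (x - y)) with ((L - - L) * (LK * Rabs (x - y) * m)) by ring.
    apply abs_RInt_le_const; [lra| |].
    - apply (ex_RInt_minus (V := R_NormedModule)); now apply lipschitz_RInt with Lw.
    - intros z _. change (Rabs (K (x - z) * v z - K (y - z) * v z) <= LK * Rabs (x - y) * m).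
      rewrite <- Rmult_minus_distr_r, Rabs_mult.
      apply Rmult_le_compat; auto using Rabs_pos.
      destruct HK as (_ & HKl & _).
      replace (x - y) with ((x - z) - (y - z)) by ring. apply HKl. }
  set (F := fun x => g * u x * v x - v x * v x).
  set (I := RInt F (- L) L). change (0 < I) in HI.
  assert (HF : exists LF, lipschitz LF F).
  { eexists. unfold F.
    assert (H1 : lipschitz (Rabs g * (2 * L * (LK * m))) (fun x => g * u x)) by now apply lipschitz_scal.
    assert (H2 : forall x, Rabs (g * u x) <= g * (2 * L * (C * m))).
    { intros x. rewrite Rabs_mult, Rabs_pos_eq by lra. apply Rmult_le_compat_l; [lra|apply Hub]. }
    assert (H3 := lipschitz_mult _ _ _ _ _ _ H1 Hv H2 Hvm).
    assert (H4 := lipschitz_scal _ (-1) _ (lipschitz_mult _ _ _ _ _ _ Hv Hv Hvm Hvm)).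
    intros x y. generalize (lipschitz_plus _ _ _ _ H3 H4 x y).
    replace (g * u x * v x - v x * v x) with (g * u x * v x + -1 * (v x * v x)) by ring.
    replace (g * u y * v y - v y * v y) with (g * u y * v y + -1 * (v y * v y)) by ring.
    intros H; exact H. }
  destruct HF as [LF HF]. assert (HLF := lipschitz_nonneg _ _ HF).
  set (sm := 2 * L * m + 1).
  assert (Hsm : 0 < sm) by (unfold sm; nra).
  (* total discretisation error per unit of mesh *)
  set (E := 2 * L * LF + g * (2 * L * m) * (2 * L * Lw)).
  assert (HE : 0 <= E).
  { unfold E. apply Rplus_le_le_0_compat; repeat apply Rmult_le_pos; lra. }
  set (d := I / 2 / sm ^ 2).
  assert (Hd : 0 < d) by (apply Rdiv_lt_0_compat; [lra|now apply pow_lt]).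
  assert (Hq : 0 < I / (2 * (E + 1) * L)) by (apply Rdiv_lt_0_compat; nra).
  destruct (archimed_cor1 _ Hq) as [n0 [Hn0 Hn00]].
  exists d, n0. split; [exact Hd|]. intros n Hn.
  set (h := L / INR (S n)). set (N := S n).
  assert (HNp : 0 < INR N) by (apply lt_0_INR; lia).
  assert (Hh : 0 < h) by now apply Rdiv_lt_0_compat.
  assert (HNh : INR N * h = L) by (unfold h, N; field; apply not_0_INR; lia).
  assert (HhE : h * E <= I / 2).
  { assert (H1 : / INR N <= / INR n0).
    { apply Rinv_le_contravar; [now apply lt_0_INR|apply le_INR; lia]. }
    assert (H2 : h <= L * (I / (2 * (E + 1) * L))).
    { unfold h, Rdiv. apply Rmult_le_compat_l; [lra|]. unfold N in H1. lra. }
    replace (L * (I / (2 * (E + 1) * L))) with (I / (2 * (E + 1))) in H2 by (field; lra).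
    assert (H3 : I / (2 * (E + 1)) * (2 * (E + 1)) = I) by (field; lra).
    nra. }
  set (w := fun k : Z => v (IZR k * h)).
  assert (Hws : forall k, ~ in_window N k -> w k = 0).
  { intros k Hk. apply Hs. rewrite <- HNh, Rabs_mult, (Rabs_pos_eq h) by lra.
    apply Rmult_le_compat_r; [lra|]. rewrite INR_IZR_INZ, <- abs_IZR.
    apply IZR_le. unfold in_window in Hk. lia. }
  set (uh := fun x => h * window_sum N (fun k => K (x - IZR k * h) * w k)).
  assert (Huh : forall x, Rabs (uh x - u x) <= 2 * L * Lw * h).
  { intros x. generalize (Riemann_sum_error Lw _ h N (Hw x) ltac:(lra)).
    rewrite HNh, Rabs_minus_sym. fold (u x).
    replace (2 * INR N * (Lw * h ^ 2)) with (2 * L * Lw * h) by (rewrite <- HNh; ring).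
    intros H; exact H. }
  set (sg := h * window_sum N w).
  assert (Hsg0 : 0 <= sg).
  { apply Rmult_le_pos; [lra|]. rewrite <- (window_sum_zero N). apply window_sum_le. intros; apply Hm. }
  assert (Hsg1 : sg <= 2 * L * m).
  { replace (2 * L * m) with (h * (2 * INR N * m)) by (rewrite <- HNh; ring).
    rewrite <- window_sum_const. apply Rmult_le_compat_l; [lra|]. apply window_sum_le. intros; apply Hm. }
  set (J := h * window_sum N (fun k => w k * w k - g * uh (IZR k * h) * w k)).
  assert (HJ : J <= - (I / 2)).
  { assert (H1 : J <= - (h * window_sum N (fun k => F (IZR k * h))) + g * (2 * L * Lw * h) * sg).
    { unfold J, sg.
      replace (_ + _) with (h * (-1 * window_sum N (fun k => F (IZR k * h)) +
                               g * (2 * L * Lw * h) * window_sum N w)) by ring.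
      apply Rmult_le_compat_l; [lra|]. rewrite <- !window_sum_scal, <- window_sum_plus.
      apply window_sum_le. intros k _. unfold F, w.
      generalize (Huh (IZR k * h)). intros H. apply Rabs_le_between in H.
      assert (H5 : 0 <= g * v (IZR k * h)) by (apply Rmult_le_pos; [lra|apply Hm]).
      nra. }
    generalize (Riemann_sum_error LF F h N HF ltac:(lra)). rewrite HNh. fold I.
    replace (2 * INR N * (LF * h ^ 2)) with (2 * L * LF * h) by (rewrite <- HNh; ring).
    intros H2. apply Rabs_le_between in H2.
    assert (H3 : g * (2 * L * Lw * h) * sg <= g * (2 * L * Lw * h) * (2 * L * m)).
    { apply Rmult_le_compat_l; [|exact Hsg1]. apply Rmult_le_pos; [lra|]. apply Rmult_le_pos; [apply Rmult_le_pos; lra|lra]. }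
    unfold E in HhE. nra. }
  (* otherwise every sample is 0, and so is J *)
  assert (Hsg : 0 < sg).
  { destruct Hsg0 as [H|H]; [exact H|exfalso].
    assert (Hz : forall k, in_window N k -> w k = 0).
    { intros k Hk. assert (H1 : w k <= window_sum N w) by (apply window_sum_term_le; [intros; apply Hm|exact Hk]).
      assert (H2 : 0 <= w k) by apply Hm.
      assert (H3 : window_sum N w = 0).
      { apply Rmult_eq_reg_l with h; [|lra]. rewrite Rmult_0_r. now symmetry. }
      lra. }
    assert (J = 0); [|lra]. unfold J.
    rewrite (window_sum_ext N _ (fun _ => 0)), window_sum_zero; [ring|].
    intros k Hk. rewrite (Hz k Hk). ring. }
  exists N, (fun k => h / sg * w k).
  assert (Hhs : 0 < h / sg) by now apply Rdiv_lt_0_compat.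
  split; [split; [|split]|].
  - intros k. apply Rmult_le_pos; [lra|apply Hm].
  - intros k Hk. rewrite (Hws k Hk). ring.
  - rewrite window_sum_scal. fold w.
    replace (h / sg * window_sum N w) with (sg / sg) by (unfold sg at 1; unfold Rdiv; ring).
    field. lra.
  - assert (Eq : quad_form (grid_form K g h) N (fun k => h / sg * w k) = J / sg ^ 2).
    { unfold quad_form.
      rewrite (window_sum_ext N _ (fun k => h / sg ^ 2 * (w k * w k - g * uh (IZR k * h) * w k))).
      - rewrite window_sum_scal. unfold J. field. lra.
      - intros i Hi.
        assert (Ea : apply_matrix (grid_form K g h) N (fun k => h / sg * w k) i =
                     / sg * (w i - g * uh (IZR i * h))).
        { unfold apply_matrix, grid_form, uh.
          rewrite (window_sum_ext N _ (fun j => (if Z.eq_dec j i then / sg * w j else 0) +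
             (- g * h / sg) * (K (IZR i * h - IZR j * h) * w j))).
          - rewrite window_sum_plus, window_sum_scal, (window_sum_delta N i (fun j => / sg * w j) Hi). field. lra.
          - intros j _.
            replace (IZR (i - j) * h) with (IZR i * h - IZR j * h)
              by (rewrite minus_IZR; ring).
            destruct (Z.eq_dec j i); field; lra. }
        rewrite Ea. field. lra. }
    rewrite Eq. unfold d.
    assert (Hsg2 : sg ^ 2 <= sm ^ 2) by (apply pow_incr; unfold sm; lra).
    assert (Hp1 : 0 < sg ^ 2) by now apply pow_lt.
    apply Rle_trans with (- (I / 2) / sg ^ 2).
    + apply Rmult_le_compat_r; [apply Rlt_le, Rinv_0_lt_compat; lra|exact HJ].
    + unfold Rdiv. rewrite Ropp_mult_distr_l_reverse. apply Ropp_le_contravar.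
      apply Rmult_le_compat_l; [lra|]. apply Rinv_le_contravar; lra.
Qed.

(** * The bump profile and its energy *)

Lemma is_derive_Rext (f g : R -> R) (x d : R) :
  (forall t, f t = g t) -> is_derive f x d -> is_derive g x d.
Proof. intros H. now apply (is_derive_ext (V := R_NormedModule)). Qed.

(** The factor makes the slopes at [- X] and [X] equal to 1 and -1. *)
Definition bump (r X s : R) : R :=
  (1 + r ^ 2 * X ^ 2) / (2 * X) * (X ^ 2 - s ^ 2) / (1 + r ^ 2 * s ^ 2).
Definition bump1 (r X s : R) : R :=
  - (1 + r ^ 2 * X ^ 2) ^ 2 / X * s / (1 + r ^ 2 * s ^ 2) ^ 2.
Definition bump2 (r X s : R) : R :=
  - (1 + r ^ 2 * X ^ 2) ^ 2 / X * (1 - 3 * r ^ 2 * s ^ 2) / (1 + r ^ 2 * s ^ 2) ^ 3.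

Lemma one_plus_sq_pos r s : 0 < 1 + r ^ 2 * s ^ 2.
Proof. replace (r ^ 2 * s ^ 2) with ((r * s) ^ 2) by ring. generalize (pow2_ge_0 (r * s)). lra. Qed.

Lemma is_derive_bump r X s : 0 < X -> is_derive (bump r X) s (bump1 r X s).
Proof.
  intros HX. generalize (one_plus_sq_pos r s). intros H.
  unfold bump, bump1. auto_derive; [lra|]. field. lra.
Qed.

Lemma is_derive_bump1 r X s : 0 < X -> is_derive (bump1 r X) s (bump2 r X s).
Proof.
  intros HX. generalize (one_plus_sq_pos r s). intros H.
  unfold bump1, bump2. auto_derive; [|field; lra].
  apply Rgt_not_eq. apply Rmult_lt_0_compat; [lra|]. apply Rmult_lt_0_compat; lra.
Qed.

(** The reduction formula for the integral of 1 / (1 + r^2 s^2)^k. *)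
Fixpoint primitive_inv_pow (r : R) (k : nat) (s : R) : R :=
  match k with
  | O => s
  | S O => atan (r * s) / r
  | S j => s / (2 * INR j * (1 + r ^ 2 * s ^ 2) ^ j)
           + (2 * INR j - 1) / (2 * INR j) * primitive_inv_pow r j s
  end.

Lemma is_derive_primitive_inv_pow r k s : 0 < r ->
  is_derive (primitive_inv_pow r k) s (/ (1 + r ^ 2 * s ^ 2) ^ k).
Proof.
  intros Hr. generalize (one_plus_sq_pos r s). intros H.
  induction k as [|k IH].
  - apply (is_derive_eq (fun t => t) s 1); [apply (is_derive_id (K := R_AbsRing))|simpl; field].
  - destruct k as [|j].
    + simpl primitive_inv_pow. auto_derive; [lra|]. rewrite pow_1. unfold Rsqr. field.
      split; [|lra]. replace (1 + r * s * (r * s)) with (1 + r ^ 2 * s ^ 2) by ring. lra.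
    + change (primitive_inv_pow r (S (S j))) with (fun s =>
        s / (2 * INR (S j) * (1 + r ^ 2 * s ^ 2) ^ (S j))
        + (2 * INR (S j) - 1) / (2 * INR (S j)) * primitive_inv_pow r (S j) s).
      assert (Hj : 0 < INR (S j)) by (apply lt_0_INR; lia).
      assert (Hp := pow_lt _ j H).
      set (c := (2 * INR (S j) - 1) / (2 * INR (S j))).
      assert (H1 : is_derive (fun s => s / (2 * INR (S j) * (1 + r ^ 2 * s ^ 2) ^ (S j))) s
        (/ (2 * INR (S j) * (1 + r ^ 2 * s ^ 2) ^ (S j))
          - r ^ 2 * s ^ 2 / (1 + r ^ 2 * s ^ 2) ^ (S (S j)))).
      { set (q := INR (S j)) in *. auto_derive.
        - apply Rgt_not_eq. apply Rmult_lt_0_compat; [lra|]. now apply (pow_lt _ (S j)).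
        - change (match j with 0%nat => 1 | S _ => INR j + 1 end) with q.
          replace (1 + r * (r * 1) * (s * (s * 1))) with (1 + r ^ 2 * s ^ 2) by ring.
          simpl pow. field.
          replace (1 + r * (r * 1) * (s * (s * 1))) with (1 + r ^ 2 * s ^ 2) by ring.
          replace (1 + r * r * (s * s)) with (1 + r ^ 2 * s ^ 2) by ring.
          repeat split; lra. }
      assert (H2 := is_derive_scal _ s c _ IH).
      apply (is_derive_eq _ s _ _ (is_derive_plus (V := R_NormedModule) _ _ _ _ _ H1 H2)).
      change (/ (2 * INR (S j) * (1 + r ^ 2 * s ^ 2) ^ (S j))
          - r ^ 2 * s ^ 2 / (1 + r ^ 2 * s ^ 2) ^ (S (S j))
          + c * / (1 + r ^ 2 * s ^ 2) ^ S j = / (1 + r ^ 2 * s ^ 2) ^ S (S j)).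
      unfold c. set (D := 1 + r ^ 2 * s ^ 2) in *.
      replace (r ^ 2 * s ^ 2) with (D - 1) by (unfold D; ring).
      cbn [pow]. set (q := INR (S j)) in *. field. repeat split; lra.
Qed.

(** This and the next two are primitives of the squares of [bump], [bump1] and
    [bump2], from their expansions in powers of 1 / (1 + r^2 s^2). *)
Definition mass_primitive (r X s : R) : R :=
  ((1 + r ^ 2 * X ^ 2) / (2 * X)) ^ 2 / r ^ 4 *
  ((1 + r ^ 2 * X ^ 2) ^ 2 * primitive_inv_pow r 2 s
   - 2 * (1 + r ^ 2 * X ^ 2) * primitive_inv_pow r 1 s + primitive_inv_pow r 0 s).

Definition slope_primitive (r X s : R) : R :=
  ((1 + r ^ 2 * X ^ 2) ^ 2 / X) ^ 2 / r ^ 2 *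
  (primitive_inv_pow r 3 s - primitive_inv_pow r 4 s).

Definition curvature_primitive (r X s : R) : R :=
  ((1 + r ^ 2 * X ^ 2) ^ 2 / X) ^ 2 *
  (16 * primitive_inv_pow r 6 s - 24 * primitive_inv_pow r 5 s
   + 9 * primitive_inv_pow r 4 s).

Lemma is_derive_combination (f1 f2 f3 : R -> R) (d1 d2 d3 c a1 a2 a3 s : R) :
  is_derive f1 s d1 -> is_derive f2 s d2 -> is_derive f3 s d3 ->
  is_derive (fun s => c * (a1 * f1 s + a2 * f2 s + a3 * f3 s)) s
    (c * (a1 * d1 + a2 * d2 + a3 * d3)).
Proof.
  intros H1 H2 H3. apply is_derive_scal.
  apply (is_derive_plus (V := R_NormedModule) (fun s => a1 * f1 s + a2 * f2 s));
    [apply (is_derive_plus (V := R_NormedModule) (fun s => a1 * f1 s))|];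
    now apply is_derive_scal.
Qed.

Lemma is_derive_mass_primitive r X s : 0 < r -> 0 < X ->
  is_derive (mass_primitive r X) s (bump r X s ^ 2).
Proof.
  intros Hr HX. generalize (one_plus_sq_pos r s). intros H.
  set (T := 1 + r ^ 2 * X ^ 2).
  apply (is_derive_Rext (fun s => (T / (2 * X)) ^ 2 / r ^ 4 *
    (T ^ 2 * primitive_inv_pow r 2 s + (- (2 * T)) * primitive_inv_pow r 1 s
     + 1 * primitive_inv_pow r 0 s))).
  { intros t. unfold mass_primitive. fold T. ring. }
  eapply is_derive_eq; [apply is_derive_combination; now apply is_derive_primitive_inv_pow|].
  unfold bump, T. field. repeat split; lra.
Qed.

Lemma is_derive_slope_primitive r X s : 0 < r -> 0 < X ->
  is_derive (slope_primitive r X) s (bump1 r X s ^ 2).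
Proof.
  intros Hr HX. generalize (one_plus_sq_pos r s). intros H.
  set (T := 1 + r ^ 2 * X ^ 2).
  apply (is_derive_Rext (fun s => (T ^ 2 / X) ^ 2 / r ^ 2 *
    (1 * primitive_inv_pow r 3 s + (- 1) * primitive_inv_pow r 4 s
     + 0 * primitive_inv_pow r 0 s))).
  { intros t. unfold slope_primitive. fold T. ring. }
  eapply is_derive_eq; [apply is_derive_combination; now apply is_derive_primitive_inv_pow|].
  unfold bump1, T. field. repeat split; lra.
Qed.

Lemma is_derive_curvature_primitive r X s : 0 < r -> 0 < X ->
  is_derive (curvature_primitive r X) s (bump2 r X s ^ 2).
Proof.
  intros Hr HX. generalize (one_plus_sq_pos r s). intros H.
  set (T := 1 + r ^ 2 * X ^ 2).
  apply (is_derive_Rext (fun s => (T ^ 2 / X) ^ 2 *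
    (16 * primitive_inv_pow r 6 s + (- 24) * primitive_inv_pow r 5 s
     + 9 * primitive_inv_pow r 4 s))).
  { intros t. unfold curvature_primitive. fold T. ring. }
  eapply is_derive_eq; [apply is_derive_combination; now apply is_derive_primitive_inv_pow|].
  unfold bump2, T. field. repeat split; lra.
Qed.

Lemma sqrt_of_pow p n : 0 <= p -> sqrt (p ^ n) = sqrt p ^ n.
Proof.
  intros Hp. rewrite <- (sqrt_pow2 (sqrt p ^ n)) by apply pow_le, sqrt_pos.
  f_equal. rewrite <- pow_mult, Nat.mul_comm, pow_mult, pow2_sqrt by exact Hp.
  reflexivity.
Qed.

(** Dividing x by lam and multiplying sqrt p by lam leaves the argument of the
    arctangent unchanged; the powers of lam come from the change of variable. *)
Lemma mass_scaled p x lam : 0 < p -> 0 < x -> 0 < lam ->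
  mass_primitive (lam * sqrt p) (x / lam) (x / lam)
  - mass_primitive (lam * sqrt p) (x / lam) (- (x / lam)) = Gfun p x / lam ^ 3.
Proof.
  intros Hp Hx Hl. unfold Gfun.
  assert (Hr := sqrt_lt_R0 p Hp). rewrite sqrt_of_pow by lra.
  assert (Ep : p = sqrt p ^ 2) by (rewrite pow2_sqrt; lra).
  set (r := sqrt p) in *. rewrite Ep. clearbody r. clear p Hp Ep.
  unfold mass_primitive. simpl primitive_inv_pow.
  replace (lam * r * (x / lam)) with (r * x) by (field; lra).
  replace (lam * r * - (x / lam)) with (- (r * x)) by (field; lra).
  rewrite atan_opp. generalize (one_plus_sq_pos r x). intros H.
  field. repeat split; nra.
Qed.

Lemma slope_scaled p x lam : 0 < p -> 0 < x -> 0 < lam ->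
  slope_primitive (lam * sqrt p) (x / lam) (x / lam)
  - slope_primitive (lam * sqrt p) (x / lam) (- (x / lam)) = Mfun p x / lam.
Proof.
  intros Hp Hx Hl. unfold Mfun.
  assert (Hr := sqrt_lt_R0 p Hp). rewrite sqrt_of_pow by lra.
  assert (Ep : p = sqrt p ^ 2) by (rewrite pow2_sqrt; lra).
  set (r := sqrt p) in *. rewrite Ep. clearbody r. clear p Hp Ep.
  unfold slope_primitive. simpl primitive_inv_pow.
  replace (lam * r * (x / lam)) with (r * x) by (field; lra).
  replace (lam * r * - (x / lam)) with (- (r * x)) by (field; lra).
  rewrite atan_opp. generalize (one_plus_sq_pos r x). intros H.
  field. repeat split; nra.
Qed.

Lemma curvature_scaled p x lam : 0 < p -> 0 < x -> 0 < lam ->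
  curvature_primitive (lam * sqrt p) (x / lam) (x / lam)
  - curvature_primitive (lam * sqrt p) (x / lam) (- (x / lam)) = Nfun p x * lam.
Proof.
  intros Hp Hx Hl. unfold Nfun.
  assert (Hr := sqrt_lt_R0 p Hp).
  assert (Ep : p = sqrt p ^ 2) by (rewrite pow2_sqrt; lra).
  set (r := sqrt p) in *. rewrite Ep. clearbody r. clear p Hp Ep.
  unfold curvature_primitive. simpl primitive_inv_pow.
  replace (lam * r * (x / lam)) with (r * x) by (field; lra).
  replace (lam * r * - (x / lam)) with (- (r * x)) by (field; lra).
  rewrite atan_opp. generalize (one_plus_sq_pos r x). intros H.
  field. repeat split; nra.
Qed.

(** * Energy inequality along a train of bumps *)

Lemma derive_nonneg_le (f d : R -> R) l r : l <= r ->
  (forall x, l <= x <= r -> is_derive f x (d x)) ->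
  (forall x, l <= x <= r -> 0 <= d x) -> f l <= f r.
Proof.
  intros Hlr Hf Hd.
  destruct (MVT_gen f l r d) as [z [Hz E]].
  - intros x Hx. rewrite Rmin_left, Rmax_right in Hx by exact Hlr. apply Hf. lra.
  - intros x Hx. rewrite Rmin_left, Rmax_right in Hx by exact Hlr.
    apply continuity_pt_filterlim, (ex_derive_continuous (V := R_NormedModule) f).
    exists (d x). now apply Hf.
  - rewrite Rmin_left, Rmax_right in Hz by exact Hlr.
    generalize (Hd z Hz). intros H. nra.
Qed.

(** A primitive of f''^2 - c2 f'^2 + k f^2 for the bump f. *)
Definition bump_energy_primitive (c2 k r X s : R) : R :=
  curvature_primitive r X s - c2 * slope_primitive r X s + k * mass_primitive r X s.

Definition bump_energy (c2 k r X : R) : R :=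
  bump_energy_primitive c2 k r X X - bump_energy_primitive c2 k r X (- X).

Lemma bump_endpoints r X : 0 < X ->
  bump r X X = 0 /\ bump r X (- X) = 0 /\ bump1 r X X = -1 /\ bump1 r X (- X) = 1.
Proof.
  intros HX. generalize (one_plus_sq_pos r X). intros H. unfold bump, bump1.
  replace ((- X) ^ 2) with (X ^ 2) by ring.
  repeat split; field; repeat split; lra.
Qed.

(** The beam form at g u - f is, up to a remainder, the derivative of an expression
    in which all mixed terms are integrated by parts; the differential equation of u
    removes its fourth derivative. *)
Lemma energy_derivative (U0 U1 U2 U3 f f1 Rf Phi : R -> R) (v d2 dP g a c2 x : R) :
  is_derive U0 x (U1 x) -> is_derive U1 x (U2 x) -> is_derive U2 x (U3 x) ->
  is_derive U3 x (v - c2 * U2 x - a * U0 x) ->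
  is_derive f x (f1 x) -> is_derive f1 x d2 ->
  is_derive Rf x (g * U0 x * v - v * v) -> is_derive Phi x dP ->
  is_derive (fun x => g * Rf x + g ^ 2 * (U1 x * U2 x - U0 x * U3 x)
     - g * (2 * U2 x * f1 x - 2 * U3 x * f x + c2 * (U0 x * f1 x - U1 x * f x)) + Phi x) x
   (((g * U2 x - d2) ^ 2 + c2 * (g * U2 x - d2) * (g * U0 x - f x) + a * (g * U0 x - f x) ^ 2)
     + (dP - d2 ^ 2 - c2 * f x * d2 - a * f x ^ 2 + 2 * g * v * f x - g * v ^ 2)).
Proof.
  intros H0 H1 H2 H3 Hf Hf1 HR HP.
  auto_derive; [repeat split; eexists; eassumption|].
  replace (Derive (fun x0 => U0 x0) x) with (U1 x) by (symmetry; now apply is_derive_unique).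
  replace (Derive (fun x0 => U1 x0) x) with (U2 x) by (symmetry; now apply is_derive_unique).
  replace (Derive (fun x0 => U2 x0) x) with (U3 x) by (symmetry; now apply is_derive_unique).
  replace (Derive (fun x0 => U3 x0) x) with (v - c2 * U2 x - a * U0 x)
    by (symmetry; now apply is_derive_unique).
  replace (Derive (fun x0 => f x0) x) with (f1 x) by (symmetry; now apply is_derive_unique).
  replace (Derive (fun x0 => f1 x0) x) with d2 by (symmetry; now apply is_derive_unique).
  replace (Derive (fun x0 => Rf x0) x) with (g * U0 x * v - v * v)
    by (symmetry; now apply is_derive_unique).
  replace (Derive (fun x0 => Phi x0) x) with dP by (symmetry; now apply is_derive_unique).
  ring.
Qed.

Lemma is_derive_shift (f : R -> R) xi x d :
  is_derive f (x - xi) d -> is_derive (fun x => f (x - xi)) x d.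
Proof.
  intros H. apply (is_derive_eq _ _ (1 * d)); [|ring].
  apply (is_derive_comp (V := R_NormedModule) f (fun x => x - xi)); [exact H|].
  auto_derive; [exact I|ring].
Qed.

(** The discriminant condition c^4 <= 4 a, with a and c^2 expressed by al and be. *)
Lemma beam_form_nonneg al be w w2 :
  0 <= w2 ^ 2 + 2 * (be ^ 2 - al ^ 2) * w2 * w + (al ^ 2 + be ^ 2) ^ 2 * w ^ 2.
Proof.
  replace (_ + _) with ((w2 + (be ^ 2 - al ^ 2) * w) ^ 2 + (2 * al * be * w) ^ 2) by ring.
  generalize (pow2_ge_0 (w2 + (be ^ 2 - al ^ 2) * w)) (pow2_ge_0 (2 * al * be * w)). lra.
Qed.

(** The terms produced by the integrations by parts at an end of a bump, where the
    test function is 0 and has slope [d]. *)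
Definition boundary_term (g c2 : R) (U : nat -> R -> R) (d x : R) : R :=
  g ^ 2 * (U 1%nat x * U 2%nat x - U 0%nat x * U 3%nat x)
  - g * d * (2 * U 2%nat x + c2 * U 0%nat x).

(** One bump, with sign [e], centred at [xi]. The last hypothesis covers both cases in
    use: v = 0 with k = a on a negative bump, and v = f with k = a - g on a positive
    one. It cancels the remainder in [energy_derivative], so that the expression
    there is nondecreasing. The slope at the right end, [- e], is the slope at the
    left end of the next bump, so the boundary terms telescope. *)
Lemma energy_step al be g k r X xi e (U : nat -> R -> R) (v Rf : R -> R) :
  let c2 := 2 * (be ^ 2 - al ^ 2) in let a := (al ^ 2 + be ^ 2) ^ 2 in
  0 < r -> 0 < X -> e ^ 2 = 1 ->
  (forall x, is_derive (U 0%nat) x (U 1%nat x)) ->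
  (forall x, is_derive (U 1%nat) x (U 2%nat x)) ->
  (forall x, is_derive (U 2%nat) x (U 3%nat x)) ->
  (forall x, is_derive (U 3%nat) x (v x - c2 * U 2%nat x - a * U 0%nat x)) ->
  (forall x, is_derive Rf x (g * U 0%nat x * v x - v x * v x)) ->
  (forall x, xi - X <= x <= xi + X ->
     (k - a) * bump r X (x - xi) ^ 2 + 2 * g * v x * (e * bump r X (x - xi)) - g * v x ^ 2 = 0) ->
  g * Rf (xi - X) + boundary_term g c2 U e (xi - X) <=
  g * Rf (xi + X) + boundary_term g c2 U (- e) (xi + X) + bump_energy c2 k r X.
Proof.
  intros c2 a Hr HX He H0 H1 H2 H3 HR Hv.
  set (f := fun x => e * bump r X (x - xi)).
  set (f1 := fun x => e * bump1 r X (x - xi)).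
  set (P := fun s => bump_energy_primitive c2 k r X s + c2 * (bump r X s * bump1 r X s)).
  assert (Hf : forall x, is_derive f x (f1 x)).
  { intros x. apply is_derive_scal, (is_derive_shift (bump r X)). now apply is_derive_bump. }
  assert (Hf1 : forall x, is_derive f1 x (e * bump2 r X (x - xi))).
  { intros x. apply is_derive_scal, (is_derive_shift (bump1 r X)). now apply is_derive_bump1. }
  assert (HP : forall x, is_derive (fun x => P (x - xi)) x
    (bump2 r X (x - xi) ^ 2 + c2 * bump r X (x - xi) * bump2 r X (x - xi)
     + k * bump r X (x - xi) ^ 2)).
  { intros x. apply (is_derive_shift P). set (s := x - xi). unfold P, bump_energy_primitive.
    generalize (is_derive_bump r X s HX) (is_derive_bump1 r X s HX)
      (is_derive_mass_primitive r X s Hr HX) (is_derive_slope_primitive r X s Hr HX)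
      (is_derive_curvature_primitive r X s Hr HX).
    intros D0 D1 DM DS DC.
    auto_derive; [repeat split; eexists; eassumption|].
    replace (Derive (fun x0 => bump r X x0) s) with (bump1 r X s) by (symmetry; now apply is_derive_unique).
    replace (Derive (fun x0 => bump1 r X x0) s) with (bump2 r X s) by (symmetry; now apply is_derive_unique).
    replace (Derive (fun x0 => mass_primitive r X x0) s) with (bump r X s ^ 2) by (symmetry; now apply is_derive_unique).
    replace (Derive (fun x0 => slope_primitive r X x0) s) with (bump1 r X s ^ 2) by (symmetry; now apply is_derive_unique).
    replace (Derive (fun x0 => curvature_primitive r X x0) s) with (bump2 r X s ^ 2) by (symmetry; now apply is_derive_unique).
    ring. }
  generalize (derive_nonneg_le _ _ (xi - X) (xi + X) ltac:(lra)
    (fun x _ => energy_derivative (U 0%nat) (U 1%nat) (U 2%nat) (U 3%nat) f f1 Rf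
       (fun x => P (x - xi)) (v x) _ _ g a c2 x (H0 x) (H1 x) (H2 x) (H3 x)
       (Hf x) (Hf1 x) (HR x) (HP x))).
  intros H.
  assert (Hpos : forall x, xi - X <= x <= xi + X -> 0 <=
   ((g * U 2%nat x - e * bump2 r X (x - xi)) ^ 2
    + c2 * (g * U 2%nat x - e * bump2 r X (x - xi)) * (g * U 0%nat x - f x)
    + a * (g * U 0%nat x - f x) ^ 2)
   + (bump2 r X (x - xi) ^ 2 + c2 * bump r X (x - xi) * bump2 r X (x - xi)
      + k * bump r X (x - xi) ^ 2 - (e * bump2 r X (x - xi)) ^ 2
      - c2 * f x * (e * bump2 r X (x - xi)) - a * f x ^ 2 + 2 * g * v x * f x
      - g * v x ^ 2)).
  { intros x Hx.
    generalize (beam_form_nonneg al be (g * U 0%nat x - f x) (g * U 2%nat x - e * bump2 r X (x - xi))).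
    fold c2 a. specialize (Hv x Hx).
    assert (E : bump2 r X (x - xi) ^ 2 + c2 * bump r X (x - xi) * bump2 r X (x - xi)
      + k * bump r X (x - xi) ^ 2 - (e * bump2 r X (x - xi)) ^ 2
      - c2 * f x * (e * bump2 r X (x - xi)) - a * f x ^ 2 + 2 * g * v x * f x
      - g * v x ^ 2 = 0).
    { rewrite <- Hv. unfold f.
      replace ((e * bump2 r X (x - xi)) ^ 2) with (e ^ 2 * bump2 r X (x - xi) ^ 2) by ring.
      replace ((e * bump r X (x - xi)) ^ 2) with (e ^ 2 * bump r X (x - xi) ^ 2) by ring.
      replace (c2 * (e * bump r X (x - xi)) * (e * bump2 r X (x - xi)))
        with (e ^ 2 * (c2 * bump r X (x - xi) * bump2 r X (x - xi))) by ring.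
      rewrite He. ring. }
    rewrite E. lra. }
  specialize (H Hpos). clear Hpos HP Hf Hf1.
  destruct (bump_endpoints r X HX) as (B1 & B2 & B3 & B4).
  unfold f, f1, P in H.
  replace (xi - X - xi) with (- X) in H by ring.
  replace (xi + X - xi) with X in H by ring.
  rewrite B1, B2, B3, B4 in H.
  unfold boundary_term, bump_energy. lra.
Qed.

Definition tent (r X s : R) : R := Rmax 0 (bump r X s).

Lemma bump_nonneg r X s : 0 < X -> - X <= s <= X -> 0 <= bump r X s.
Proof.
  intros HX Hs. generalize (one_plus_sq_pos r X) (one_plus_sq_pos r s). intros H1 H2.
  unfold bump. apply Rdiv_le_0_compat; [|exact H2].
  apply Rmult_le_pos; [apply Rdiv_le_0_compat; lra|nra].
Qed.

Lemma tent_inside r X s : 0 < X -> - X <= s <= X -> tent r X s = bump r X s.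
Proof. intros HX Hs. apply Rmax_right. now apply bump_nonneg. Qed.

Lemma tent_outside r X s : 0 < X -> s <= - X \/ X <= s -> tent r X s = 0.
Proof.
  intros HX Hs. generalize (one_plus_sq_pos r X) (one_plus_sq_pos r s). intros H1 H2.
  apply Rmax_left. unfold bump.
  assert (H3 : 0 < (1 + r ^ 2 * X ^ 2) / (2 * X)) by (apply Rdiv_lt_0_compat; lra).
  assert (H4 : 0 < / (1 + r ^ 2 * s ^ 2)) by now apply Rinv_0_lt_compat.
  set (A := _ / (2 * X)) in *. set (B := X ^ 2 - s ^ 2).
  assert (HB : 0 <= - B) by (unfold B; nra).
  assert (0 <= A * - B * / (1 + r ^ 2 * s ^ 2))
    by (apply Rmult_le_pos; [apply Rmult_le_pos; lra|lra]).
  unfold Rdiv. lra.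
Qed.

Lemma tent_bound r X s : 0 < X ->
  0 <= tent r X s <= (1 + r ^ 2 * X ^ 2) / (2 * X) * X ^ 2.
Proof.
  intros HX. generalize (one_plus_sq_pos r X) (one_plus_sq_pos r s). intros H1 H2.
  assert (H3 : 0 < (1 + r ^ 2 * X ^ 2) / (2 * X)) by (apply Rdiv_lt_0_compat; lra).
  split; [apply Rmax_l|]. apply Rmax_lub; [apply Rmult_le_pos; nra|].
  unfold bump. set (D := 1 + r ^ 2 * s ^ 2) in *.
  apply Rmult_le_reg_r with D; [exact H2|].
  unfold Rdiv at 1. rewrite Rmult_assoc, Rinv_l, Rmult_1_r by lra.
  assert (HD : 1 <= D).
  { unfold D. replace (r ^ 2 * s ^ 2) with ((r * s) ^ 2) by ring.
    generalize (pow2_ge_0 (r * s)). lra. }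
  rewrite Rmult_assoc. apply Rmult_le_compat_l; [lra|].
  generalize (pow2_ge_0 s) (pow2_ge_0 X). nra.
Qed.

Lemma tent_lipschitz r X : 0 < r -> 0 < X -> exists L, lipschitz L (tent r X).
Proof.
  intros Hr HX.
  set (L := (1 + r ^ 2 * X ^ 2) ^ 2 / X / (2 * r)).
  assert (H1 : 0 < (1 + r ^ 2 * X ^ 2) ^ 2 / X)
    by (apply Rdiv_lt_0_compat; [apply pow_lt, one_plus_sq_pos|exact HX]).
  assert (Hb : forall s, Rabs (bump1 r X s) <= L).
  { intros s. generalize (one_plus_sq_pos r s). intros H2. unfold bump1, L.
    set (T := (1 + r ^ 2 * X ^ 2) ^ 2) in *. set (D := 1 + r ^ 2 * s ^ 2) in *.
    replace (- T / X * s / D ^ 2) with (T / X * - (s / D ^ 2)) by (field; lra).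
    rewrite Rabs_mult, (Rabs_pos_eq (T / X)) by lra.
    unfold Rdiv at 3. apply Rmult_le_compat_l; [lra|].
    rewrite Rabs_Ropp. unfold Rdiv. rewrite Rabs_mult, (Rabs_pos_eq (/ D ^ 2))
      by (apply Rlt_le, Rinv_0_lt_compat; nra).
    apply Rmult_le_reg_r with (D ^ 2 * (2 * r)); [apply Rmult_lt_0_compat; [now apply pow_lt|lra]|].
    replace (Rabs s * / D ^ 2 * (D ^ 2 * (2 * r))) with (Rabs s * (2 * r)) by (field; lra).
    replace (/ (2 * r) * (D ^ 2 * (2 * r))) with (D ^ 2) by (field; lra).
    assert (HD : D = 1 + (r * Rabs s) ^ 2)
      by (unfold D; rewrite Rpow_mult_distr, pow2_abs; reflexivity).
    assert (H3 : 2 * (r * Rabs s) <= D) by (generalize (pow2_ge_0 (r * Rabs s - 1)); nra).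
    assert (H4 : 1 <= D) by (generalize (pow2_ge_0 (r * Rabs s)); lra).
    nra. }
  exists L. intros x y. eapply Rle_trans; [apply Rmax_0_lipschitz|].
  destruct (MVT_gen (bump r X) y x (bump1 r X)) as [z [_ E]].
  - intros z _. now apply is_derive_bump.
  - intros z _. apply continuity_pt_filterlim, (ex_derive_continuous (V := R_NormedModule) (bump r X)).
    eexists. now apply is_derive_bump.
  - rewrite E, Rabs_mult. apply Rmult_le_compat_r; [apply Rabs_pos|apply Hb].
Qed.

(** Only the positive bumps of the test function; the negative ones have half-width
    [gap] and precede them. *)
Fixpoint train (gap r X : R) (n : nat) (s : R) : R :=
  match n with
  | O => 0
  | S j => train gap r X j s + tent r X (s - (INR j * (2 * gap + 2 * X) + 2 * gap + X))
  end.

Lemma train_outside gap r X n s : 0 < gap -> 0 < X ->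
  s <= 0 \/ INR n * (2 * gap + 2 * X) <= s -> train gap r X n s = 0.
Proof.
  intros Hg HX. induction n as [|n IH]; intros Hs; [reflexivity|].
  assert (Hn := pos_INR n). rewrite S_INR in Hs.
  cbn [train]. rewrite IH, tent_outside; [ring|exact HX| |].
  - destruct Hs as [Hs|Hs]; [left; nra|right; nra].
  - destruct Hs as [Hs|Hs]; [now left|right; nra].
Qed.

Lemma train_inside gap r X n j s : 0 < gap -> 0 < X -> (j < n)%nat ->
  INR j * (2 * gap + 2 * X) <= s <= (INR j + 1) * (2 * gap + 2 * X) ->
  train gap r X n s = tent r X (s - (INR j * (2 * gap + 2 * X) + 2 * gap + X)).
Proof.
  intros Hg HX Hj Hs. induction Hj as [|n Hj IH]; cbn [train].
  - rewrite train_outside; [ring|assumption..|right; lra].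
  - rewrite IH, (tent_outside r X (s - (INR n * _ + _ + _))); [ring|exact HX|left].
    apply le_INR in Hj. rewrite S_INR in Hj. nra.
Qed.

Lemma train_bound gap r X n s : 0 < gap -> 0 < X ->
  0 <= train gap r X n s <= (1 + r ^ 2 * X ^ 2) / (2 * X) * X ^ 2.
Proof.
  intros Hg HX. assert (Hb := fun s => tent_bound r X s HX).
  induction n as [|n IH]; cbn [train]; [generalize (Hb 0); lra|].
  destruct (Rle_or_lt s (INR n * (2 * gap + 2 * X))) as [H|H].
  - rewrite tent_outside; [lra|exact HX|left; lra].
  - rewrite train_outside, Rplus_0_l; [apply Hb|assumption..|right; lra].
Qed.

Lemma train_lipschitz gap r X n : 0 < r -> 0 < X -> exists L, lipschitz L (train gap r X n).
Proof.
  intros Hr HX. destruct (tent_lipschitz r X Hr HX) as [L HL].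
  induction n as [|n [M HM]].
  - exists 0. intros x y. simpl. rewrite Rminus_0_r, Rabs_R0. lra.
  - exists (M + L). apply lipschitz_plus; [exact HM|]. intros x y.
    set (z := _ + X). replace (x - y) with ((x - z) - (y - z)) by ring. apply HL.
Qed.

(** * Existence of travelling waves *)

Lemma exp_cancel t b : exp (- t) * (exp t * b) = b.
Proof. rewrite <- Rmult_assoc, <- exp_plus, Rplus_opp_l, exp_0. ring. Qed.

(** [m / al * exp (al * x)] plus or minus the moment is a nondecreasing function
    of x. *)
Lemma left_moment_bound al (w : R -> R) m p x : 0 < al -> p <= x ->
  (forall y, continuous w y) -> (forall y, Rabs (w y) <= m) ->
  Rabs (exp (- al * x) * moment al w p x) <= m / al.
Proof.
  intros Hal Hpx Hw Hm.
  assert (H0 : 0 <= m) by (apply Rle_trans with (2 := Hm 0), Rabs_pos).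
  assert (H1 : forall e, e ^ 2 = 1 -> e * moment al w p x <= m / al * exp (al * x)).
  { intros e He.
    assert (Hd : forall y, is_derive (fun y => m / al * exp (al * y) - e * moment al w p y) y
                   (exp (al * y) * (m - e * w y))).
    { intros y. generalize (is_derive_moment_r al w p y Hw). intros D.
      auto_derive; [eexists; exact D|].
      replace (Derive (fun x0 => moment al w p x0) y) with (exp (al * y) * w y)
        by (symmetry; now apply is_derive_unique).
      field. lra. }
    generalize (derive_nonneg_le _ _ p x Hpx (fun y _ => Hd y)).
    unfold moment at 1. rewrite RInt_point. intros H.
    assert (Hp := exp_pos (al * p)).
    assert (0 <= m / al * exp (al * p)).
    { apply Rmult_le_pos; [apply Rdiv_le_0_compat; lra|lra]. }
    change (@zero R_CompleteNormedModule) with 0 in H.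
    enough (m / al * exp (al * p) - e * 0 <= m / al * exp (al * x) - e * moment al w p x) by lra.
    apply H. intros y _. apply Rmult_le_pos; [apply Rlt_le, exp_pos|].
    generalize (Hm y). intros Hy. apply Rabs_le_between in Hy.
    assert (He' : e = 1 \/ e = -1) by (assert ((e - 1) * (e + 1) = 0) by (simpl in He; lra);
      destruct (Rmult_integral _ _ H2); [left|right]; lra).
    destruct He' as [-> | ->]; lra. }
  rewrite Rabs_mult, Rabs_pos_eq by apply Rlt_le, exp_pos.
  replace (- al * x) with (- (al * x)) by ring.
  rewrite <- (exp_cancel (al * x) (m / al)).
  apply Rmult_le_compat_l; [apply Rlt_le, exp_pos|]. rewrite (Rmult_comm (exp _)).
  apply Rabs_le. generalize (H1 1 ltac:(ring)) (H1 (-1) ltac:(ring)). lra.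
Qed.

Lemma right_moment_bound al (w : R -> R) m x q : 0 < al -> x <= q ->
  (forall y, continuous w y) -> (forall y, Rabs (w y) <= m) ->
  Rabs (exp (al * x) * moment (- al) w x q) <= m / al.
Proof.
  intros Hal Hxq Hw Hm.
  replace (moment (- al) w x q) with (moment al (fun y => w (- y)) (- q) (- x)).
  - replace (al * x) with (- al * - x) by ring.
    apply left_moment_bound; [exact Hal|lra| |auto].
    intros y. now apply continuous_reflection.
  - unfold moment.
    assert (E := RInt_reflection (fun y => exp (- al * y) * w y) (- q) (- x)
                   ltac:(intros; now apply continuous_exp_mult)).
    rewrite !Ropp_involutive in E. rewrite <- E.
    apply (RInt_ext (V := R_CompleteNormedModule)). intros y _.
    replace (- al * - y) with (al * y) by ring. reflexivity.
Qed.

Lemma potential_bound al be C1 S1 C2 S2 l x z :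
  Rabs (exp (- al * x) * C1 x) <= z -> Rabs (exp (- al * x) * S1 x) <= z ->
  Rabs (exp (al * x) * C2 x) <= z -> Rabs (exp (al * x) * S2 x) <= z ->
  Rabs (potential al be C1 S1 C2 S2 l x) <=
    (Rabs (green_cos al be l) + Rabs (green_sin al be l)) * (4 * z).
Proof.
  intros H1 H2 H3 H4. unfold potential.
  set (A := Rabs (green_cos al be l) + Rabs (green_sin al be l)).
  assert (HA : 0 <= A) by (apply Rplus_le_le_0_compat; apply Rabs_pos).
  eapply Rle_trans; [apply Rabs_triang|].
  rewrite Rabs_mult, pow_1_abs, Rmult_1_l.
  apply Rle_trans with (A * (z + z) + A * (z + z)); [|lra].
  apply Rplus_le_compat.
  - eapply Rle_trans; [apply damped_response_bound|]. apply Rmult_le_compat_l; [exact HA|lra].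
  - eapply Rle_trans; [apply damped_response_bound|].
    rewrite Rabs_Ropp, Ropp_involutive. apply Rmult_le_compat_l; [exact HA|lra].
Qed.

Lemma boundary_term_bound g c2 U d x z : 0 < g -> d ^ 2 = 1 ->
  (forall l, (l <= 3)%nat -> Rabs (U l x) <= z) ->
  Rabs (boundary_term g c2 U d x) <= 2 * g ^ 2 * z ^ 2 + g * (2 * z + Rabs c2 * z).
Proof.
  intros Hg Hd HU. unfold boundary_term.
  assert (HU0 := HU 0%nat ltac:(lia)). assert (HU1 := HU 1%nat ltac:(lia)).
  assert (HU2 := HU 2%nat ltac:(lia)). assert (HU3 := HU 3%nat ltac:(lia)).
  assert (Hd1 : Rabs d = 1).
  { apply (Rsqr_inj); [apply Rabs_pos|lra|]. rewrite <- Rsqr_abs. unfold Rsqr. lra. }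
  assert (Hm : forall p q, Rabs p <= z -> Rabs q <= z -> Rabs (p * q) <= z ^ 2).
  { intros p q Hp Hq. rewrite Rabs_mult. simpl. rewrite Rmult_1_r.
    apply Rmult_le_compat; auto using Rabs_pos. }
  unfold Rminus. eapply Rle_trans; [apply Rabs_triang|]. apply Rplus_le_compat.
  - rewrite Rabs_mult, (Rabs_pos_eq (g ^ 2)) by apply pow2_ge_0.
    replace (2 * g ^ 2 * z ^ 2) with (g ^ 2 * (z ^ 2 + z ^ 2)) by ring.
    apply Rmult_le_compat_l; [apply pow2_ge_0|].
    eapply Rle_trans; [apply Rabs_triang|]. rewrite Rabs_Ropp.
    apply Rplus_le_compat; now apply Hm.
  - rewrite Rabs_Ropp, !Rabs_mult, Hd1, (Rabs_pos_eq g), Rmult_1_r by lra.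
    apply Rmult_le_compat_l; [lra|].
    eapply Rle_trans; [apply Rabs_triang|]. rewrite !Rabs_mult, (Rabs_pos_eq 2) by lra.
    apply Rplus_le_compat; [lra|]. apply Rmult_le_compat_l; [apply Rabs_pos|exact HU0].
Qed.

(** Every period adds at least D > 0 to g Rf plus a boundary term, where Rf is the
    integral to be made positive. The bound Bd on the boundary terms only uses the sup
    norm of the train, which does not depend on n; hence n D > 2 Bd for large n. *)
Lemma train_form_positive al be g r1 X1 r2 X2 :
  let c2 := 2 * (be ^ 2 - al ^ 2) in let a := (al ^ 2 + be ^ 2) ^ 2 in
  0 < al -> 0 < be -> 0 < g -> 0 < r1 -> 0 < X1 -> 0 < r2 -> 0 < X2 ->
  bump_energy c2 a r1 X1 + bump_energy c2 (a - g) r2 X2 < 0 ->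
  exists n, (0 < n)%nat /\
    let L := INR n * (2 * X1 + 2 * X2) in let v := train X1 r2 X2 n in
    0 < RInt (fun x => g * RInt (fun y => green al be (x - y) * v y) (- L) L * v x
                       - v x * v x) (- L) L.
Proof.
  intros c2 a Hal Hbe Hg Hr1 HX1 Hr2 HX2 HE.
  set (D := - (bump_energy c2 a r1 X1 + bump_energy c2 (a - g) r2 X2)).
  assert (HD : 0 < D) by (unfold D; lra).
  set (m := (1 + r2 ^ 2 * X2 ^ 2) / (2 * X2) * X2 ^ 2).
  set (A := fun l => Rabs (green_cos al be l) + Rabs (green_sin al be l)).
  assert (HA : forall l, 0 <= A l) by (intros; apply Rplus_le_le_0_compat; apply Rabs_pos).
  set (z := (A 0%nat + A 1%nat + A 2%nat + A 3%nat) * (4 * (m / al))).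
  set (Bd := 2 * g ^ 2 * z ^ 2 + g * (2 * z + Rabs c2 * z)).
  destruct (INR_unbounded (2 * Bd / D)) as [n0 Hn0].
  set (n := S n0). exists n. split; [lia|]. intros L v.
  set (Pi := 2 * X1 + 2 * X2) in *.
  assert (HPi : 0 < Pi) by (unfold Pi; lra).
  assert (Hn : 0 < INR n) by (apply lt_0_INR; lia).
  assert (HL : 0 < L) by now apply Rmult_lt_0_compat.
  destruct (train_lipschitz X1 r2 X2 n Hr2 HX2) as [Lv HLv]. fold v in HLv.
  assert (Hvc : forall y, continuous v y) by (intros; now apply lipschitz_continuous with Lv).
  assert (Hvb : forall y, 0 <= v y <= m) by (intros; now apply train_bound).
  assert (Hcc : forall y, continuous (fun y => cos (be * y) * v y) y)
    by (intros; apply (continuous_trig_mult cos); auto).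
  assert (Hsc : forall y, continuous (fun y => sin (be * y) * v y) y)
    by (intros; apply (continuous_trig_mult sin); auto).
  assert (Hcb : forall y, Rabs (cos (be * y) * v y) <= m).
  { intros y. rewrite Rabs_mult, <- (Rmult_1_l m).
    apply Rmult_le_compat; [apply Rabs_pos..| |rewrite Rabs_pos_eq; apply Hvb].
    apply Rabs_le. generalize (COS_bound (be * y)). lra. }
  assert (Hsb : forall y, Rabs (sin (be * y) * v y) <= m).
  { intros y. rewrite Rabs_mult, <- (Rmult_1_l m).
    apply Rmult_le_compat; [apply Rabs_pos..| |rewrite Rabs_pos_eq; apply Hvb].
    apply Rabs_le. generalize (SIN_bound (be * y)). lra. }
  set (U := potential al be
    (moment al (fun y => cos (be * y) * v y) (- L))
    (moment al (fun y => sin (be * y) * v y) (- L))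
    (fun x => moment (- al) (fun y => cos (be * y) * v y) x L)
    (fun x => moment (- al) (fun y => sin (be * y) * v y) x L)).
  assert (Hode := fun x => potential_ode al be _ _ _ _ v x Hal Hbe
    (is_derive_moment_r al _ (- L) x Hcc) (is_derive_moment_r al _ (- L) x Hsc)
    (is_derive_moment_l (- al) _ x L Hcc) (is_derive_moment_l (- al) _ x L Hsc)).
  fold U in Hode. cbv zeta in Hode. fold c2 a in Hode.
  assert (HUb : forall x l, - L <= x <= L -> (l <= 3)%nat -> Rabs (U l x) <= z).
  { intros x l Hx Hl.
    assert (Hmz : 0 <= m / al) by (apply Rdiv_le_0_compat; [generalize (Hvb 0); lra|exact Hal]).
    apply Rle_trans with (A l * (4 * (m / al))).
    - apply potential_bound; [apply left_moment_bound|apply left_moment_bound|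
        apply right_moment_bound|apply right_moment_bound]; auto; lra.
    - apply Rmult_le_compat_r; [lra|].
      generalize (HA 0%nat) (HA 1%nat) (HA 2%nat) (HA 3%nat).
      destruct l as [|[|[|[|l]]]]; [lra..|lia]. }
  assert (HBd : forall x, - L <= x <= L -> Rabs (boundary_term g c2 U (-1) x) <= Bd).
  { intros x Hx. apply boundary_term_bound; [exact Hg|ring|]. intros l Hl. now apply HUb. }
  set (F := fun x => g * U 0%nat x * v x - v x * v x).
  assert (HUc : forall x, continuous (U 0%nat) x).
  { intros x. apply (ex_derive_continuous (V := R_NormedModule) (U 0%nat)).
    exists (U 1%nat x). exact (proj1 (Hode x)). }
  assert (HFc : forall x, continuous F x).
  { intros x. apply (continuous_minus (V := R_NormedModule)).
    - apply (continuous_mult (K := R_AbsRing)); [|apply Hvc].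
      apply (continuous_mult (K := R_AbsRing)); [apply continuous_const|apply HUc].
    - apply (continuous_mult (K := R_AbsRing)); apply Hvc. }
  set (Rf := fun x => RInt F (- L) x).
  assert (HRf : forall x, is_derive Rf x (F x)).
  { intros x. apply (is_derive_RInt (V := R_NormedModule) F _ (- L)); [|apply HFc].
    apply filter_forall. intros y. apply (RInt_correct (V := R_CompleteNormedModule)).
    now apply continuous_RInt. }
  assert (HR0 : Rf 0 = 0).
  { unfold Rf. rewrite (RInt_ext (V := R_CompleteNormedModule) F (fun _ => 0)).
    - rewrite RInt_const. unfold scal; simpl; unfold mult; simpl. ring.
    - intros x Hx. rewrite Rmin_left, Rmax_right in Hx by lra.
      change (g * U 0%nat x * v x - v x * v x = 0).
      unfold v. rewrite train_outside; [ring|assumption..|left; lra]. }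
  assert (Hstep : forall j, (j <= n)%nat ->
    boundary_term g c2 U (-1) 0 + INR j * D <=
    g * Rf (INR j * Pi) + boundary_term g c2 U (-1) (INR j * Pi)).
  { induction j as [|j IH]; intros Hj.
    - simpl INR. rewrite !Rmult_0_l, HR0. lra.
    - specialize (IH ltac:(lia)). rewrite S_INR. set (s := INR j * Pi) in *.
      assert (Hin : forall x, s <= x <= s + Pi -> v x = tent r2 X2 (x - (s + 2 * X1 + X2))).
      { intros x Hx. apply train_inside; [assumption..|lia|]. fold Pi. fold s.
        replace ((INR j + 1) * Pi) with (s + Pi) by (unfold s; ring). lra. }
      assert (S1 := energy_step al be g a r1 X1 (s + X1) (-1) U v Rf Hr1 HX1 ltac:(ring)
        (fun x => proj1 (Hode x)) (fun x => proj1 (proj2 (Hode x)))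
        (fun x => proj1 (proj2 (proj2 (Hode x)))) (fun x => proj2 (proj2 (proj2 (Hode x)))) HRf).
      assert (S2 := energy_step al be g (a - g) r2 X2 (s + 2 * X1 + X2) 1 U v Rf Hr2 HX2 ltac:(ring)
        (fun x => proj1 (Hode x)) (fun x => proj1 (proj2 (Hode x)))
        (fun x => proj1 (proj2 (proj2 (Hode x)))) (fun x => proj2 (proj2 (proj2 (Hode x)))) HRf).
      cbv zeta in S1, S2. fold c2 a in S1, S2.
      assert (HP1 : Pi = 2 * X1 + 2 * X2) by reflexivity.
      assert (G1 : forall x, s + X1 - X1 <= x <= s + X1 + X1 ->
        (a - a) * bump r1 X1 (x - (s + X1)) ^ 2
        + 2 * g * v x * (-1 * bump r1 X1 (x - (s + X1))) - g * v x ^ 2 = 0).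
      { intros x Hx. rewrite Hin, tent_outside; [ring|exact HX2|left; lra|lra]. }
      assert (G2 : forall x, s + 2 * X1 + X2 - X2 <= x <= s + 2 * X1 + X2 + X2 ->
        (a - g - a) * bump r2 X2 (x - (s + 2 * X1 + X2)) ^ 2
        + 2 * g * v x * (1 * bump r2 X2 (x - (s + 2 * X1 + X2))) - g * v x ^ 2 = 0).
      { intros x Hx. rewrite Hin, tent_inside; [ring|exact HX2|lra|lra]. }
      specialize (S1 G1). specialize (S2 G2).
      replace (s + X1 - X1) with s in S1 by ring.
      replace (s + X1 + X1) with (s + 2 * X1) in S1 by ring.
      replace (s + 2 * X1 + X2 - X2) with (s + 2 * X1) in S2 by ring.
      replace (s + 2 * X1 + X2 + X2) with ((INR j + 1) * Pi) in S2 by (unfold s, Pi; ring).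
      replace (- -1) with 1 in S1 by ring.
      replace (Ropp 1) with (-1) in S2 by ring.
      unfold D in *. lra. }
  assert (HRL : 0 < Rf L).
  { generalize (Hstep n (Nat.le_refl n)) (HBd 0 ltac:(lra)) (HBd L ltac:(lra)).
    fold L. intros H1 H2 H3. apply Rabs_le_between in H2. apply Rabs_le_between in H3.
    assert (H4 : 2 * Bd < INR n * D).
    { replace (2 * Bd) with (2 * Bd / D * D) by (field; lra).
      apply Rmult_lt_compat_r; [exact HD|]. unfold n. rewrite S_INR. lra. }
    apply Rmult_lt_reg_l with g; [exact Hg|]. lra. }
  replace (RInt _ (- L) L) with (Rf L); [exact HRL|].
  apply (RInt_ext (V := R_CompleteNormedModule)). intros x Hx.
  rewrite Rmin_left, Rmax_right in Hx by lra.
  rewrite (green_convolution al be v (- L) L x Hal ltac:(lra) Hvc). reflexivity.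
Qed.

Lemma bump_energy_scaled c2 k p x lam : 0 < p -> 0 < x -> 0 < lam ->
  bump_energy c2 k (lam * sqrt p) (x / lam) =
  Nfun p x * lam - c2 * (Mfun p x / lam) + k * (Gfun p x / lam ^ 3).
Proof.
  intros Hp Hx Hl. rewrite <- mass_scaled, <- slope_scaled, <- curvature_scaled by assumption.
  unfold bump_energy, bump_energy_primitive. ring.
Qed.

Lemma Gfun_nonneg p x : 0 < p -> 0 < x -> 0 <= Gfun p x.
Proof.
  intros Hp Hx. generalize (mass_scaled p x 1 Hp Hx Rlt_0_1).
  replace (Gfun p x / 1 ^ 3) with (Gfun p x) by field. intros <-.
  assert (Hr : 0 < 1 * sqrt p) by (rewrite Rmult_1_l; now apply sqrt_lt_R0).
  assert (HX : 0 < x / 1) by lra.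
  set (r := 1 * sqrt p) in *. set (X := x / 1) in *.
  generalize (derive_nonneg_le (mass_primitive r X) _ (- X) X ltac:(lra)
    (fun s _ => is_derive_mass_primitive r X s Hr HX) (fun s _ => pow2_ge_0 _)). lra.
Qed.

Lemma root4_lt_abs t c : 0 <= t -> root4 t < Rabs c -> t < c ^ 4.
Proof.
  intros Ht H. unfold root4 in H.
  assert (H1 : sqrt t < Rabs c ^ 2).
  { rewrite <- (pow2_sqrt (sqrt t)) by apply sqrt_pos.
    assert (0 <= sqrt (sqrt t)) by apply sqrt_pos. nra. }
  rewrite pow2_abs in H1. rewrite <- (pow2_sqrt t) by exact Ht.
  assert (0 <= sqrt t) by apply sqrt_pos.
  replace (c ^ 4) with (c ^ 2 * c ^ 2) by ring. nra.
Qed.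

Lemma abs_lt_root4 t c : 0 <= t -> Rabs c < root4 t -> c ^ 2 < sqrt t.
Proof.
  intros Ht H. unfold root4 in H.
  rewrite <- (pow2_abs c), <- (pow2_sqrt (sqrt t)) by apply sqrt_pos.
  assert (0 <= Rabs c) by apply Rabs_pos. nra.
Qed.

(** The parameters al, be > 0 encode a = (al^2 + be^2)^2 and c^2 = 2 (be^2 - al^2):
    the characteristic roots of u'''' + c^2 u'' + a u are the four numbers
    al + i be, al - i be and their opposites. *)
Lemma homoclinic_travelling_wave al be b X1 r1 X2 r2 c :
  0 < al -> 0 < be -> 0 < b < (al ^ 2 + be ^ 2) ^ 2 -> c ^ 2 = 2 * (be ^ 2 - al ^ 2) ->
  0 < r1 -> 0 < X1 -> 0 < r2 -> 0 < X2 ->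
  bump_energy (c ^ 2) ((al ^ 2 + be ^ 2) ^ 2) r1 X1 + bump_energy (c ^ 2) b r2 X2 < 0 ->
  exists u, travelling_wave_solution ((al ^ 2 + be ^ 2) ^ 2) b c u.
Proof.
  intros Hal Hbe Hb Hc Hr1 HX1 Hr2 HX2 HE. set (a := (al ^ 2 + be ^ 2) ^ 2) in *.
  set (g := a - b). assert (Hg : 0 < g) by (unfold g; lra).
  rewrite Hc in HE. replace b with (a - g) in HE by (unfold g; ring).
  destruct (train_form_positive al be g r1 X1 r2 X2 Hal Hbe Hg Hr1 HX1 Hr2 HX2 HE)
    as (n & Hn & Hform).
  set (L := INR n * (2 * X1 + 2 * X2)) in *.
  assert (HL : 0 < L) by (apply Rmult_lt_0_compat; [now apply lt_0_INR|lra]).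
  destruct (train_lipschitz X1 r2 X2 n Hr2 HX2) as [Lv HLv].
  assert (HK := green_decaying al be Hal Hbe).
  destruct (discretised_form_negative _ _ _ _ g _ _ Lv L HK Hg HL HLv
     (fun x => train_bound X1 r2 X2 n x HX1 HX2)) as (d & n0 & Hd & Hneg);
    [|exact Hform|].
  { intros x Hx. apply train_outside; [assumption..|]. fold L.
    unfold Rabs in Hx. destruct (Rcase_abs x); [left; lra|right; lra]. }
  destruct free_ultrafilter_exists as [F HF].
  assert (Ha : 0 < a) by lra.
  set (kap := 1 / a). assert (Hkap : 0 < kap) by (apply Rdiv_lt_0_compat; lra).
  destruct (grid_compactness F _ _ _ _ g kap L d n0 HF HK Hg Hkap HL Hd Hneg)
    as (u & [Lu HLu] & Hu0 & Hu).
  set (V := fun y => g * Rmax 0 (u y - kap)) in *.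
  assert (HVl : lipschitz (g * Lu) V).
  { intros x y. unfold V. rewrite <- Rmult_minus_distr_l, Rabs_mult, Rabs_pos_eq by lra.
    rewrite Rmult_assoc. apply Rmult_le_compat_l; [lra|].
    eapply Rle_trans; [apply Rmax_0_lipschitz|].
    replace (u x - kap - (u y - kap)) with (u x - u y) by ring. apply HLu. }
  assert (HVc : forall y, continuous V y) by (intros; now apply lipschitz_continuous with (g * Lu)).
  assert (HVp : forall y, 0 <= V y) by (intros; apply Rmult_le_pos; [lra|apply Rmax_l]).
  destruct (integral_equation_ode al be V u _ L Hal Hbe HL HVc HVp Hu)
    as (u1 & u2 & u3 & D0 & D1 & D2 & D3 & V0 & V1).
  rewrite <- Hc in D3. fold a in D3.
  set (ys := fun k : nat => match k with
    | 0%nat => fun s => kap - u s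
    | 1%nat => fun s => - u1 s
    | 2%nat => fun s => - u2 s
    | 3%nat => fun s => - u3 s
    | _ => fun s => - (V s - c ^ 2 * u2 s - a * u s)
    end).
  exists (fun x t => ys 0%nat (x - c * t)).
  assert (Hopp : forall f x (l : R), is_derive f x l -> is_derive (fun x => - f x) x (- l))
    by (intros f x l; apply (is_derive_opp (V := R_NormedModule))).
  assert (Hcu : forall f f' : R -> R, (forall x, is_derive f x (f' x)) -> forall x, continuous f x).
  { intros f f' Hf x. apply (ex_derive_continuous (V := R_NormedModule) f). now exists (f' x). }
  apply travelling_wave_of_profile.
  - intros k x Hk. destruct k as [|[|[|[|k]]]]; [| | | |lia]; simpl ys.
    + apply (is_derive_Rext (fun s => - u s + kap)); [intros; ring|].
      apply (is_derive_eq _ _ (- u1 x + 0)); [|ring].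
      apply (is_derive_plus (V := R_NormedModule)); [now apply Hopp|].
      apply (is_derive_const (V := R_NormedModule) kap).
    + now apply Hopp.
    + now apply Hopp.
    + now apply Hopp.
  - intros x. simpl ys. apply (continuous_opp (V := R_NormedModule)).
    apply (continuous_minus (V := R_NormedModule)); [apply (continuous_minus (V := R_NormedModule))|].
    + apply HVc.
    + apply (continuous_scal_r (V := R_NormedModule)). now apply (Hcu u2 u3).
    + apply (continuous_scal_r (V := R_NormedModule)). now apply (Hcu u u1).
  - intros s. simpl ys. unfold V, pos_part, neg_part, g.
    replace (- (kap - u s)) with (u s - kap) by ring.
    assert (Hak : a * kap = 1) by (unfold kap; field; lra).
    unfold Rmax. repeat destruct Rle_dec; nra.
  - apply (vanishing_le _ (fun s => Rabs (u s))); [now apply vanishing_abs|].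
    intros s. simpl ys. fold kap. replace (kap - u s - kap) with (- u s) by ring.
    rewrite Rabs_Ropp. apply Rle_refl.
  - apply (vanishing_le _ (fun s => Rabs (u1 s))); [now apply vanishing_abs|].
    intros s. simpl ys. rewrite Rabs_Ropp. apply Rle_refl.
  - exists 0. simpl ys. fold kap. lra.
Qed.

(** The profiles are stretched by lam = |c| / sqrt 2, for which lam^4 = c^4 / 4. The
    energy of one period, multiplied by lam^3, is then b times the denominator of
    B(a/b) minus c^4 / 4 times its numerator. *)
Theorem theorem15 (a b : R) (hb : 0 < b) (hab : b < a)
  (x1 x2 p1 p2 : R) (hx1 : 0 < x1) (hx2 : 0 < x2) (hp1 : 0 < p1) (hp2 : 0 < p2)
  (hB : Bfun p1 p2 x1 x2 (a / b) > b / a)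
  (c : R)
  (hc : root4 (4 * b / Bfun p1 p2 x1 x2 (a / b)) < Rabs c < root4 (4 * a)) :
  exists u : R -> R -> R, travelling_wave_solution a b c u.
Proof.
  destruct hc as [hc1 hc2].
  assert (HB0 : 0 < Bfun p1 p2 x1 x2 (a / b)).
  { apply Rlt_trans with (2 := hB). apply Rdiv_lt_0_compat; lra. }
  apply root4_lt_abs in hc1; [|apply Rlt_le, Rdiv_lt_0_compat; lra].
  apply abs_lt_root4 in hc2; [|lra].
  replace (sqrt (4 * a)) with (2 * sqrt a) in hc2.
  2:{ rewrite sqrt_mult by lra. f_equal. replace 4 with (2 ^ 2) by ring.
      rewrite sqrt_pow2; lra. }
  assert (Hsa : sqrt a ^ 2 = a) by (apply pow2_sqrt; lra).
  assert (Hc0 : c <> 0).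
  { intros ->. assert (0 < 4 * b / Bfun p1 p2 x1 x2 (a / b)) by (apply Rdiv_lt_0_compat; lra).
    simpl in hc1. lra. }
  assert (Hc2 : 0 < c ^ 2) by (generalize (pow2_gt_0 c Hc0); lra).
  set (al := sqrt ((sqrt a - c ^ 2 / 2) / 2)). set (be := sqrt ((sqrt a + c ^ 2 / 2) / 2)).
  assert (Hal : 0 < al) by (apply sqrt_lt_R0; lra).
  assert (Hbe : 0 < be) by (apply sqrt_lt_R0; lra).
  assert (Hal2 : al ^ 2 = (sqrt a - c ^ 2 / 2) / 2) by (apply pow2_sqrt; lra).
  assert (Hbe2 : be ^ 2 = (sqrt a + c ^ 2 / 2) / 2) by (apply pow2_sqrt; lra).
  assert (Ea : (al ^ 2 + be ^ 2) ^ 2 = a).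
  { rewrite Hal2, Hbe2. transitivity (sqrt a ^ 2); [field|exact Hsa]. }
  set (lam := sqrt (c ^ 2 / 2)).
  assert (Hlam : 0 < lam) by (apply sqrt_lt_R0; lra).
  assert (Hlam2 : lam ^ 2 = c ^ 2 / 2) by (apply pow2_sqrt; lra).
  rewrite <- Ea.
  apply (homoclinic_travelling_wave al be b (x1 / lam) (lam * sqrt p1)
           (x2 / lam) (lam * sqrt p2) c Hal Hbe).
  - rewrite Ea. lra.
  - rewrite Hal2, Hbe2. field.
  - apply Rmult_lt_0_compat; [exact Hlam|now apply sqrt_lt_R0].
  - now apply Rdiv_lt_0_compat.
  - apply Rmult_lt_0_compat; [exact Hlam|now apply sqrt_lt_R0].
  - now apply Rdiv_lt_0_compat.
  - rewrite Ea, !bump_energy_scaled by assumption.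
    unfold Bfun in *.
    set (num := 2 * Mfun p1 x1 + 2 * Mfun p2 x2 - Nfun p1 x1 - Nfun p2 x2) in *.
    set (den := Gfun p1 x1 * (a / b) + Gfun p2 x2) in *.
    assert (Hden : 0 < den).
    { assert (Hge : 0 <= den).
      { apply Rplus_le_le_0_compat; [apply Rmult_le_pos|]; try now apply Gfun_nonneg.
        apply Rlt_le, Rdiv_lt_0_compat; lra. }
      destruct Hge as [H|H]; [exact H|exfalso].
      rewrite <- H in HB0. unfold Rdiv in HB0. rewrite Rinv_0, Rmult_0_r in HB0. lra. }
    assert (Hnum : 0 < num).
    { replace num with (num / den * den) by (field; lra). now apply Rmult_lt_0_compat. }
    assert (Hkey : 4 * b * den < c ^ 4 * num).
    { replace (4 * b * den) with (4 * b / (num / den) * num) by (field; split; lra).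
      now apply Rmult_lt_compat_r. }
    assert (Hbden : b * den = a * Gfun p1 x1 + b * Gfun p2 x2) by (unfold den; field; lra).
    apply Rmult_lt_reg_l with (lam ^ 3); [now apply pow_lt|]. rewrite Rmult_0_r.
    replace (_ * _) with (lam ^ 2 * lam ^ 2 * (Nfun p1 x1 + Nfun p2 x2)
       - c ^ 2 * lam ^ 2 * (Mfun p1 x1 + Mfun p2 x2)
       + (a * Gfun p1 x1 + b * Gfun p2 x2)) by (field; lra).
    rewrite Hlam2, <- Hbden. unfold num in Hkey. lra.
Qed.
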